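(* Let $\mathscr D$ be the set of oriented admissible deletion data for a fixed Niemeier lattice $\Gamma=N(A_1^{24})$, Golay trio $\mathcal T$ and root labels, as defined in the context. The group of independent root sign changes has eight orbits on $\mathscr D$, each of size $2^{19}$. The full group $\operatorname{Aut}(\Gamma)_{\mathcal T}$ is transitive on $\mathscr D$.
   Context: Let $r_1,\dots,r_{24}$ be pairwise orthogonal vectors of norm $2$, $\mathcal G\subset\mathbf F_2^{24}$ the binary Golay code, and $\Gamma=\{\frac12\sum a_ir_i:a_i\in\mathbf Z,\ (a_i\bmod2)\in\mathcal G\}$, the even unimodular Niemeier lattice $N(A_1^{24})$ with roots $\pm r_i$. Let $\mathcal T=\{O_1,O_2,O_3\}$ be a trio (a partition of $\{1,\dots,24\}$ into supports of three weight-$8$ words of $\mathcal G$). Let $H_2=\mathbf F_2^2$ with non-zero elements $h_1,h_2,h_3$. An admissible quotient map is a homomorphism $\lambda:\Gamma\to H_2$ with $\lambda(r_j)=h_i$ for $j\in O_i$ (the root labels) such that for every non-zero linear $\chi:H_2\to\mathbf F_2$, the unique class $\bar t_\chi\in\Gamma/2\Gamma$ with $(t_\chi,a)\equiv\chi(\lambda(a))\pmod2$ for all $a\in\Gamma$ satisfies $t_\chi^2/2\equiv1\pmod2$. Put $K=\ker\lambda$, $A_K=K^\#/K$ (where $K^\#$ is the dual lattice, containing $\Gamma$), $q_K(\bar y)=y^2\bmod2\mathbf Z$. Let $I_3=\mathbf Ze_1\oplus\mathbf Ze_2\oplus\mathbf Ze_3$ with $e_i$ orthonormal, $c=e_1+e_2+e_3$,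 $S=\{\sum n_ie_i:n_1\equiv n_2\equiv n_3\pmod2\}$, $A_S=S^\#/S$, and $q_{S,c}(\bar x)=x^2-(x,c)\bmod2\mathbf Z$. A compatible gluing for $\lambda$ is a group isomorphism $\varphi:A_S\to A_K$ with $q_K(\varphi(a))=-q_{S,c}(a)$ for all $a$, sending the class of $e_i$ to the class of $r_j$ for $j\in O_i$ ($i=1,2,3$). $\mathscr D$ is the set of pairs $(\lambda,\varphi)$ with $\lambda$ an admissible quotient map and $\varphi$ a compatible gluing for $\lambda$. $\operatorname{Aut}(\Gamma)_{\mathcal T}$ is the group of isometries of $\Gamma$ whose induced permutation of the $24$ root pairs $\{\pm r_i\}$ maps the trio $\mathcal T$ to itself (possibly permuting the octads). If $g$ induces the permutation $\pi$ of the octads, with $\pi_*$ the automorphism $h_i\mapsto h_{\pi(i)}$ of $H_2$ and $s_\pi$ the isometry $e_i\mapsto e_{\pi(i)}$, then $g$ acts by $(\lambda,\varphi)\mapsto(\pi_*\circ\lambda\circ g^{-1},\ \bar g\circ\varphi\circ \bar s_\pi^{-1})$, where $\bar g:A_K\to A_{g(K)}$ and $\bar s_\pi:A_S\to A_S$ are induced. The group of independent root sign changes is the subgroup $(C_2)^{24}$ of isometries $r_i\mapsto\pm r_i$. *)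

(* Defs.v *)
From HB Require Import structures.
From mathcomp Require Import all_boot all_order fingroup perm all_algebra.
From mathcomp Require Import boolp classical_sets functions cardinality.

Set Implicit Arguments.
Unset Strict Implicit.
Unset Printing Implicit Defensive.

Import GRing.Theory Num.Theory.

Local Open Scope classical_set_scope.
Local Open Scope ring_scope.

(** * The binary Golay code *)

(* Row i is the i-th shift of the generator polynomial
   1 + X^2 + X^4 + X^5 + X^6 + X^10 + X^11 of the cyclic [23, 12, 7] Golay code
   (coordinates 0..22), extended by the parity bit in coordinate 23. *)
Definition golay_gen : 'M['F_2]_(12, 24) :=
  \matrix_(i < 12, j < 24)
    ((j == 23%N :> nat) ||
     ((i <= j)%N && ((j - i)%N \in [:: 0; 2; 4; 5; 6; 10; 11]%N)))%:R.

Definition golay (w : 'rV['F_2]_24) : bool := (w <= golay_gen)%MS.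

Definition octad (B : {set 'I_24}) : bool :=
  (#|B| == 8%N) && golay (\row_j (j \in B)%:R).

Definition is_trio (O : 'I_3 -> {set 'I_24}) : Prop :=
  (forall i, octad (O i)) /\ finset.partition (O @: 'I_3) [set: 'I_24]%SET.

(** * Rational quadratic spaces, lattices and discriminant groups *)

Definition dot n (x y : 'rV[rat]_n) : rat := \sum_j x 0 j * y 0 j.

Definition eqmod2 (u v : rat) : Prop := (u - v) / 2 \is a Num.int.

Definition dual_lat n (b : 'rV[rat]_n -> 'rV[rat]_n -> rat)
    (L : set 'rV[rat]_n) : set 'rV[rat]_n :=
  [set y | forall a, L a -> b y a \is a Num.int].

Definition lat_coset n (L : set 'rV[rat]_n) (y : 'rV[rat]_n) : set 'rV[rat]_n :=
  [set y + a | a in L].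

(* The elements of L^#/L are literally the cosets of L. *)
Definition discr n (b : 'rV[rat]_n -> 'rV[rat]_n -> rat) (L : set 'rV[rat]_n) :
  set (set 'rV[rat]_n) := [set lat_coset L y | y in dual_lat b L].

Definition addset n (X Y : set 'rV[rat]_n) : set 'rV[rat]_n :=
  [set z | exists x y, [/\ X x, Y y & z = x + y]].

Definition mulset n (X : set 'rV[rat]_n) (g : 'M[rat]_n) : set 'rV[rat]_n :=
  [set x *m g | x in X].

(** * The Niemeier lattice N(A_1^24) *)

(* Vectors of the ambient space are given by their coordinates in the basis
   r_1, .., r_24, so the form is twice the standard one. *)
Definition V := 'rV[rat]_24.
Definition form24 (x y : V) : rat := 2 * dot x y.
Definition root_vec (j : 'I_24) : V := delta_mx 0 j.

Definition Gamma : set V :=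
  [set x | exists a : 'rV[int]_24,
     golay (map_mx (fun z : int => z%:~R) a) /\
     x = 2^-1 *: \sum_j (a 0 j)%:~R *: root_vec j].

(** * Admissible quotient maps *)

Definition H2 := 'rV['F_2]_2.

(* A homomorphism Gamma -> H2 is encoded as a function on V vanishing outside
   Gamma, so that equality of homomorphisms is equality of functions. *)
Definition is_hom (lam : V -> H2) : Prop :=
  (forall x y, Gamma x -> Gamma y -> lam (x + y) = lam x + lam y) /\
  (forall x, ~ Gamma x -> lam x = 0).

(* As Gamma is even, t^2/2 mod 2 depends only on the class of t in
   Gamma/2Gamma; this class exists and is unique because Gamma is unimodular. *)
Definition admissible (h : 'I_3 -> H2) (O : 'I_3 -> {set 'I_24})
    (lam : V -> H2) : Prop :=
  [/\ is_hom lam,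
      forall i j, j \in O i -> lam (root_vec j) = h i
    & forall chi : {linear H2 -> ('F_2)^o}, (exists x, chi x != 0) ->
      exists t, [/\ Gamma t,
        forall a, Gamma a -> eqmod2 (form24 t a) (nat_of_ord (chi (lam a)))%:R
        & eqmod2 (form24 t t / 2) 1]].

Definition ker_map (lam : V -> H2) : set V := [set x | Gamma x /\ lam x = 0].

(** * Compatible gluings *)

Definition W := 'rV[rat]_3.
Definition e_vec (i : 'I_3) : W := delta_mx 0 i.
Definition c_vec : W := \sum_i e_vec i.

Definition lat_S : set W :=
  [set x | exists n : 'rV[int]_3,
     (forall i j, (n ord0 i = n ord0 j %[mod 2])%Z) /\
     x = \sum_i (n 0 i)%:~R *: e_vec i].

Definition A_S : set (set W) := discr (@dot 3) lat_S.
Definition A_K (lam : V -> H2) : set (set V) := discr form24 (ker_map lam).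

(* A map out of A_S is encoded as a function on sets of vectors with value set0
   outside A_S.  The quadratic condition does not depend on the representatives
   x and y. *)
Definition compatible (O : 'I_3 -> {set 'I_24}) (lam : V -> H2)
    (phi : set W -> set V) : Prop :=
  [/\ set_bij A_S (A_K lam) phi /\ (forall X, ~ A_S X -> phi X = set0),
      forall X Y, A_S X -> A_S Y -> phi (addset X Y) = addset (phi X) (phi Y),
      forall X x y, A_S X -> X x -> phi X y ->
        eqmod2 (form24 y y) (- (dot x x - dot x c_vec))
    & forall i j, j \in O i ->
        phi (lat_coset lat_S (e_vec i)) = lat_coset (ker_map lam) (root_vec j)].

Definition datum : Type := (V -> H2) * (set W -> set V).

Definition deletion_data (h : 'I_3 -> H2) (O : 'I_3 -> {set 'I_24}) :
  set datum :=
  [set d | admissible h O d.1 /\ compatible O d.1 d.2].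

(** * Automorphisms and their action *)

(* Isometries of Gamma extend uniquely to V; g acts by x |-> x *m g. *)
Definition isometry (g : 'M[rat]_24) : Prop :=
  (forall x y, form24 (x *m g) (y *m g) = form24 x y) /\ mulset Gamma g = Gamma.

Definition root_perm (g : 'M[rat]_24) (sigma : 'S_24) : Prop :=
  forall j, root_vec j *m g = root_vec (sigma j) \/
            root_vec j *m g = - root_vec (sigma j).

Definition octad_perm (O : 'I_3 -> {set 'I_24}) (g : 'M[rat]_24) (pi : 'S_3) :
  Prop :=
  exists2 sigma : 'S_24, root_perm g sigma &
    forall i, (sigma @: O i)%SET = O (pi i).

Definition Aut_trio (O : 'I_3 -> {set 'I_24}) : set 'M[rat]_24 :=
  [set g | isometry g /\ exists pi, octad_perm O g pi].

Definition sign_changes : set 'M[rat]_24 :=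
  [set g | isometry g /\ root_perm g 1%g].

(* The automorphism h_i |-> h_(pi i) of H2, for h an enumeration of the
   non-zero elements. *)
Definition pi_star (h : 'I_3 -> H2) (pi : 'S_3) (x : H2) : H2 :=
  if [pick i | h i == x] is Some i then h (pi i) else 0.

Definition act (h : 'I_3 -> H2) (g : 'M[rat]_24) (pi : 'S_3) (d : datum) :
  datum :=
  (fun x => pi_star h pi (d.1 (x *m invmx g)),
   fun X => mulset (d.2 (mulset X (invmx (perm_mx pi)))) g).

(* The permutation pi of the octads is determined by g. *)
Definition datum_orbit (h : 'I_3 -> H2) (O : 'I_3 -> {set 'I_24})
    (G : set 'M[rat]_24) (d : datum) : set datum :=
  [set d' | exists g pi, [/\ G g, octad_perm O g pi & d' = act h g pi d]].

(* Main.v *)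
(* A deletion datum is the same thing as a frame t_1, t_2, t_3 in Gamma with
   t_1 + t_2 + t_3 = 0, t_i^2 = 2 mod 8 and odd half-coordinates exactly off O_i,
   up to (t_i) ~ (t_i') when each (t_i - t_i')/2 lies in K: the quotient map is
   read off from lambda(a) = ((t_i, a) mod 2)_i, and the gluing is induced by
   the linear map e_i |-> t_i.

   The sign change along a set Y fixes lambda exactly when the restriction of Y
   to the complement of each octad is a Golay word.  These Y form a code of
   dimension 6, and such a Y multiplies the gluing by (-1)^eps(Y), where
   eps(Y) = (t_1, t_2 restricted to Y) mod 2 is linear on the code and takes the
   value 1 on each octad.  The stabilizer of a datum is the kernel of eps, of order
   2^5, whence the orbit size; linear duality for the self-dual Golay code shows
   that eps determines the sign orbit, and there are 2^6/2^3 = 8 candidates for eps.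
   They are permuted transitively by the stabilizer of the three octads in M24.

   The facts on M24 are reduced to one trio, by transitivity on octads and then on
   the octads disjoint from a given one, and checked there by computation. *)
Require Import Defs.
From HB Require Import structures.
From mathcomp Require Import all_boot all_order fingroup perm all_algebra.
From mathcomp Require Import ring.
From mathcomp Require Import boolp classical_sets functions cardinality.

Set Implicit Arguments.
Unset Strict Implicit.
Unset Printing Implicit Defensive.

Import Order.TTheory GRing.Theory Num.Theory.
Local Open Scope ring_scope.

(** * The binary Golay code *)

(** The norm condition 2 mod 8 is the quadratic condition of the gluing: [(c - e_i)/2] is dual to S
    with [-q = 1/2] and goes to [-t_i/2], so [t_i^2/4 = 1/2] mod 2. The same condition forces [eps]
    to be 1 on the octads, and it leaves the three values on a complement of the octads in the code
    free. That [eps] is a complete invariant is a solvability question. A sign change Y moves [t_i]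
    by twice its restriction to Y, so carrying one frame into another modulo [2 Gamma] is a linear
    system for Y over F_2 modulo the Golay code. Its obstructions are pairs of Golay words; each
    pair glues to a word Z of the trio code, and the obstruction is the difference of the two values
    of [eps] at Z. The computations never run over all 2^24 words or over M24: they use the 4096
    Golay words and products of powers of a few permutations. *)

Notation word := 'rV['F_2]_24.

Lemma F2_cases (x : 'F_2) : x = 0 \/ x = 1.
Proof. by case: x => [[|[|n]] //= lt_n]; [left|right]; apply: val_inj. Qed.

Lemma F2_natr (x : 'F_2) : (x != 0)%:R = x.
Proof. by case: (F2_cases x) => ->. Qed.

Lemma F2_addxx (x : 'F_2) : x + x = 0.
Proof. by case: (F2_cases x) => ->; apply: val_inj. Qed.

Lemma F2_natr_addb (a b : bool) : (a (+) b)%:R = a%:R + b%:R :> 'F_2.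
Proof. by case: a; case: b; apply: val_inj. Qed.

Lemma F2_natr_odd n : n%:R = (odd n)%:R :> 'F_2.
Proof.
by elim: n => // n IH; rewrite mulrS IH -(F2_natr_addb true).
Qed.

Lemma F2_natr_inj (a b : bool) : a%:R = b%:R :> 'F_2 -> a = b.
Proof. by case: a; case: b. Qed.

(** Bit sequences are the computable mirror of words: the finite checks run on them by [vm_compute]
    and are carried back through [word_of] and [bits_of]. *)
Definition word_of (s : bitseq) : word := \row_(j < 24) (nth false s j)%:R.
Definition bits_of (w : word) : bitseq := [seq w 0 j != 0 | j <- enum 'I_24].

Lemma size_bits_of w : size (bits_of w) = 24%N.
Proof. by rewrite size_map size_enum_ord. Qed.

Lemma nth_bits_of w (j : 'I_24) : nth false (bits_of w) j = (w 0 j != 0).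
Proof. by rewrite (nth_map j) ?size_enum_ord ?nth_ord_enum. Qed.

Lemma bits_ofK w : word_of (bits_of w) = w.
Proof. by apply/rowP=> j; rewrite mxE nth_bits_of F2_natr. Qed.

Definition xors (s t : bitseq) : bitseq := [seq p.1 (+) p.2 | p <- zip s t].
Definition dots (s t : bitseq) : nat := count id [seq p.1 && p.2 | p <- zip s t].

Lemma size_xors s t : size s = 24%N -> size t = 24%N -> size (xors s t) = 24%N.
Proof. by move=> hs ht; rewrite size_map size_zip hs ht. Qed.

Lemma word_of_xors s t : size s = 24%N -> size t = 24%N ->
  word_of (xors s t) = word_of s + word_of t.
Proof.
move=> hs ht; apply/rowP=> j; rewrite !mxE /xors.
by rewrite (nth_map (false, false)) ?size_zip ?hs ?ht ?nth_zip ?hs ?ht ?F2_natr_addb.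
Qed.

Lemma word_of_inj s t : size s = 24%N -> size t = 24%N ->
  word_of s = word_of t -> s = t.
Proof.
move=> hs ht eq_st; apply: (@eq_from_nth _ false); first by rewrite ht.
rewrite hs => i lt_i; have /rowP/(_ (Ordinal lt_i)) := eq_st.
by rewrite !mxE => /F2_natr_inj.
Qed.

Lemma count_ord (s : bitseq) n : size s = n ->
  count id s = (\sum_(j < n) nth false s j)%N.
Proof.
move=> <-; rewrite -sum1_count (big_nth false) big_mkord big_mkcond /=.
by apply: eq_bigr => i _; case: nth.
Qed.

Lemma dots_word s t : size s = 24%N -> size t = 24%N ->
  \sum_j word_of s 0 j * word_of t 0 j = (dots s t)%:R.
Proof.
move=> hs ht; rewrite /dots (@count_ord _ 24) ?size_map ?size_zip ?hs ?ht //.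
rewrite natr_sum; apply: eq_bigr => j _; rewrite !mxE.
rewrite (nth_map (false, false)) ?size_zip ?hs ?ht ?nth_zip ?hs ?ht //=.
by case: nth; case: nth; rewrite ?mulr0 ?mulr1.
Qed.

Definition golay_row (i : nat) : bitseq :=
  [seq (j == 23) || ((i <= j) && (j - i \in [:: 0; 2; 4; 5; 6; 10; 11])) | j <- iota 0 24]%N.
Definition golay_rows : seq bitseq := [seq golay_row i | i <- iota 0 12].

Lemma size_golay_row i : size (golay_row i) = 24%N.
Proof. by rewrite size_map size_iota. Qed.

Lemma row_golay_gen (i : 'I_12) : row i golay_gen = word_of (golay_row i).
Proof.
by apply/rowP=> j; rewrite !mxE (nth_map 0%N) ?size_iota // nth_iota.
Qed.


Lemma golayP w : reflect (exists c : 'rV_12, w = c *m golay_gen) (golay w).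
Proof. exact: submxP. Qed.

Lemma golay0 : golay 0. Proof. exact: sub0mx. Qed.

Lemma golayD v w : golay v -> golay w -> golay (v + w).
Proof. exact: addmx_sub. Qed.

Lemma word_of0 : word_of (nseq 24 false) = 0.
Proof. by apply/rowP=> j; rewrite !mxE nth_nseq; case: ifP. Qed.

Definition span_bits (L : seq bitseq) : seq bitseq :=
  foldr (fun r L => L ++ [seq xors r s | s <- L]) [:: nseq 24 false] L.

Lemma span_bits_size L : all (fun s => size s == 24%N) L ->
  {in span_bits L, forall s, size s = 24%N}.
Proof.
elim: L => [_ s|r L IH /= /andP[/eqP hr /IH {}IH] s]; first by rewrite inE => /eqP->.
by rewrite mem_cat => /orP[/IH//|/mapP[t /IH ht ->]]; rewrite size_xors.
Qed.

Lemma mem_span_bits (I : eqType) (r : seq I) (f : I -> bitseq) (c : I -> 'F_2) :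
  (forall i, size (f i) = 24%N) ->
  exists2 s, s \in span_bits [seq f i | i <- r] &
    word_of s = \sum_(i <- r) c i *: word_of (f i).
Proof.
move=> hf; elim: r => [|i r [s hs es]].
  by exists (nseq 24 false); rewrite ?inE // big_nil word_of0.
have ss : size s = 24%N.
  by apply: span_bits_size hs; rewrite all_map; apply/allP => j _ /=; rewrite hf.
rewrite big_cons; case: (F2_cases (c i)) => ->.
  by exists s; rewrite /= ?mem_cat ?hs // scale0r add0r.
exists (xors (f i) s); last by rewrite word_of_xors // es scale1r.
by rewrite /= mem_cat map_f ?orbT.
Qed.

Definition golay_words : seq bitseq := span_bits golay_rows.

Lemma golay_wordsP w : golay w -> bits_of w \in golay_words.
Proof.
case/golayP=> c ->.
(* The rows are listed over naturals, so the coefficients of [c] are extended from ordinals by the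
   default 0. *)
have [|s hs es] := @mem_span_bits _ (iota 0 12) golay_row
  (fun i => if insub i is Some j then c 0 j else 0); first exact: size_golay_row.
suff -> : c *m golay_gen = word_of s.
  suff -> : bits_of (word_of s) = s by [].
  apply: word_of_inj; rewrite ?size_bits_of ?bits_ofK //.
  by apply: span_bits_size hs.
rewrite es -[iota 0 12]/(index_iota 0 12) big_mkord; apply/rowP=> j.
by rewrite mxE summxE; apply: eq_bigr => i _; rewrite valK -row_golay_gen !mxE.
Qed.

Definition wdot (v w : word) : 'F_2 := \sum_j v 0 j * w 0 j.

Lemma mulmx_trE (v w : word) : v *m w^T = (wdot v w)%:M.
Proof. by rewrite [LHS]mx11_scalar mxE; congr (_%:M); apply: eq_bigr => j _; rewrite mxE. Qed.

Lemma golay_gen_orth : golay_gen *m golay_gen^T = 0.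
Proof.
apply/matrixP=> i k; rewrite !mxE.
have -> : \sum_j golay_gen i j * golay_gen^T j k =
   \sum_j word_of (golay_row i) 0 j * word_of (golay_row k) 0 j.
  by apply: eq_bigr => j _; rewrite -!row_golay_gen !mxE.
rewrite dots_word ?size_golay_row // F2_natr_odd.
have h : all (fun i => all (fun k => ~~ odd (dots (golay_row i) (golay_row k)))
    (iota 0 12)) (iota 0 12) by vm_compute.
have mem12 (l : 'I_12) : (l : nat) \in iota 0 12 by rewrite mem_iota ltn_ord.
by have /allP/(_ _ (mem12 k))/negPf-> := allP h _ (mem12 i).
Qed.

(** Shift [i] of the generator polynomial starts with 1 in column [i], so the first 12 columns,
    selected by [U], form a unitriangular matrix. *)
Lemma golay_gen_free : row_free golay_gen.
Proof.
pose U : 'M['F_2]_(24, 12) := \matrix_(j, i) (j == i :> nat)%:R.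
have h : golay_gen *m U \in unitmx.
  rewrite unitmxE -det_tr det_trig.
    rewrite big1 ?unitr1 // => i _; rewrite !mxE.
    have lt_i : (i < 24)%N by apply: leq_trans (ltn_ord i) _.
    rewrite (bigD1 (Ordinal lt_i)) //= !mxE /= eqxx leqnn subnn /= orbT mulr1 big1 ?addr0 // => j nj.
    by rewrite !mxE -[j == i :> nat]/(j == Ordinal lt_i) (negPf nj) mulr0.
  apply/is_trig_mxP=> i k lt_ik; rewrite !mxE big1 // => j _; rewrite !mxE.
  case: (eqVneq (nat_of_ord j) i) => [->|]; last by rewrite mulr0.
  rewrite [(k <= i)%N]leqNgt lt_ik /= ltn_eqF ?mul0r //.
  by apply: leq_trans (ltn_ord i) _.
by apply/row_freeP; exists (U *m invmx (golay_gen *m U)); rewrite mulmxA mulmxV.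
Qed.

(** The code is contained in its annihilator, and both have rank 12 = 24 - 12. *)
Lemma golay_dual w : golay w = (w *m golay_gen^T == 0).
Proof.
have s : (golay_gen <= kermx golay_gen^T)%MS by apply/sub_kermxP/golay_gen_orth.
have le : (kermx golay_gen^T <= golay_gen)%MS.
  by rewrite -(mxrank_leqif_sup s) mxrank_ker mxrank_tr (eqP golay_gen_free).
apply/idP/eqP => [h|h]; first by apply/sub_kermxP; apply: submx_trans h s.
by apply: submx_trans le; apply/sub_kermxP.
Qed.

Lemma golay_orth v w : golay v -> golay w -> wdot v w = 0.
Proof.
case/golayP=> c -> /golayP[d ->].
have := mulmx_trE (c *m golay_gen) (d *m golay_gen).
rewrite trmx_mul mulmxA -(mulmxA c) golay_gen_orth mulmx0 mul0mx => /(congr1 (fun M : 'M_1 => M 0 0)).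
by rewrite !mxE mulr1n.
Qed.

Lemma golay_self_dual w : (forall v, golay v -> wdot w v = 0) -> golay w.
Proof.
move=> h; rewrite golay_dual; apply/eqP/rowP=> i; rewrite !mxE.
have /h : golay (row i golay_gen) by apply: row_sub.
by rewrite /wdot => e; rewrite -[RHS]e; apply: eq_bigr => j _; rewrite !mxE.
Qed.

(** By self-duality the generator rows serve as parity checks. *)
Definition golay_test (s : bitseq) : bool :=
  all (fun r => ~~ odd (dots s r)) golay_rows.

Lemma golay_word_of s : size s = 24%N -> golay (word_of s) = golay_test s.
Proof.
move=> hs; rewrite golay_dual; apply/eqP/allP => [h r /mapP[i]|h].
  rewrite mem_iota => /andP[_ lt_i] ->; move/rowP: h => /(_ (Ordinal lt_i)).
  rewrite !mxE (eq_bigr (fun j => word_of s 0 j * word_of (golay_row i) 0 j)).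
    by rewrite dots_word ?size_golay_row // F2_natr_odd; case: odd.
  by move=> j _; rewrite -(row_golay_gen (Ordinal lt_i)) !mxE.
apply/rowP=> i; rewrite !mxE (eq_bigr (fun j => word_of s 0 j * word_of (golay_row i) 0 j)).
  rewrite dots_word ?size_golay_row // F2_natr_odd (negPf (h _ _)) //.
  by apply: map_f; rewrite mem_iota ltn_ord.
by move=> j _; rewrite -row_golay_gen !mxE.
Qed.

Definition weight (w : word) : nat := #|[set j | w 0 j != 0]|.

Lemma weight_bits w : weight w = count id (bits_of w).
Proof.
rewrite (@count_ord _ 24) ?size_bits_of // /weight -sum1_card big_mkcond /=.
by apply: eq_bigr => j _; rewrite nth_bits_of inE; case: ifP.
Qed.

Lemma golay_weight w : golay w -> (4 %| weight w)%N.
Proof.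
move/golay_wordsP; rewrite weight_bits; move: (bits_of w); apply/allP.
by vm_compute.
Qed.

(** * Automorphisms of the Golay code *)

Definition golay_aut (s : 'S_24) : Prop :=
  forall w, golay w -> golay (col_perm s w).

Lemma golay_aut1 : golay_aut 1%g.
Proof. by move=> w; rewrite col_perm1. Qed.

Lemma golay_autM s t : golay_aut s -> golay_aut t -> golay_aut (s * t)%g.
Proof. by move=> hs ht w /ht/hs; rewrite col_permM. Qed.

(** In a finite group the inverse is a power, which is why [golay_aut] can ask for one inclusion
    only. *)
Lemma golay_autV s : golay_aut s -> golay_aut s^-1%g.
Proof.
move=> hs; rewrite invg_expg; elim: _.-1 => [|n IH]; first exact: golay_aut1.
by rewrite expgS; apply: golay_autM.
Qed.

Definition perm_bits (p : seq nat) (s : bitseq) : bitseq := [seq nth false s i | i <- p].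

(** Certificate for a code automorphism given by its list of images: by linearity the 12 generator
    rows suffice. *)
Definition golay_perm (p : seq nat) : bool :=
  [&& size p == 24, uniq p, all (fun i => i < 24) p
    & all (fun r => golay_test (perm_bits p r)) golay_rows]%N.

Lemma golay_permP p : golay_perm p -> exists2 s, golay_aut s &
  forall b, col_perm s (word_of b) = word_of (perm_bits p b).
Proof.
case/and4P=> /eqP sp up /allP bp gp.
have lt_p (j : 'I_24) : (nth 0%N p j < 24)%N by apply: bp; rewrite mem_nth ?sp.
pose f (j : 'I_24) := Ordinal (lt_p j).
have f_inj : injective f.
  move=> i j /(congr1 val) /= /eqP; rewrite nth_uniq ?sp // => /eqP e; exact: val_inj.
have e b : col_perm (perm f_inj) (word_of b) = word_of (perm_bits p b).
  by apply/rowP=> j; rewrite !mxE permE (nth_map 0%N) ?sp.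
exists (perm f_inj) => // w /golayP[c ->]; rewrite col_permE -mulmxA -col_permE.
apply: submx_trans (submxMl _ _) _; apply/row_subP=> i.
rewrite -[row i _]/(row i (col_perm _ _)).
have -> : row i (col_perm (perm f_inj) golay_gen) = col_perm (perm f_inj) (row i golay_gen).
  by apply/rowP=> j; rewrite !mxE.
rewrite row_golay_gen e -/(golay _) golay_word_of ?size_map //.
by apply: (allP gp); apply: map_f; rewrite mem_iota ltn_ord.
Qed.

(* Membership through [\in] is an order of magnitude slower under [vm_compute]. *)
Fixpoint same_bits (s t : bitseq) : bool :=
  match s, t with
  | [::], [::] => true
  | true :: s', true :: t' | false :: s', false :: t' => same_bits s' t'
  | _, _ => false
  end.

Lemma same_bitsE s t : same_bits s t -> s = t.
Proof. by elim: s t => [|[] s IH] [|[] t] //= /IH->. Qed.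

Lemma has_same_bits b L : has (same_bits b) L -> b \in L.
Proof. by case/hasP=> c hc /same_bitsE->. Qed.

(** A pair [(p, n)] replaces each word by its images under the powers 0 to n - 1 of [p]. A fixed
    product of such runs covers an orbit without any closure computation. *)
Definition sweep (ps : seq (seq nat * nat)) (L : seq bitseq) : seq bitseq :=
  foldl (fun L q => flatten [seq traject (perm_bits q.1) b q.2 | b <- L]) L ps.

Lemma sweepP (Q : 'S_24 -> Prop) ps b0 L :
    (forall s t, Q s -> Q t -> Q (s * t)%g) ->
    (forall p, p \in unzip1 ps -> exists2 s, Q s &
       forall b, col_perm s (word_of b) = word_of (perm_bits p b)) ->
    (forall b, b \in L -> exists2 s, Q s & word_of b = col_perm s (word_of b0)) ->
  forall b, b \in sweep ps L -> exists2 s, Q s & word_of b = col_perm s (word_of b0).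
Proof.
move=> QM; elim: ps L => [|[p n] ps IH] L //= hg hL b.
have [s Qs es] := hg p (mem_head _ _).
apply: IH => [q hq|{}b /flatten_mapP[c /hL{hL} hc /trajectP[i _ ->]]].
  by apply: hg; rewrite inE hq orbT.
elim: i => //= i [t Qt et]; exists (s * t)%g; first exact: QM.
by rewrite -es et col_permM.
Qed.

Lemma golay_perm_fixP p b : golay_perm p -> perm_bits p b = b ->
  exists2 s, golay_aut s /\ col_perm s (word_of b) = word_of b &
    forall c, col_perm s (word_of c) = word_of (perm_bits p c).
Proof. by case/golay_permP=> s gs es eb; exists s; rewrite ?es ?eb. Qed.

(** The code is cyclic on coordinates 0 to 22; coordinate 23 is the parity bit and stays fixed. *)
Definition shift_perm : seq nat := rcons (rcons (iota 1 22) 0) 23.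

(* Found by random search in M24: the octad permutations fix the first of
   [octad_bits], the trio permutations fix all three. *)
Definition octad_perm1 : seq nat :=
  [:: 4; 16; 2; 19; 11; 10; 23; 1; 8; 7; 6; 5; 12; 18; 20; 9; 14; 21; 17; 13; 15; 22; 3; 0].
Definition octad_perm2 : seq nat :=
  [:: 4; 12; 23; 1; 6; 2; 11; 9; 14; 13; 0; 10; 17; 22; 20; 3; 16; 21; 7; 8; 18; 19; 15; 5].
Definition trio_perm1 : seq nat :=
  [:: 6; 13; 2; 3; 11; 23; 4; 18; 15; 17; 10; 0; 12; 7; 22; 8; 9; 21; 1; 20; 14; 16; 19; 5].
Definition trio_perm2 : seq nat :=
  [:: 11; 13; 2; 12; 6; 5; 4; 18; 15; 9; 10; 0; 3; 1; 14; 8; 17; 16; 7; 19; 22; 21; 20; 23].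

Definition bits_at (L : seq nat) : bitseq := [seq j \in L | j <- iota 0 24].

Definition octad_bits : seq bitseq :=
  [:: bits_at [:: 0; 2; 4; 5; 6; 10; 11; 23]%N;
      bits_at [:: 1; 3; 7; 8; 12; 13; 15; 18]%N;
      bits_at [:: 9; 14; 16; 17; 19; 20; 21; 22]%N].
(* Each word is a union of three tetrads, one in each octad of the base trio, of a
   sextet refining that trio. *)
Definition tetrad_bits : seq bitseq :=
  [:: bits_at [:: 3; 4; 5; 6; 7; 9; 10; 13; 15; 16; 17; 19]%N;
      bits_at [:: 1; 2; 6; 7; 8; 9; 10; 11; 14; 15; 16; 20]%N;
      bits_at [:: 0; 5; 7; 8; 10; 11; 12; 13; 14; 16; 17; 21]%N].

Definition octad_bit i := nth [::] octad_bits i.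
Definition tetrad_bit i := nth [::] tetrad_bits i.

Definition golay_octads : seq bitseq := [seq b <- golay_words | count id b == 8%N].

Lemma golay_octadsP w : golay w -> weight w = 8%N -> bits_of w \in golay_octads.
Proof. by move=> gw ww; rewrite mem_filter golay_wordsP // andbT -weight_bits ww. Qed.

(** This gives 4 * 3 * 9 * 23 = 2484 images, with repetitions, which cover the 759 octads. *)
Definition octad_moves : seq (seq nat * nat) :=
  [:: (shift_perm, 4); (octad_perm1, 3); (octad_perm2, 9); (shift_perm, 23)]%N.
Definition octad_orbit : seq bitseq := sweep octad_moves [:: octad_bit 0].

Lemma octad_transitive w : golay w -> weight w = 8%N ->
  exists2 s, golay_aut s & w = col_perm s (word_of (octad_bit 0)).
Proof.
move=> gw ww; rewrite -[w]bits_ofK.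
apply: (@sweepP golay_aut octad_moves _ [:: octad_bit 0]); first exact: golay_autM.
- have h : all golay_perm (unzip1 octad_moves) by vm_compute.
  by move=> p /(allP h); apply: golay_permP.
- move=> b; rewrite inE => /eqP->.
  by exists 1%g; [apply: golay_aut1|rewrite col_perm1].
have h : all (fun b => has (same_bits b) octad_orbit) golay_octads.
  by vm_compute.
exact: has_same_bits (allP h _ (golay_octadsP gw ww)).
Qed.

(** This gives 60 images, with repetitions, for the 30 octads disjoint from the first one. *)
Definition disjoint_octad_moves : seq (seq nat * nat) :=
  [:: (octad_perm1, 4); (octad_perm2, 15)]%N.
Definition disjoint_octad_orbit : seq bitseq := sweep disjoint_octad_moves [:: octad_bit 1].

Lemma octad_stab_transitive w : golay w -> weight w = 8%N ->
    (forall j, word_of (octad_bit 0) 0 j = 0 \/ w 0 j = 0) ->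
  exists2 s, golay_aut s /\ col_perm s (word_of (octad_bit 0)) = word_of (octad_bit 0)
           & w = col_perm s (word_of (octad_bit 1)).
Proof.
move=> gw ww dis; rewrite -[w]bits_ofK.
apply: (@sweepP _ disjoint_octad_moves _ [:: octad_bit 1]).
- move=> s t [gs es] [gt et]; split; first exact: golay_autM.
  by rewrite col_permM et es.
- have h : all (fun p => golay_perm p && (perm_bits p (octad_bit 0) == octad_bit 0)) (unzip1 disjoint_octad_moves).
    by vm_compute.
  by move=> p /(allP h)/andP[gp /eqP ep]; apply: golay_perm_fixP.
- move=> b; rewrite inE => /eqP->; exists 1%g; rewrite ?col_perm1 //.
  by split; [apply: golay_aut1|].
have d0 : dots (octad_bit 0) (bits_of w) == 0%N.
  rewrite /dots (@count_ord _ 24) ?size_map ?size_zip ?size_bits_of //.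
  apply/eqP/big1 => j _.
  rewrite (nth_map (false, false)) ?size_zip ?size_bits_of // nth_zip ?size_bits_of //=.
  case: (dis j); last by rewrite nth_bits_of => ->; rewrite eqxx andbF.
  by rewrite mxE; case: nth.
have h : all (fun b => (dots (octad_bit 0) b == 0%N) ==> has (same_bits b) disjoint_octad_orbit)
    golay_octads.
  by vm_compute.
exact: has_same_bits (implyP (allP h _ (golay_octadsP gw ww)) d0).
Qed.

(** * The code attached to a trio *)

(* The restriction of Y to the complement of b. *)
Definition off_word (b Y : word) : word := \row_j ((1 - b 0 j) * Y 0 j).

Lemma off_wordD b Y Z : off_word b (Y + Z) = off_word b Y + off_word b Z.
Proof. by apply/rowP=> j; rewrite !mxE mulrDr. Qed.

Lemma off_wordZ b c Y : off_word b (c *: Y) = c *: off_word b Y.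
Proof. by apply/rowP=> j; rewrite !mxE mulrCA. Qed.

Lemma col_perm_off_word s b Y :
  col_perm s (off_word b Y) = off_word (col_perm s b) (col_perm s Y).
Proof. by apply/rowP=> j; rewrite !mxE. Qed.

Definition trio_code (M : 'M['F_2]_(3, 24)) (Y : word) : bool :=
  [forall i, golay (off_word (row i M) Y)].

Lemma trio_codeP M Y : reflect (forall i, golay (off_word (row i M) Y)) (trio_code M Y).
Proof. exact: forallP. Qed.

Lemma trio_codeD M Y Z : trio_code M Y -> trio_code M Z -> trio_code M (Y + Z).
Proof.
move=> /trio_codeP hY /trio_codeP hZ; apply/trio_codeP=> i.
by rewrite off_wordD; apply: golayD.
Qed.

Lemma trio_codeZ M c Y : trio_code M Y -> trio_code M (c *: Y).
Proof.
by move=> /trio_codeP hY; apply/trio_codeP=> i; rewrite off_wordZ; apply: scalemx_sub; apply: hY.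
Qed.

Lemma trio_code0 M : trio_code M 0.
Proof. by apply/trio_codeP=> i; rewrite -(scale0r 0) off_wordZ scale0r golay0. Qed.

Lemma row_col_perm m n (s : 'S_n) (M : 'M['F_2]_(m, n)) i :
  row i (col_perm s M) = col_perm s (row i M).
Proof. by apply/rowP=> j; rewrite !mxE. Qed.

Lemma trio_code_col_perm s M Y : golay_aut s ->
  trio_code (col_perm s M) (col_perm s Y) = trio_code M Y.
Proof.
move=> gs; apply/trio_codeP/trio_codeP=> h i; last first.
  by rewrite row_col_perm -col_perm_off_word gs.
have := golay_autV gs (h i).
by rewrite row_col_perm -col_perm_off_word -col_permM mulVg col_perm1.
Qed.

Definition trio_bits : seq bitseq := octad_bits ++ tetrad_bits.

Definition base_trio : 'M['F_2]_(3, 24) := \matrix_(i, j) word_of (octad_bit i) 0 j.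
Definition base_tetrads : 'M['F_2]_(3, 24) := \matrix_(i, j) word_of (tetrad_bit i) 0 j.

Lemma row_base_trio i : row i base_trio = word_of (octad_bit i).
Proof. by apply/rowP=> j; rewrite !mxE. Qed.

Lemma row_base_tetrads i : row i base_tetrads = word_of (tetrad_bit i).
Proof. by apply/rowP=> j; rewrite !mxE. Qed.

Lemma row_base (k : 'I_(3 + 3)) :
  row k (col_mx base_trio base_tetrads) = word_of (nth [::] trio_bits k).
Proof.
have sz : size octad_bits = 3%N by [].
rewrite nth_cat sz; case: (splitP k) => i ei.
  rewrite ei (_ : k = lshift 3 i); last exact: val_inj.
  by rewrite rowKu row_base_trio.
rewrite ei addKn (_ : k = rshift 3 i); last exact: val_inj.
by rewrite rowKd row_base_tetrads.
Qed.

(* The basis dual to [trio_bits] for [dots] mod 2. *)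
Definition dual_bits : seq bitseq :=
  [seq bits_at L | L <- [:: [:: 23]; [:: 18]; [:: 22]; [:: 0; 5]; [:: 0; 11]; [:: 0; 23]]]%N.

Lemma base_free : row_free (col_mx base_trio base_tetrads).
Proof.
pose U : 'M['F_2]_(24, 3 + 3) := \matrix_(j, k) word_of (nth [::] dual_bits k) 0 j.
apply/row_freeP; exists U; apply/matrixP=> i k; rewrite !mxE.
have hk L : (L : seq bitseq) = trio_bits \/ L = dual_bits ->
    forall l : 'I_(3 + 3), size (nth [::] L l) = 24%N.
  by case=> ->; case=> [[|[|[|[|[|[|]]]]]]].
have -> : \sum_j (col_mx base_trio base_tetrads) i j * U j k =
    \sum_j word_of (nth [::] trio_bits i) 0 j * word_of (nth [::] dual_bits k) 0 j.
  by apply: eq_bigr => j _; rewrite -row_base !mxE.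
rewrite dots_word; try by apply: hk; auto.
have h : all (fun i => all (fun k =>
    odd (dots (nth [::] trio_bits i) (nth [::] dual_bits k)) == (i == k))
    (iota 0 6)) (iota 0 6) by vm_compute.
have mem6 (l : 'I_(3 + 3)) : (l : nat) \in iota 0 6 by rewrite mem_iota ltn_ord.
by have /allP/(_ _ (mem6 k))/eqP := allP h _ (mem6 i); rewrite F2_natr_odd => ->.
Qed.

Definition off_bits (b s : bitseq) : bitseq := [seq ~~ p.1 && p.2 | p <- zip b s].
Definition merge_bits (b s t : bitseq) : bitseq :=
  [seq if p.1 then p.2.1 else p.2.2 | p <- zip b (zip s t)].

Lemma bits_of_off_word b Y : size b = 24%N ->
  bits_of (off_word (word_of b) Y) = off_bits b (bits_of Y).
Proof.
move=> sb; apply: (@eq_from_nth _ false).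
  by rewrite size_bits_of size_map size_zip size_bits_of sb.
rewrite size_bits_of => i lt_i; rewrite -[i]/(nat_of_ord (Ordinal lt_i)) nth_bits_of.
rewrite (nth_map (false, false)) ?size_zip ?size_bits_of ?sb // nth_zip ?size_bits_of //=.
rewrite -[i]/(nat_of_ord (Ordinal lt_i)) nth_bits_of !mxE /=.
by case: nth; rewrite ?subrr ?mul0r ?eqxx // subr0 mul1r.
Qed.

Lemma same_bits_refl s : same_bits s s.
Proof. by elim: s => // [[]]. Qed.

Lemma off_bitsK b s : off_bits b (off_bits b s) = off_bits b s.
Proof. by elim: b s => [|[] b IH] [|c s] //=; rewrite /off_bits /= -!/(off_bits _ _) IH. Qed.

Lemma off_bitsC b c s : off_bits b (off_bits c s) = off_bits c (off_bits b s).
Proof.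
elim: b c s => [|x b IH] [|y c] [|z s] //.
by rewrite /off_bits /= -!/(off_bits _ _) IH andbCA.
Qed.

Lemma merge_off_bits b c s : size b = 24%N -> size c = 24%N -> size s = 24%N ->
  ~~ has id [seq p.1 && p.2 | p <- zip b c] ->
  merge_bits b (off_bits c s) (off_bits b s) = s.
Proof.
move=> <- sc ss; move: sc ss.
elim: b c s => [|x b IH] [|y c] [|z s] //= [sc] [ss]; rewrite negb_or => /andP[hxy h].
rewrite /merge_bits /off_bits /= -/(off_bits _ _) -/(off_bits _ _) -/(merge_bits _ _ _) IH //.
by case: x y hxy => [] [].
Qed.

Lemma size_octad_bit i : (i < 3)%N -> size (octad_bit i) = 24%N.
Proof. by case: i => [|[|[|]]]. Qed.

(** A word of the trio code is glued from its restrictions off two disjoint octads: Golay words [u]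
    and [v], vanishing on [b0] and on [b1], that agree off both. Only 32 Golay words vanish on a
    given octad, so 1024 pairs replace a search over 2^24 words. *)
Definition glue_check (b0 b1 : bitseq) (W L : seq bitseq) : bool :=
  let G0 := [seq u <- W | same_bits (off_bits b0 u) u] in
  let G1 := [seq u <- W | same_bits (off_bits b1 u) u] in
  all (fun u => all (fun v => same_bits (off_bits b1 u) (off_bits b0 v) ==>
    has (same_bits (merge_bits b0 v u)) L) G1) G0.

Lemma glue_checkP b0 b1 W L s : glue_check b0 b1 W L ->
    size b0 = 24%N -> size b1 = 24%N -> size s = 24%N ->
    ~~ has id [seq p.1 && p.2 | p <- zip b0 b1] ->
    off_bits b0 s \in W -> off_bits b1 s \in W -> s \in L.
Proof.
move=> check s0 s1 ss dis h0 h1.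
have /(allP check) : off_bits b0 s \in [seq u <- W | same_bits (off_bits b0 u) u].
  by rewrite mem_filter off_bitsK same_bits_refl.
have hv : off_bits b1 s \in [seq u <- W | same_bits (off_bits b1 u) u].
  by rewrite mem_filter off_bitsK same_bits_refl.
move/allP/(_ _ hv); rewrite (off_bitsC b1) same_bits_refl merge_off_bits //.
exact: has_same_bits.
Qed.

Lemma base_code_bits Y : trio_code base_trio Y -> bits_of Y \in span_bits trio_bits.
Proof.
move=> /trio_codeP hY.
have h (i : 'I_3) : off_bits (octad_bit i) (bits_of Y) \in golay_words.
  rewrite -bits_of_off_word ?size_octad_bit //.
  by apply: golay_wordsP; rewrite -row_base_trio.
apply: (@glue_checkP (octad_bit 0) (octad_bit 1) golay_words).
- by vm_compute.
- exact: size_octad_bit.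
- exact: size_octad_bit.
- exact: size_bits_of.
- by vm_compute.
- exact: h ord0.
exact: h (lift ord0 ord0).
Qed.

Lemma span_bits_sub m (M : 'M['F_2]_(m, 24)) L : all (fun s => size s == 24%N) L ->
  {in L, forall b, (word_of b <= M)%MS} -> {in span_bits L, forall b, (word_of b <= M)%MS}.
Proof.
elim: L => [|r L IH] sL hL b; first by rewrite inE => /eqP->; rewrite word_of0 sub0mx.
case/andP: (sL) => /eqP sr sL'.
have {}IH : {in span_bits L, forall b, (word_of b <= M)%MS}.
  by apply: IH sL' _ => c hc; apply: hL; rewrite inE hc orbT.
rewrite /= mem_cat => /orP[/IH//|/mapP[c hc ->]].
have sc : size c = 24%N := span_bits_size sL' hc.
rewrite word_of_xors //; apply: addmx_sub; last exact: IH.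
exact: hL (mem_head _ _).
Qed.

(** The gluing search bounds the code from above; the reverse inclusion tests the six generators
    against the three octads. *)
Lemma base_codeP Y : trio_code base_trio Y = (Y <= col_mx base_trio base_tetrads)%MS.
Proof.
apply/idP/idP=> [/base_code_bits hY|/submxP[c ->]].
  rewrite -[Y]bits_ofK; apply: span_bits_sub hY => // b hb.
  have lt_b : (index b trio_bits < 3 + 3)%N by rewrite index_mem.
  have <- : nth [::] trio_bits (Ordinal lt_b) = b by rewrite nth_index.
  by rewrite -row_base row_sub.
rewrite mulmx_sum_row; apply: (big_ind (trio_code base_trio)).
- exact: trio_code0.
- exact: trio_codeD.
move=> k _; apply: trio_codeZ; apply/trio_codeP=> i; rewrite row_base row_base_trio.
rewrite -[off_word _ _]bits_ofK bits_of_off_word ?size_octad_bit //.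
have sk : size (nth [::] trio_bits k) = 24%N by case: k => [[|[|[|[|[|[|]]]]]]].
have -> : bits_of (word_of (nth [::] trio_bits k)) = nth [::] trio_bits k.
  by apply: word_of_inj; rewrite ?size_bits_of ?bits_ofK.
rewrite golay_word_of; last by rewrite size_map size_zip sk size_octad_bit.
have h : all (fun i => all (fun b => golay_test (off_bits (octad_bit i) b)) trio_bits) (iota 0 3).
  by vm_compute.
by apply: (allP (allP h _ _)); [rewrite mem_iota ltn_ord|rewrite mem_nth].
Qed.

(* A dihedral group of order 8, acting regularly on the linear forms on the trio
   code that take the value 1 on each octad. *)
Definition trio_group : seq (seq nat) :=
  let mul p q := [seq nth 0%N p i | i <- q] in
  [seq iter i (mul trio_perm1) (iter j (mul trio_perm2) (iota 0 24))
    | i <- iota 0 4, j <- iota 0 2].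

(** Each word of the span carries the value of a linear form, so that the form is evaluated by
    lookup. *)
Definition span_values (L : seq (bitseq * bool)) : seq (bitseq * bool) :=
  foldr (fun r L => L ++ [seq (xors r.1 s.1, r.2 (+) s.2) | s <- L])
    [:: (nseq 24 false, false)] L.

Lemma span_valuesP (P : word -> Prop) (f : word -> 'F_2) (L : seq (bitseq * bool)) :
    P 0 -> (forall v w, P v -> P w -> P (v + w)) ->
    (forall v w, P v -> P w -> f (v + w) = f v + f w) ->
    (forall r, r \in L -> [/\ size r.1 = 24%N, P (word_of r.1) & f (word_of r.1) = r.2%:R]) ->
  forall r, r \in span_values L ->
    [/\ size r.1 = 24%N, P (word_of r.1) & f (word_of r.1) = r.2%:R].
Proof.
move=> P0 PD fD; have f0 : f 0 = 0.
  by have /eqP := fD 0 0 P0 P0; rewrite addr0 eq_sym -subr_eq0 addrK => /eqP.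
elim: L => [_ r|q L IH hL r]; first by rewrite inE => /eqP-> /=; rewrite word_of0.
have [sq Pq fq] := hL q (mem_head _ _).
have {}IH r' : r' \in span_values L ->
    [/\ size r'.1 = 24%N, P (word_of r'.1) & f (word_of r'.1) = r'.2%:R].
  by apply: IH => c hc; apply: hL; rewrite inE hc orbT.
rewrite /= mem_cat => /orP[/IH//|/mapP[t /IH[st Pt ft] ->]] /=.
by rewrite size_xors ?word_of_xors // fD // fq ft F2_natr_addb; split=> //; apply: PD.
Qed.

Definition bool3 : seq (seq bool) :=
  [seq a :: bc | a <- [:: true; false],
    bc <- [seq [:: b; c] | b <- [:: true; false], c <- [:: true; false]]].

Lemma mem_bool3 a b c : [:: a; b; c] \in bool3.
Proof. by case: a; case: b; case: c. Qed.

(** A form with value 1 on the octads is encoded by its values [a] on the tetrad words. *)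
Definition trio_values (a : seq bool) : seq (bitseq * bool) :=
  [seq (octad_bit i, true) | i <- iota 0 3] ++
  [seq (tetrad_bit i, nth false a i) | i <- iota 0 3].

(** Compares, on the tetrad words, the form of [a] precomposed with [p] and the form of [a']. *)
Definition moves_to (a a' : seq bool) (p : seq nat) : bool :=
  all (fun k => has (fun r => same_bits r.1 (perm_bits p (tetrad_bit k)) &&
    (r.2 == nth false a' k)) (span_values (trio_values a))) (iota 0 3).

Lemma trio_groupP p : p \in trio_group ->
  exists2 s, golay_aut s /\ col_perm s base_trio = base_trio &
    forall b, col_perm s (word_of b) = word_of (perm_bits p b).
Proof.
have h : all (fun p => golay_perm p && all (fun i =>
    same_bits (perm_bits p (octad_bit i)) (octad_bit i)) (iota 0 3)) trio_group.
  by vm_compute.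
move=> /(allP h)/andP[/golay_permP[s gs es] /allP hb]; exists s; last exact: es.
split; first exact: gs.
apply/row_matrixP=> i; rewrite row_col_perm row_base_trio es.
have /hb : (i : nat) \in iota 0 3 by rewrite mem_iota ltn_ord.
by move=> /same_bitsE ->.
Qed.

Lemma trio_group_transitive a a' : a \in bool3 -> a' \in bool3 ->
  has (moves_to a a') trio_group.
Proof.
have h : all (fun a => all (fun a' => has (moves_to a a') trio_group) bool3) bool3.
  by vm_compute.
by move=> ha; apply: (allP (allP h _ ha)).
Qed.

Lemma base_octads_code (k : 'I_3) : trio_code base_trio (word_of (octad_bit k)).
Proof. by rewrite base_codeP -row_base_trio (submx_trans (row_sub _ _)) // -addsmxE addsmxSl. Qed.

Lemma base_tetrads_code (k : 'I_3) : trio_code base_trio (word_of (tetrad_bit k)).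
Proof. by rewrite base_codeP -row_base_tetrads (submx_trans (row_sub _ _)) // -addsmxE addsmxSr. Qed.

(** The computed table only involves values of forms, hence applies to any additive [f]: the values
    of [f] on the tetrad words select the entry, and [span_values] evaluates [f] at the moved
    words. *)
Lemma base_stab_transitive (f : word -> 'F_2) (a : 'rV['F_2]_3) :
    (forall Y Z, trio_code base_trio Y -> trio_code base_trio Z -> f (Y + Z) = f Y + f Z) ->
    (forall i, f (row i base_trio) = 1) ->
  exists s, [/\ golay_aut s, col_perm s base_trio = base_trio
    & forall k, f (col_perm s (row k base_tetrads)) = a 0 k].
Proof.
move=> fD f1.
pose bits3 (g : nat -> 'F_2) := [seq g k != 0 | k <- iota 0 3].
have nth3 g (k : 'I_3) : nth false (bits3 g) k = (g k != 0).
  by rewrite (nth_map 0%N) ?size_iota // nth_iota.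
have in3 g : bits3 g \in bool3 by apply: mem_bool3.
pose v := bits3 (fun k => f (word_of (tetrad_bit k))).
pose v' := bits3 (fun k => a 0 (inord k)).
have /hasP[p /trio_groupP[s [gs fs] es] /allP hk] := trio_group_transitive (in3 _ : v \in bool3) (in3 _ : v' \in bool3).
exists s; split; [exact: gs|exact: fs|move=> k].
have /hk/hasP[r hr /andP[/same_bitsE er /eqP ev]] : (k : nat) \in iota 0 3.
  by rewrite mem_iota ltn_ord.
rewrite row_base_tetrads es -er.
suff [_ _ ->] : [/\ size r.1 = 24%N, trio_code base_trio (word_of r.1)
    & f (word_of r.1) = r.2%:R] by rewrite ev nth3 F2_natr inord_val.
apply: (span_valuesP (trio_code0 _) (@trio_codeD _) fD _ hr).
move=> q; rewrite mem_cat => /orP[]/mapP[i]; rewrite mem_iota => /= lt_i -> /=; split.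
- exact: size_octad_bit.
- exact: (base_octads_code (Ordinal lt_i)).
- by rewrite -(row_base_trio (Ordinal lt_i)) f1.
- by case: i lt_i => [|[|[|]]].
- exact: (base_tetrads_code (Ordinal lt_i)).
by rewrite -[i]/(nat_of_ord (Ordinal lt_i)) nth3 F2_natr.
Qed.

(** * Reduction of an arbitrary trio to the base trio *)

Definition oct_mx (O : 'I_3 -> {set 'I_24}) : 'M['F_2]_(3, 24) := \matrix_(i, j) (j \in O i)%:R.

Lemma weight_indicator (B : {set 'I_24}) : weight (\row_j (j \in B)%:R) = #|B|.
Proof. by apply: eq_card => j; rewrite inE mxE; case: (j \in B). Qed.

Lemma weight_col_perm s w : weight (col_perm s w) = weight w.
Proof.
rewrite /weight -(card_imset _ (@perm_inj _ s)); apply: eq_card => j.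
rewrite inE; apply/imsetP/idP=> [[k hk ->]|h]; first by move: hk; rewrite inE mxE.
by exists (s^-1%g j); rewrite ?permKV // inE mxE permKV.
Qed.

(** A trio is given through the image of [O], so distinctness of the three octads has to be derived:
    blocks of size 8 partition 24 points, hence there are three blocks. *)
Lemma trio_index O : is_trio O -> exists p : 'I_24 -> 'I_3, forall i j, (j \in O i) = (p j == i).
Proof.
case=> oO /and3P[/eqP cO tO nO].
have sO i : #|O i| = 8%N by case/andP: (oO i) => /eqP.
have card_im : #|(O @: 'I_3)%SET| = 3%N.
  have : (\sum_(B in (O @: 'I_3)%SET) #|B| = 24)%N.
    by rewrite (eqnP tO) cO cardsT card_ord.
  rewrite (eq_bigr (fun=> 8%N)) ?sum_nat_const => [/eqP|B /imsetP[i _ ->]] //.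
  by rewrite -[24%N]/(3 * 8)%N eqn_pmul2r // => /eqP.
have O_inj : injective O.
  have /imset_injP h : #|(O @: 'I_3)%SET| == #|'I_3| by rewrite card_im card_ord.
  by move=> i j; apply: h.
have ex j : exists i, j \in O i.
  have : j \in finset.cover (O @: 'I_3)%SET by rewrite cO inE.
  by case/bigcupP=> B /imsetP[i _ ->] hj; exists i.
exists (fun j => xchoose (ex j)) => i j; have hj := xchooseP (ex j).
apply/idP/eqP=> [hi|<-//]; apply: O_inj.
apply/eqP; apply: contraTT hi => ne.
have inO k : O k \in (O @: 'I_3)%SET by apply: imset_f.
have /finset.trivIsetP/(_ _ _ (inO _) (inO _) ne) := tO.
move=> /disjoint_setI0/setP/(_ j); rewrite !inE hj /= => ->.
by [].
Qed.

Lemma row_oct_mx O i : row i (oct_mx O) = \row_j (j \in O i)%:R.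
Proof. by apply/rowP=> j; rewrite !mxE. Qed.

Lemma base_trio_sum j : \sum_i base_trio i j = 1.
Proof.
rewrite (eq_bigr (fun i : 'I_3 => (nth false (octad_bit i) j)%:R)); last by move=> i _; rewrite !mxE.
rewrite !big_ord_recr big_ord0 /= add0r -!F2_natr_addb.
have h : all (fun j => nth false (octad_bit 0) j (+) nth false (octad_bit 1) j
  (+) nth false (octad_bit 2) j) (iota 0 24) by vm_compute.
by rewrite (allP h) // mem_iota ltn_ord.
Qed.

Lemma trio_transitive O : is_trio O ->
  exists2 s, golay_aut s & oct_mx O = col_perm s base_trio.
Proof.
move=> tO; have [p hp] := trio_index tO; case: tO => oO _.
have gO i : golay (row i (oct_mx O)) by rewrite row_oct_mx; case/andP: (oO i).
have wO i : weight (row i (oct_mx O)) = 8%N.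
  by rewrite row_oct_mx weight_indicator; case/andP: (oO i) => /eqP.
have OE i j : oct_mx O i j = (p j == i)%:R by rewrite mxE hp.
have sumO j : \sum_i oct_mx O i j = 1.
  by rewrite (bigD1 (p j)) //= big1 ?addr0 => [|i]; rewrite OE ?eqxx // eq_sym => /negPf->.
pose i1 : 'I_3 := lift ord0 ord0.
have [s gs es] := octad_transitive (gO ord0) (wO ord0).
have eb0 : col_perm s^-1%g (row ord0 (oct_mx O)) = word_of (octad_bit 0).
  by rewrite es -col_permM mulVg col_perm1.
(* Pulled back by [s], the second octad is disjoint from the first base octad, so the stabilizer of
   the latter reaches it. *)
have [||j|t [gt et] e1] := @octad_stab_transitive (col_perm s^-1%g (row i1 (oct_mx O))).
- exact: golay_autV.
- by rewrite weight_col_perm wO.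
- rewrite -eb0 !mxE !hp; case: eqP => [->|_]; first by right.
  by left.
have e0 : row ord0 (oct_mx O) = col_perm (s * t)%g (row ord0 base_trio).
  by rewrite row_base_trio col_permM et.
have {}e1 : row i1 (oct_mx O) = col_perm (s * t)%g (row i1 base_trio).
  by rewrite row_base_trio col_permM -e1 -col_permM mulgV col_perm1.
exists (s * t)%g; first exact: golay_autM.
have eq_row i : i != ord_max -> row i (oct_mx O) = col_perm (s * t)%g (row i base_trio).
  case: i => [[|[|[|]]]] // lt_i _.
    by rewrite (_ : Ordinal lt_i = ord0) ?e0 //; apply: val_inj.
  by rewrite (_ : Ordinal lt_i = i1) ?e1 //; apply: val_inj.
apply/matrixP=> i j; rewrite [RHS]mxE; have [->|ni] := eqVneq i ord_max; last first.
  by have /rowP/(_ j) := eq_row i ni; rewrite !mxE.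
(* The third octad is determined by the other two, since all columns sum to 1. *)
have := etrans (sumO j) (esym (base_trio_sum ((s * t)%g j))).
rewrite (bigD1 ord_max) // [in RHS](bigD1 ord_max) //=.
suff -> : \sum_(k < 3 | k != ord_max) oct_mx O k j =
  \sum_(k < 3 | k != ord_max) base_trio k ((s * t)%g j) by move/addIr.
by apply: eq_bigr => k nk; have /rowP/(_ j) := eq_row k nk; rewrite !mxE.
Qed.

(** This collects what the lattice part takes from M24. The rows of [M] are tetrad words transported
    from the base trio; the last clause says that automorphisms fixing each octad realize all forms
    with value 1 on the octads. *)
Lemma trio_space O : is_trio O -> exists M : 'M['F_2]_(3, 24),
  [/\ row_free (col_mx (oct_mx O) M),
      forall Y, trio_code (oct_mx O) Y = (Y <= col_mx (oct_mx O) M)%MS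
    & forall (f : word -> 'F_2) (a : 'rV['F_2]_3),
        (forall Y Z, trio_code (oct_mx O) Y -> trio_code (oct_mx O) Z ->
           f (Y + Z) = f Y + f Z) ->
        (forall i, f (row i (oct_mx O)) = 1) ->
      exists s, [/\ golay_aut s, col_perm s (oct_mx O) = oct_mx O
        & forall k, f (col_perm s (row k M)) = a 0 k]].
Proof.
case/trio_transitive=> t gt eO; exists (col_perm t base_tetrads).
have e : col_mx (oct_mx O) (col_perm t base_tetrads) =
    col_mx base_trio base_tetrads *m perm_mx t^-1%g.
  by rewrite eO !col_permE mul_col_mx.
split=> [|Y|f a fD f1].
- rewrite e /row_free mxrankMfree ?row_free_unit ?unitmx_perm //; exact: base_free.
- pose Y' := col_perm t^-1%g Y.
  have eY : Y = col_perm t Y' by rewrite -col_permM mulgV col_perm1.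
  rewrite e eY eO trio_code_col_perm // base_codeP col_permE submxMfree //.
  by rewrite row_free_unit unitmx_perm.
pose g Y := f (col_perm t Y).
have [||s [gs fs hs]] := @base_stab_transitive g a.
- by move=> Y Z hY hZ; rewrite /g raddfD fD // eO trio_code_col_perm.
- by move=> i; rewrite /g -row_col_perm -eO f1.
exists (t * s * t^-1)%g; split.
- by apply: golay_autM (golay_autV gt); apply: golay_autM.
- by rewrite eO -[in LHS]col_permM mulgKV col_permM fs.
by move=> k; rewrite -hs /g row_col_perm -!col_permM mulgKV.
Qed.

(** * The Niemeier lattice *)

Notation isint x := (x \is a Num.int).

(* Reduction mod 2 of an integral rational number (junk on the others). *)
Definition par (x : rat) : 'F_2 := (Num.floor x)%:~R.

Lemma par_intr (z : int) : par z%:~R = z%:~R.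
Proof. by rewrite /par intrKfloor. Qed.

Lemma parD x y : isint x -> isint y -> par (x + y) = par x + par y.
Proof. by case/intrP=> a -> /intrP[b ->]; rewrite -rmorphD !par_intr rmorphD. Qed.

Lemma parM x y : isint x -> isint y -> par (x * y) = par x * par y.
Proof. by case/intrP=> a -> /intrP[b ->]; rewrite -rmorphM !par_intr rmorphM. Qed.

Lemma par0 : par 0 = 0. Proof. exact: (par_intr 0). Qed.
Lemma par1 : par 1 = 1. Proof. exact: (par_intr 1). Qed.

Lemma F2_opp (x : 'F_2) : - x = x.
Proof. by apply/eqP; rewrite eq_sym -addr_eq0 F2_addxx. Qed.

Lemma parN x : isint x -> par (- x) = par x.
Proof. by case/intrP=> a ->; rewrite -rmorphN !par_intr rmorphN F2_opp. Qed.

Lemma parB x y : isint x -> isint y -> par (x - y) = par x + par y.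
Proof. by move=> hx hy; rewrite parD ?rpredN // parN. Qed.

Lemma par2 x : isint x -> par (2 * x) = 0.
Proof. by move=> hx; rewrite mulr_natl mulr2n parD // F2_addxx. Qed.

Lemma par_sum (I : Type) (r : seq I) (P : pred I) (F : I -> rat) :
  (forall i, P i -> isint (F i)) ->
  isint (\sum_(i <- r | P i) F i) /\ par (\sum_(i <- r | P i) F i) = \sum_(i <- r | P i) par (F i).
Proof.
move=> hF; apply: (big_rec2 (fun x y => isint x /\ par x = y)); first by rewrite par0 rpred0.
by move=> i x y hi [hy <-]; rewrite rpredD ?hF ?parD ?hF.
Qed.

Lemma isint_sum (I : Type) (r : seq I) (P : pred I) (F : I -> rat) :
  (forall i, P i -> isint (F i)) -> isint (\sum_(i <- r | P i) F i).
Proof. by move=> hF; have [] := @par_sum _ r P F hF. Qed.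

Lemma par_eq0 x : isint x -> (par x == 0) = isint (x / 2).
Proof.
case/intrP=> a ->; rewrite par_intr; apply/eqP/idP => [|h]; last first.
  have -> : a%:~R = par (2 * (a%:~R / 2)) by rewrite mulrC divfK // par_intr.
  by rewrite par2.
have [q [b ->]] : exists q, exists b : bool, a = q * 2 + b%:Z.
  exists (a %/ 2)%Z, ((a %% 2)%Z != 0); rewrite {1}(divz_eq a 2); congr (_ + _).
  have : (0 <= (a %% 2)%Z < 2) by rewrite modz_ge0 ?ltz_pmod.
  by case: (a %% 2)%Z => [[|[|n]]|n].
rewrite !rmorphD !rmorphM /= (_ : 2%:~R = 0 :> 'F_2); last exact: val_inj.
case: b; rewrite mulr0 add0r // => _.
by rewrite addr0 mulfK // intr_int.
Qed.

Lemma par_natr n : par n%:R = n%:R.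
Proof. by rewrite -[n%:R]/((n : int)%:~R) par_intr. Qed.

Lemma eqmod2P u v : isint u -> isint v -> eqmod2 u v <-> par u = par v.
Proof.
move=> hu hv; rewrite /eqmod2 -par_eq0 ?rpredB // parB //.
split=> [h|->]; last by rewrite F2_addxx.
by apply/eqP; rewrite -subr_eq0 F2_opp.
Qed.

Lemma form24E (x y : V) : form24 x y = \sum_j 2 * x 0 j * y 0 j.
Proof. by rewrite /form24 /dot mulr_sumr; apply: eq_bigr => j _; rewrite mulrA. Qed.

Lemma form24C x y : form24 x y = form24 y x.
Proof. by rewrite !form24E; apply: eq_bigr => j _; rewrite mulrAC. Qed.

Lemma form24Dl x y z : form24 (x + y) z = form24 x z + form24 y z.
Proof. by rewrite !form24E -big_split; apply: eq_bigr => j _; rewrite !mxE mulrDr mulrDl. Qed.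

Lemma form24Zl a x y : form24 (a *: x) y = a * form24 x y.
Proof. by rewrite !form24E mulr_sumr; apply: eq_bigr => j _; rewrite !mxE; ring. Qed.

Lemma form24Nl x y : form24 (- x) y = - form24 x y.
Proof. by rewrite -scaleN1r form24Zl mulN1r. Qed.

Lemma form24Dr x y z : form24 x (y + z) = form24 x y + form24 x z.
Proof. by rewrite form24C form24Dl !(form24C x). Qed.

Lemma form24Zr a x y : form24 x (a *: y) = a * form24 x y.
Proof. by rewrite form24C form24Zl form24C. Qed.

Lemma form24Nr x y : form24 x (- y) = - form24 x y.
Proof. by rewrite form24C form24Nl form24C. Qed.

Lemma form24_suml (I : Type) (r : seq I) (P : pred I) (F : I -> V) y :
  form24 (\sum_(i <- r | P i) F i) y = \sum_(i <- r | P i) form24 (F i) y.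
Proof.
apply: (big_morph (form24^~ y)) => [x z|]; first exact: form24Dl.
by rewrite -(scale0r 0) form24Zl mul0r.
Qed.

Lemma form24_root x j : form24 x (root_vec j) = 2 * x 0 j.
Proof.
rewrite form24E (bigD1 j) //= big1 ?addr0 ?mxE ?eqxx ?mulr1 // => k /negPf nk.
by rewrite mxE nk andbF mulr0.
Qed.

Definition half_word (x : V) : word := \row_j par (2 * x 0 j).

Lemma GammaP x : Gamma x <-> (forall j, isint (2 * x 0 j)) /\ golay (half_word x).
Proof.
split=> [[a [ga ex]]|[hx gx]].
  have e j : 2 * x 0 j = (a 0 j)%:~R.
    rewrite ex mxE mulrA divff // mul1r summxE (bigD1 j) //= big1 => [|k nk].
      by rewrite !mxE !eqxx mulr1 addr0.
    by rewrite !mxE [j == k]eq_sym (negPf nk) andbF mulr0.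
  split=> [j|]; first by rewrite e intr_int.
  by congr (golay _): ga; apply/rowP=> j; rewrite !mxE e par_intr.
exists (\row_j Num.floor (2 * x 0 j)); split.
  by congr (golay _): gx; apply/rowP=> j; rewrite !mxE.
apply/rowP=> j; rewrite mxE summxE (bigD1 j) //= big1 => [|k nk].
  by rewrite !mxE !eqxx mulr1 addr0 floorK // mulKf.
by rewrite !mxE [j == k]eq_sym (negPf nk) andbF mulr0.
Qed.

Lemma half_wordD (x y : V) : (forall j, isint (2 * x 0 j)) -> (forall j, isint (2 * y 0 j)) ->
  half_word (x + y) = half_word x + half_word y.
Proof. by move=> hx hy; apply/rowP=> j; rewrite !mxE mulrDr parD. Qed.

Lemma GammaD x y : Gamma x -> Gamma y -> Gamma (x + y).
Proof.
move=> /GammaP[hx gx] /GammaP[hy gy]; apply/GammaP; split=> [j|].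
  by rewrite mxE mulrDr rpredD.
by rewrite half_wordD // golayD.
Qed.

Lemma GammaN x : Gamma x -> Gamma (- x).
Proof.
move=> /GammaP[hx gx]; apply/GammaP; split=> [j|]; first by rewrite mxE mulrN rpredN.
by congr (golay _): gx; apply/rowP=> j; rewrite !mxE mulrN parN.
Qed.

Lemma GammaB x y : Gamma x -> Gamma y -> Gamma (x - y).
Proof. by move=> hx /GammaN; apply: GammaD. Qed.

Lemma Gamma0 : Gamma 0.
Proof.
apply/GammaP; split=> [j|]; first by rewrite mxE mulr0 rpred0.
by rewrite (_ : half_word 0 = 0) ?golay0 //; apply/rowP=> j; rewrite !mxE mulr0 par0.
Qed.

Lemma Gamma_sum (I : Type) (r : seq I) (P : pred I) (F : I -> V) :
  (forall i, P i -> Gamma (F i)) -> Gamma (\sum_(i <- r | P i) F i).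
Proof. by move=> hF; apply: (big_ind Gamma) => //; [apply: Gamma0|apply: GammaD]. Qed.

Lemma GammaZ z x : isint z -> Gamma x -> Gamma (z *: x).
Proof.
case/intrP=> n -> gx.
have h k : Gamma (k%:R *: x).
  by elim: k => [|k IH]; rewrite ?scale0r ?mulrS ?scalerDl ?scale1r; [apply: Gamma0|apply: GammaD].
case: n => k; first exact: h.
by rewrite NegzE rmorphN scaleNr; apply/GammaN/h.
Qed.

Lemma Gamma_root j : Gamma (root_vec j).
Proof.
apply/GammaP; split=> [k|]; first by rewrite mxE -natrM natr_int.
rewrite (_ : half_word _ = 0) ?golay0 //; apply/rowP=> k; rewrite !mxE.
by rewrite par2 // natr_int.
Qed.

#[local] Hint Resolve Gamma_root : core.

Lemma form24_par x y : Gamma x -> Gamma y ->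
  isint (2 * form24 x y) /\ par (2 * form24 x y) = wdot (half_word x) (half_word y).
Proof.
move=> /GammaP[hx _] /GammaP[hy _].
have -> : 2 * form24 x y = \sum_j (2 * x 0 j) * (2 * y 0 j).
  by rewrite form24E mulr_sumr; apply: eq_bigr => j _; ring.
have [j _|h ->] := @par_sum _ (index_enum 'I_24) xpredT (fun j => 2 * x 0 j * (2 * y 0 j)).
  by rewrite rpredM.
by split=> //; apply: eq_bigr => j _; rewrite parM // !mxE.
Qed.

(** Self-orthogonality of the code makes twice the product even. *)
Lemma form24_int x y : Gamma x -> Gamma y -> isint (form24 x y).
Proof.
move=> gx gy; have [h e] := form24_par gx gy.
have : par (2 * form24 x y) == 0.
  by rewrite e golay_orth //; [case/GammaP: gx|case/GammaP: gy].
by rewrite par_eq0 // mulrAC divff // mul1r.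
Qed.

(** Half the norm is the sum of the squares of the doubled coordinates divided by 4. Squares are 0
    or 1 mod 4, so that sum is the weight of a Golay word mod 4, hence 0. *)
Lemma Gamma_even x : Gamma x -> isint (form24 x x / 2).
Proof.
case/GammaP=> hx /golay_weight/dvdnP[k hk].
have sq j : isint (((2 * x 0 j) ^+ 2 - (half_word x 0 j != 0)%:R) / 4).
  rewrite mxE; case/intrP: (hx j) => a ->.
  have [h|h] := eqVneq (par a%:~R) 0.
    move/eqP: h; rewrite par_eq0 ?intr_int // => h.
    by rewrite (_ : _ / 4 = (a%:~R / 2) ^+ 2) ?rpredX //=; field.
  have h1 : par (a%:~R - 1) == 0.
    have ha := intr_int rat a.
    by rewrite parB ?rpred1 // par1; case: (F2_cases (par a%:~R)) h => ->.
  move: h1; rewrite par_eq0 ?rpredB ?rpred1 ?intr_int // => h1.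
  rewrite (_ : _ / 4 = ((a%:~R - 1) / 2) * ((a%:~R - 1) / 2 + 1)) /=; last by field.
  by rewrite rpredM ?rpredD ?rpred1.
have hw : \sum_j (half_word x 0 j != 0)%:R = 4 * k%:R :> rat.
  rewrite -natr_sum -natrM mulnC -hk /weight -sum1_card [in RHS]big_mkcond /=.
  by congr (_%:R); apply: eq_bigr => j _; rewrite inE; case: ifP.
have -> : form24 x x / 2 = \sum_j (((2 * x 0 j) ^+ 2 - (half_word x 0 j != 0)%:R) / 4) + k%:R.
  rewrite -mulr_suml sumrB hw form24E !mulr_suml.
  have -> : \sum_j (2 * x 0 j) ^+ 2 = 4 * \sum_j (2 * x 0 j * x 0 j / 2).
    by rewrite mulr_sumr; apply: eq_bigr => j _; field.
  by field.
by rewrite rpredD ?natr_int // isint_sum.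
Qed.

(** Pairing with roots makes the doubled coordinates integral; pairing with halves of 0-1 lifts of
    Golay words puts their reduction in the dual code. *)
Lemma Gamma_unimodular y : (forall a, Gamma a -> isint (form24 y a)) -> Gamma y.
Proof.
move=> h; have hy j : isint (2 * y 0 j) by rewrite -form24_root; apply/h/Gamma_root.
apply/GammaP; split=> //; apply: golay_self_dual => v gv.
pose a : V := \row_j ((v 0 j)%:R / 2).
have ea j : 2 * a 0 j = (v 0 j)%:R by rewrite mxE mulrC divfK.
have ga : Gamma a.
  apply/GammaP; split=> [j|]; first by rewrite ea natr_int.
  rewrite (_ : half_word a = v) //; apply/rowP=> j.
  by rewrite mxE ea par_natr natr_Zp.
have e2 : 2 * form24 y a = \sum_j (2 * y 0 j) * (2 * a 0 j).
  by rewrite form24E mulr_sumr; apply: eq_bigr => j _; ring.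
have [j _|_] := @par_sum _ (index_enum 'I_24) xpredT (fun j => 2 * y 0 j * (2 * a 0 j)).
  by rewrite rpredM // ea natr_int.
rewrite -e2 par2 ?h // => ->; apply: eq_bigr => j _.
by rewrite parM ?ea ?natr_int // par_natr natr_Zp mxE.
Qed.

(** * Characters of H2 and frames *)

Local Open Scope classical_set_scope.
Local Open Scope card_scope.
Local Open Scope ring_scope.

(* Pairing with the three vectors h_i gives the three non-zero characters of H2. *)
Definition wedge (x y : H2) : 'F_2 := x 0 0 * y 0 1 + x 0 1 * y 0 0.

Lemma wedgeD x y z : wedge (x + y) z = wedge x z + wedge y z.
Proof. by rewrite /wedge !mxE; ring. Qed.

Lemma wedgeZ a x z : wedge (a *: x) z = a * wedge x z.
Proof. by rewrite /wedge !mxE; ring. Qed.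

Lemma wedge0 z : wedge 0 z = 0.
Proof. by rewrite /wedge !mxE !mul0r addr0. Qed.

Lemma H2_eq (x y : H2) : x 0 0 = y 0 0 -> x 0 1 = y 0 1 -> x = y.
Proof.
move=> e0 e1; apply/rowP=> -[[|[|k]] lt_k] //.
  by rewrite (_ : Ordinal lt_k = 0) //; apply: val_inj.
by rewrite (_ : Ordinal lt_k = 1) //; apply: val_inj.
Qed.

Lemma wedge_eq0 x y : x != 0 -> y != 0 -> (wedge x y == 0) = (x == y).
Proof.
move=> x0 y0; have [->|ne] := eqVneq x y; first by rewrite /wedge mulrC F2_addxx eqxx.
apply/negbTE; move: x0 y0 ne; rewrite /wedge.
have nz z : (z != 0 :> H2) = (z 0 0 != 0) || (z 0 1 != 0).
  rewrite -negb_and; congr (~~ _); apply/eqP/andP=> [->|[/eqP e0 /eqP e1]].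
    by rewrite !mxE.
  by apply: H2_eq; rewrite !mxE.
have ne z t : (z != t :> H2) = (z 0 0 != t 0 0) || (z 0 1 != t 0 1).
  rewrite -negb_and; congr (~~ _); apply/eqP/andP=> [->|[/eqP e0 /eqP e1]] //.
  exact: H2_eq.
rewrite !nz ne.
by case: (F2_cases (x 0 0)) => ->; case: (F2_cases (x 0 1)) => ->;
  case: (F2_cases (y 0 0)) => ->; case: (F2_cases (y 0 1)) => ->.
Qed.

Lemma wedge_h (h : 'I_3 -> H2) i k : injective h -> (forall i, h i != 0) ->
  wedge (h k) (h i) = (i != k)%:R.
Proof.
move=> h_inj h0; have := wedge_eq0 (h0 k) (h0 i); rewrite (inj_eq h_inj) [k == i]eq_sym.
by case: (F2_cases (wedge (h k) (h i))) => ->; case: (i == k).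
Qed.

(** A non-zero difference that pairs to 0 with every [h i] would equal each of them. *)
Lemma wedge_inj (h : 'I_3 -> H2) x y : injective h -> (forall i, h i != 0) ->
  (forall i, wedge x (h i) = wedge y (h i)) -> x = y.
Proof.
move=> h_inj h0 e; apply/eqP; rewrite -subr_eq0; apply: contraT => nz.
have eh i : x - y = h i.
  by apply/eqP; rewrite -wedge_eq0 // wedgeD -scaleN1r wedgeZ e F2_opp mul1r F2_addxx.
have : ord0 = lift ord0 ord0 :> 'I_3 by apply: h_inj; rewrite -!eh.
by [].
Qed.

Lemma sum_h (h : 'I_3 -> H2) : injective h -> (forall i, h i != 0) -> \sum_i h i = 0.
Proof.
move=> h_inj h0; apply: (wedge_inj h_inj h0) => i.
rewrite (big_morph (wedge^~ (h i)) (fun x y => wedgeD x y (h i)) (wedge0 _)) wedge0.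
rewrite (eq_bigr (fun k => (i != k)%:R)) => [|k _]; last exact: wedge_h.
by case: i => [[|[|[|]]]] // lt_i; rewrite !big_ord_recl big_ord0; apply: val_inj.
Qed.

(** A non-zero vector different from all three would pair to 1 with each of them, but their sum is
    0. *)
Lemma H2_cases (h : 'I_3 -> H2) x : injective h -> (forall i, h i != 0) ->
  x != 0 -> exists i, h i = x.
Proof.
move=> h_inj h0 x0; have [i /eqP|ne] := pickP (fun i => h i == x); first by exists i.
have e i : wedge (h i) x = 1.
  have := wedge_eq0 (h0 i) x0; rewrite ne.
  by case: (F2_cases (wedge (h i) x)) => ->.
have := wedge0 x; rewrite -(sum_h h_inj h0).
rewrite (big_morph (wedge^~ x) (fun y z => wedgeD y z x) (wedge0 _)).
by rewrite (eq_bigr (fun=> 1)) // !big_ord_recl big_ord0.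
Qed.

Lemma pi_starP (h : 'I_3 -> H2) (pi : 'S_3) x i : injective h -> (forall i, h i != 0) ->
  wedge (pi_star h pi x) (h (pi i)) = wedge x (h i).
Proof.
move=> h_inj h0; rewrite /pi_star; case: pickP => [k /eqP <-|ne].
  by rewrite !wedge_h // (inj_eq perm_inj).
have [->|x0] := eqVneq x 0; first by rewrite !wedge0.
by have [k /eqP] := H2_cases h_inj h0 x0; rewrite ne.
Qed.

Lemma pi_star0 (h : 'I_3 -> H2) (pi : 'S_3) : (forall i, h i != 0) -> pi_star h pi 0 = 0.
Proof. by move=> h0; rewrite /pi_star; case: pickP => // k; rewrite (negPf (h0 k)). Qed.

Notation I0 := (ord0 : 'I_3).
Notation I1 := (lift ord0 ord0 : 'I_3).
Notation I2 := (ord_max : 'I_3).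

Lemma sum3 (M : nmodType) (F : 'I_3 -> M) : \sum_i F i = F I0 + F I1 + F I2.
Proof.
rewrite !big_ord_recl big_ord0 addr0 addrA; congr (_ + _ + F _); exact: val_inj.
Qed.

Lemma ord3P (i : 'I_3) : [\/ i = I0, i = I1 | i = I2].
Proof.
case: i => [[|[|[|]]]] // lt_i; [apply: Or31|apply: Or32|apply: Or33]; exact: val_inj.
Qed.

(* The rows t_i of a frame represent the classes of the three non-zero characters. *)
Definition frame (O : 'I_3 -> {set 'I_24}) (T : 'M[rat]_(3, 24)) : Prop :=
  [/\ forall i, Gamma (row i T),
      \sum_i row i T = 0,
      forall i j, par (2 * T i j) = (j \notin O i)%:R
    & forall i, isint ((form24 (row i T) (row i T) - 2) / 8)].

(** The coefficients are crossed because pairing with [h i] kills [h i]: the i-th character then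
    takes the value [(t_i, x)] mod 2. *)
Definition frame_lam (h : 'I_3 -> H2) (T : 'M[rat]_(3, 24)) (x : V) : H2 :=
  if `[< Gamma x >] then
    par (form24 (row I1 T) x) *: h I0 + par (form24 (row I0 T) x) *: h I1
  else 0.

Definition frame_ker (T : 'M[rat]_(3, 24)) : set V :=
  [set x | Gamma x /\ forall i, par (form24 (row i T) x) = 0].

(** Adding all of K makes the value a full coset; the guard gives the default [set0] outside
    [A_S]. *)
Definition frame_phi (T : 'M[rat]_(3, 24)) (X : set W) : set V :=
  [set y | A_S X /\ exists x k, [/\ X x, frame_ker T k & y = x *m T + k]].

Definition frame_datum h T : datum := (frame_lam h T, frame_phi T).

Lemma chi_lam (h : 'I_3 -> H2) O T i x : injective h -> (forall i, h i != 0) ->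
  frame O T -> Gamma x ->
  wedge (frame_lam h T x) (h i) = par (form24 (row i T) x).
Proof.
move=> h_inj h0 [gT sT _ _] gx; rewrite /frame_lam asboolT // wedgeD !wedgeZ !wedge_h //.
have s : par (form24 (row I0 T) x) + par (form24 (row I1 T) x) = par (form24 (row I2 T) x).
  rewrite -parD ?form24_int // -form24Dl -[RHS]parN ?form24_int // -form24Nl; congr (par (form24 _ _)).
  by apply/eqP; rewrite -subr_eq0 opprK -(sum3 (fun i => row i T)) sT.
by case: (ord3P i) => ->; rewrite /= ?mulr0 ?mulr1 ?addr0 ?add0r // addrC.
Qed.

Lemma frame_kerE (h : 'I_3 -> H2) O T : injective h -> (forall i, h i != 0) -> frame O T ->
  ker_map (frame_lam h T) = frame_ker T.
Proof.
move=> h_inj h0 fT; apply/seteqP; split=> x [gx hx]; split=> //.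
  by move=> i; rewrite -(chi_lam i h_inj h0 fT gx) hx wedge0.
by apply: (wedge_inj h_inj h0) => i; rewrite (chi_lam i h_inj h0 fT gx) hx wedge0.
Qed.

(* From t_i^2 = t_j^2 = t_k^2 = 2 mod 8 and t_i + t_j + t_k = 0. *)
Lemma gram_off_diag (T : 'M[rat]_(3, 24)) i k : \sum_i row i T = 0 ->
  (forall i, isint ((form24 (row i T) (row i T) - 2) / 8)) -> i != k ->
  isint ((form24 (row i T) (row k T) + 1) / 4).
Proof.
move=> sT nT.
have key a b c : \sum_i row i T = row a T + row b T + row c T ->
    isint ((form24 (row a T) (row b T) + 1) / 4).
  move=> e; have ec : row c T = - (row a T + row b T).
    by apply/eqP; rewrite -addr_eq0 addrC -e sT.
  have := nT c; rewrite ec form24Nl form24Nr opprK !form24Dl !form24Dr [form24 (row b T) _]form24C => hc.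
  rewrite (_ : (_ + 1) / 4 = (form24 (row a T) (row a T) + form24 (row a T) (row b T)
     + (form24 (row a T) (row b T) + form24 (row b T) (row b T)) - 2) / 8
     - (form24 (row a T) (row a T) - 2) / 8 - (form24 (row b T) (row b T) - 2) / 8); last by field.
  by apply: rpredB => //; apply: rpredB.
have e := sum3 (fun i => row i T).
have k01 : isint ((form24 (row I0 T) (row I1 T) + 1) / 4) by exact: key e.
have k02 : isint ((form24 (row I0 T) (row I2 T) + 1) / 4).
  by apply: (key _ _ I1); rewrite e addrAC.
have k12 : isint ((form24 (row I1 T) (row I2 T) + 1) / 4).
  by apply: (key _ _ I0); rewrite e -addrA addrC.
by case: (ord3P i) => ->; case: (ord3P k) => ->; rewrite ?eqxx // form24C.
Qed.

Lemma gram_par (T : 'M[rat]_(3, 24)) i k : (forall i, Gamma (row i T)) ->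
  \sum_i row i T = 0 -> (forall i, isint ((form24 (row i T) (row i T) - 2) / 8)) ->
  par (form24 (row i T) (row k T)) = (i != k)%:R.
Proof.
move=> gT sT nT; have hf := form24_int (gT i) (gT k).
have [<-|nik] /= := eqVneq i k.
  by apply/eqP; rewrite par_eq0 ?form24_int //; apply: Gamma_even.
have /eqP : par (form24 (row i T) (row k T) + 1) == 0.
  rewrite par_eq0 ?rpredD ?rpred1 // (_ : _ / 2 = 2 * ((form24 (row i T) (row k T) + 1) / 4)).
    by rewrite rpredM ?natr_int // gram_off_diag.
  by field.
rewrite parD ?rpred1 // par1 => /(congr1 (fun x => x + 1)).
by rewrite -addrA F2_addxx addr0 add0r.
Qed.

Lemma frame_gram O T i k : frame O T -> i != k ->
  isint ((form24 (row i T) (row k T) + 1) / 4).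
Proof. by case=> _ sT _ nT; apply: gram_off_diag. Qed.

Lemma frame_par O T i k : frame O T -> par (form24 (row i T) (row k T)) = (i != k)%:R.
Proof. by case=> gT sT _ nT; apply: gram_par. Qed.

(** * The lattices S and K *)

Definition subgroup n (L : set 'rV[rat]_n) : Prop :=
  L 0 /\ forall x y, L x -> L y -> L (x - y).

Lemma subgroupN n (L : set 'rV[rat]_n) x : subgroup L -> L x -> L (- x).
Proof. by case=> L0 LB hx; rewrite -sub0r; apply: LB. Qed.

Lemma subgroupD n (L : set 'rV[rat]_n) x y : subgroup L -> L x -> L y -> L (x + y).
Proof. by move=> sL hx hy; rewrite -[y]opprK; apply: sL.2 => //; apply: subgroupN. Qed.

Lemma lat_cosetE n (L : set 'rV[rat]_n) y z : lat_coset L y z <-> L (z - y).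
Proof.
split=> [[a La <-]|h]; first by rewrite addrC addKr.
by exists (z - y) => //; rewrite addrC subrK.
Qed.

Lemma lat_coset_eq n (L : set 'rV[rat]_n) y z : subgroup L ->
  lat_coset L y = lat_coset L z <-> L (y - z).
Proof.
move=> sL; split=> [e|h].
  have : lat_coset L y y by apply/lat_cosetE; rewrite subrr; case: sL.
  by rewrite e => /lat_cosetE.
apply/seteqP; split=> x /lat_cosetE hx; apply/lat_cosetE.
  by rewrite -(subrK y x) -addrA; apply: subgroupD.
by rewrite -(subrK z x) -addrA; apply: subgroupD => //; rewrite -opprB; apply: subgroupN.
Qed.

Lemma addset_coset n (L : set 'rV[rat]_n) y z : subgroup L ->
  addset (lat_coset L y) (lat_coset L z) = lat_coset L (y + z).
Proof.
move=> sL; apply/seteqP; split=> x.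
  case=> [a [b [/lat_cosetE ha /lat_cosetE hb ->]]]; apply/lat_cosetE.
  by rewrite opprD addrACA; apply: subgroupD.
move=> /lat_cosetE hx; exists y, (x - y); split; last by rewrite addrC subrK.
  by apply/lat_cosetE; rewrite subrr; case: sL.
by apply/lat_cosetE; rewrite -addrA -opprD.
Qed.

Lemma dual_lat_subgroup n (b : 'rV[rat]_n -> 'rV[rat]_n -> rat) (L : set 'rV[rat]_n) :
  (forall a, b 0 a = 0) -> (forall x y a, b (x - y) a = b x a - b y a) ->
  subgroup (dual_lat b L).
Proof.
move=> b0 bB; split=> [a _|x y hx hy a La]; first by rewrite b0 rpred0.
by rewrite bB rpredB ?hx ?hy.
Qed.

Lemma dotE (x y : W) : dot x y = \sum_i x 0 i * y 0 i. Proof. by []. Qed.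

Lemma dot_e (x : W) i : dot x (e_vec i) = x 0 i.
Proof.
rewrite dotE (bigD1 i) //= big1 ?addr0 ?mxE ?eqxx ?mulr1 // => k /negPf nk.
by rewrite mxE nk andbF mulr0.
Qed.

Lemma c_vecE i : c_vec 0 i = 1.
Proof.
rewrite summxE (bigD1 i) //= big1 ?addr0 ?mxE ?eqxx // => k nk.
by rewrite mxE [i == k]eq_sym (negPf nk) andbF.
Qed.

Lemma lat_SP x : lat_S x <-> (forall i, isint (x 0 i)) /\ forall i k, par (x 0 i) = par (x 0 k).
Proof.
have eqm (m n : int) : (m = n %[mod 2])%Z <-> (m%:~R : 'F_2) = n%:~R.
  split=> [h|h].
    rewrite (divz_eq m 2) (divz_eq n 2) h !rmorphD !rmorphM /= (_ : 2%:~R = 0 :> 'F_2) ?mulr0 //.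
    exact: val_inj.
  have /intrP[q hq] : isint ((m%:~R - n%:~R : rat) / 2).
    rewrite -par_eq0 ?rpredB ?intr_int //.
    by rewrite parB ?intr_int // !par_intr h F2_addxx.
  apply/eqP; rewrite eqz_mod_dvd; apply/dvdzP; exists q; apply: (@intr_inj rat); rewrite rmorphM rmorphB /= -hq.
  by rewrite divfK.
split=> [[n [hn ex]]|[hx px]].
  have e i : x 0 i = (n 0 i)%:~R.
    rewrite ex summxE (bigD1 i) //= big1 ?addr0 => [|k nk]; first by rewrite !mxE !eqxx mulr1.
    by rewrite !mxE [i == k]eq_sym (negPf nk) andbF mulr0.
  split=> [i|i k]; first by rewrite e intr_int.
  by rewrite !e !par_intr; apply/eqm/hn.
exists (\row_i Num.floor (x 0 i)); split=> [i k|].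
  by rewrite !mxE; apply/eqm; apply: px.
apply/rowP=> i; rewrite summxE (bigD1 i) //= big1 ?addr0 => [|k nk].
  by rewrite !mxE !eqxx mulr1 floorK.
by rewrite !mxE [i == k]eq_sym (negPf nk) andbF mulr0.
Qed.

Lemma lat_S_subgroup : subgroup lat_S.
Proof.
split=> [|x y /lat_SP[hx px] /lat_SP[hy py]]; apply/lat_SP.
  by split=> [i|i k]; rewrite !mxE ?rpred0.
split=> [i|i k]; rewrite !mxE; first by rewrite rpredB.
by rewrite !parB // (px i k) (py i k).
Qed.

(** The vectors [2 e_i] and [c] of S already cut out the dual. *)
Lemma dual_SP x : dual_lat (@dot 3) lat_S x <->
  (forall i, isint (2 * x 0 i)) /\ isint (\sum_i x 0 i).
Proof.
split=> [hx|[hx sx] a /lat_SP[ha pa]].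
  split=> [i|].
    have : lat_S (2 *: e_vec i).
      apply/lat_SP; split=> [k|k l]; rewrite !mxE; first by rewrite -natrM natr_int.
      by rewrite !par2 ?natr_int.
    move/hx; rewrite dotE (eq_bigr (fun k => 2 * (x 0 k * e_vec i 0 k))) => [|k _].
      by rewrite -mulr_sumr -dotE dot_e.
    by rewrite mxE; ring.
  have /hx : lat_S c_vec by apply/lat_SP; split=> [i|i k]; rewrite !c_vecE ?rpred1.
  by rewrite dotE; congr (isint _); apply: eq_bigr => i _; rewrite c_vecE mulr1.
(* The coordinates of [a] differ from the first one by even integers, and the first one multiplies
   the integral sum of [x]. *)
rewrite dotE (eq_bigr (fun i => a 0 ord0 * x 0 i + 2 * x 0 i * ((a 0 i - a 0 ord0) / 2))) => [|i _].
  rewrite big_split /= -mulr_sumr rpredD ?rpredM // isint_sum // => i _.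
  by rewrite rpredM // -par_eq0 ?rpredB // parB // (pa i ord0) F2_addxx.
by field.
Qed.

Lemma dual_S_subgroup : subgroup (dual_lat (@dot 3) lat_S).
Proof.
apply: dual_lat_subgroup => [a|x y a]; rewrite !dotE.
  by rewrite big1 // => i _; rewrite mxE mul0r.
by rewrite -sumrB; apply: eq_bigr => i _; rewrite !mxE mulrBl.
Qed.

Lemma dual_S_e i : dual_lat (@dot 3) lat_S (e_vec i).
Proof.
apply/dual_SP; split=> [k|]; first by rewrite mxE -natrM natr_int.
by rewrite isint_sum // => k _; rewrite mxE natr_int.
Qed.

Lemma frame_ker_subgroup T : (forall i, Gamma (row i T)) -> subgroup (frame_ker T).
Proof.
move=> gT; split=> [|x y [gx hx] [gy hy]].
  by split=> [|i]; [exact: Gamma0|rewrite -(scale0r 0) form24Zr mul0r par0].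
split=> [|i]; first exact: GammaB.
by rewrite form24Dr form24Nr parB ?form24_int // hx hy addr0.
Qed.

Lemma form24_mulmx (x : W) (T : 'M[rat]_(3, 24)) y :
  form24 (x *m T) y = \sum_i x 0 i * form24 (row i T) y.
Proof. by rewrite mulmx_sum_row form24_suml; apply: eq_bigr => i _; rewrite form24Zl. Qed.

Lemma frame_S_ker O T x : frame O T -> lat_S x -> frame_ker T (x *m T).
Proof.
move=> fT /lat_SP[hx px]; have [gT _ _ _] := fT; split.
  by rewrite mulmx_sum_row; apply: Gamma_sum => i _; apply: GammaZ.
move=> k; rewrite form24C form24_mulmx.
have [i _|_ ->] := @par_sum _ (index_enum 'I_3) xpredT (fun i => x 0 i * form24 (row i T) (row k T)).
  by rewrite rpredM ?form24_int.
rewrite (eq_bigr (fun i => par (x 0 k) * (i != k)%:R)) => [|i _]; last first.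
  by rewrite parM ?form24_int // (frame_par _ _ fT) (px i k).
rewrite -mulr_sumr (_ : \sum_i _ = 0) ?mulr0 //.
by rewrite sum3; case: (ord3P k) => ->; apply: val_inj.
Qed.

(** Injectivity of the gluing. The Gram matrix of a frame is [3I - J] mod 4, with J the all-ones
    matrix, so evenness of the pairing with [t_k] forces [x_k = s] mod 2, where [s] is the integral
    coordinate sum. *)
Lemma frame_ker_S O T x : frame O T -> dual_lat (@dot 3) lat_S x -> frame_ker T (x *m T) -> lat_S x.
Proof.
move=> fT /dual_SP[hx sx] [gx kx]; have [gT _ _ nT] := fT.
pose s := \sum_i x 0 i.
have key k : exists2 w, isint w & x 0 k = s + 2 * w.
  have := kx k; move/eqP; rewrite par_eq0 ?form24_int //.
  pose z i := (form24 (row i T) (row k T) + 1 - 3 * (i == k)%:R) / 4.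
  have hz i : isint (z i).
    rewrite /z; have [->|nik] := eqVneq i k; last by rewrite mulr0 subr0 (frame_gram fT).
    rewrite mulr1 (_ : _ / 4 = 2 * ((form24 (row k T) (row k T) - 2) / 8)); last by field.
    by rewrite rpredM ?natr_int.
  rewrite form24C form24_mulmx.
  have -> : \sum_i x 0 i * form24 (row i T) (row k T) =
      \sum_i (2 * x 0 i) * (2 * z i) - s + 3 * x 0 k.
    have -> : 3 * x 0 k = \sum_i 3 * x 0 i * (i == k)%:R.
      rewrite (bigD1 k) //= big1 ?addr0 ?eqxx ?mulr1 // => i /negPf->; by rewrite mulr0.
    by rewrite /s -sumrB -big_split; apply: eq_bigr => i _; rewrite /z /=; field.
  set u := \sum_i _ => h.
  have hu : isint (u / 2).
    rewrite /u mulr_suml isint_sum // => i _.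
    rewrite (_ : 2 * x 0 i * (2 * z i) / 2 = 2 * x 0 i * z i); first by rewrite rpredM.
    by clearbody z; field.
  (* This is [(x_k - s) / 2], written as a combination of quantities known to be integral. *)
  exists (2 * x 0 k - s - (u - s + 3 * x 0 k) / 2 + u / 2 ).
    by rewrite rpredD // rpredB // rpredB.
  by field.
apply/lat_SP; split=> [i|i k].
  by have [w hw ->] := key i; rewrite rpredD ?rpredM ?natr_int.
have [w hw ->] := key i; have [v hv ->] := key k.
by rewrite !parD ?rpredM ?natr_int // !par2.
Qed.

Lemma frame_dual O T x : frame O T -> dual_lat (@dot 3) lat_S x ->
  dual_lat form24 (frame_ker T) (x *m T).
Proof.
move=> [gT _ _ _] /dual_SP[hx _] k [gk hk]; rewrite form24_mulmx isint_sum // => i _.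
rewrite (_ : _ * _ = 2 * x 0 i * (form24 (row i T) k / 2)); last by field.
by rewrite rpredM // -par_eq0 ?form24_int // hk.
Qed.

Lemma frame_root_class O T i j : is_trio O -> frame O T -> j \in O i ->
  frame_ker T (row i T - root_vec j).
Proof.
move=> /trio_index[p hp] fT ji; have [gT _ pT _] := fT.
split=> [|k]; first by apply: GammaB; [exact: gT|exact: Gamma_root].
rewrite form24Dr form24Nr parB ?form24_int //.
rewrite (frame_par _ _ fT) form24_root mxE pT hp.
by move: ji; rewrite hp => /eqP ->; rewrite eq_sym F2_addxx.
Qed.

(** The three parities add up to 0, so if they are not all zero exactly two are 1; that is the
    pattern of the roots in the remaining octad. *)
Lemma frame_kerP O T x : is_trio O -> frame O T -> Gamma x ->
  frame_ker T x \/ exists i, forall j, j \in O i -> frame_ker T (x - root_vec j).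
Proof.
move=> tO fT gx; have [gT sT pT nT] := fT; have [p hp] := trio_index tO.
have s : par (form24 (row I0 T) x) + par (form24 (row I1 T) x) + par (form24 (row I2 T) x) = 0.
  by rewrite -!parD ?rpredD ?form24_int // -!form24Dl -(sum3 (fun i => row i T)) sT -(scale0r 0)
    form24Zl mul0r par0.
have [h0|ne] := pselect (forall i, par (form24 (row i T) x) = 0); first by left.
right; suff [i hi] : exists i, forall k, par (form24 (row k T) x) = (k != i)%:R.
  exists i => j ji; split=> [|k]; first by apply: GammaB; [exact: gx|exact: Gamma_root].
  rewrite form24Dr form24Nr parB ?form24_int // form24_root mxE pT hp hi.
  by move: ji; rewrite hp => /eqP ->; rewrite eq_sym F2_addxx.
pose w k := par (form24 (row k T) x).
suff [i hi] : exists i, [/\ w I0 = (I0 != i)%:R, w I1 = (I1 != i)%:R & w I2 = (I2 != i)%:R].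
  by exists i => k; case: (ord3P k) => ->; case: hi.
have nz : ~ [/\ w I0 = 0, w I1 = 0 & w I2 = 0].
  by move=> [h0 h1 h2]; apply: ne => k; case: (ord3P k) => ->.
move: s nz; rewrite -/(w I0) -/(w I1) -/(w I2).
case: (F2_cases (w I0)) => ->; case: (F2_cases (w I1)) => ->; case: (F2_cases (w I2)) => -> //.
- by move=> _ /(_ (And3 erefl erefl erefl)).
- by exists I0.
- by exists I1.
- by exists I2.
Qed.

Lemma trio_root O : is_trio O -> exists r : 'I_3 -> 'I_24, forall i, r i \in O i.
Proof.
case=> oO _; have h i : exists j, j \in O i.
  by apply/card_gt0P; case/andP: (oO i) => /eqP->.
by exists (fun i => xchoose (h i)) => i; apply: xchooseP.
Qed.

(* The coordinates of x are the pairings of y with a root of each octad. *)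
Lemma frame_dual_surj O T y : is_trio O -> frame O T -> dual_lat form24 (frame_ker T) y ->
  exists2 x, dual_lat (@dot 3) lat_S x & frame_ker T (y - x *m T).
Proof.
move=> tO fT hy; have [gT sT pT nT] := fT; have [r hr] := trio_root tO.
have [p hp] := trio_index tO; have sK := frame_ker_subgroup gT.
have root_par i k : par (form24 (row i T) (root_vec (r k))) = (i != k)%:R.
  by rewrite form24_root mxE pT hp; move: (hr k); rewrite hp => /eqP->; rewrite eq_sym.
have root_int i k : isint (form24 (row i T) (root_vec (r k))).
  by apply: form24_int => //; apply: Gamma_root.
pose x : W := \row_i form24 y (root_vec (r i)).
have hx : dual_lat (@dot 3) lat_S x.
  apply/dual_SP; split=> [i|].
    rewrite mxE -form24Zr; apply: hy; split=> [|k].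
      by apply: GammaZ (Gamma_root _); rewrite natr_int.
    by rewrite form24Zr par2.
  have -> : \sum_i x 0 i = form24 y (\sum_i root_vec (r i)).
    by rewrite form24C form24_suml; apply: eq_bigr => i _; rewrite mxE form24C.
  apply: hy; split=> [|k]; first by apply: Gamma_sum => i _; apply: Gamma_root.
  rewrite form24C form24_suml sum3 !(form24C _ (row k T)) !parD ?rpredD // !root_par.
  by case: (ord3P k) => ->; apply: val_inj.
have /dual_SP[hx2 sx] := hx.
(* By [frame_kerP], integrality on K and on one root of each octad gives integrality on [Gamma];
   then unimodularity applies. *)
have gy : Gamma (y - x *m T).
  have hk a : frame_ker T a -> isint (form24 (y - x *m T) a).
    by move=> ka; rewrite form24Dl form24Nl rpredB ?(frame_dual fT hx) ?hy.
  have hroot k : isint (form24 (y - x *m T) (root_vec (r k))).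
    pose b i := form24 (row i T) (root_vec (r k)).
    pose z i := (b i - (i != k)%:R) / 2.
    have hz i : isint (z i).
      rewrite -par_eq0 ?rpredB ?natr_int ?root_int //.
      by rewrite parB ?root_int ?natr_int // par_natr root_par F2_addxx.
    have e : \sum_i x 0 i * b i = \sum_i 2 * x 0 i * z i + (\sum_i x 0 i - x 0 k).
      have -> : \sum_i x 0 i - x 0 k = \sum_i x 0 i * (i != k)%:R.
        rewrite (bigD1 k) //= [RHS](bigD1 k) //= eqxx mulr0 add0r addrAC subrr add0r.
        by apply: eq_bigr => i ->; rewrite mulr1.
      by rewrite -big_split; apply: eq_bigr => i _; rewrite /z /=; field.
    rewrite form24Dl form24Nl form24_mulmx e (_ : form24 y _ = x 0 k); last by rewrite mxE.
    rewrite (_ : _ - _ = 2 * x 0 k - \sum_i x 0 i - \sum_i 2 * x 0 i * z i); last by ring.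
    rewrite rpredB ?rpredB //.
    by rewrite isint_sum // => i _; rewrite rpredM.
  apply: Gamma_unimodular => a ga.
  case: (frame_kerP tO fT ga) => [/hk//|[k /(_ _ (hr k))/hk]].
  rewrite form24Dr form24Nr => h.
  by rewrite -(subrK (form24 (y - x *m T) (root_vec (r k))) (form24 _ a)) rpredD.
(* The difference may lie in the class of a root of [O k] instead of K; adding [e_k] to [x] corrects
   this, as [t_k] is in that class. *)
case: (frame_kerP tO fT gy) => [|[k /(_ _ (hr k)) hk]]; first by exists x.
exists (x + e_vec k); first by apply: subgroupD dual_S_subgroup hx (dual_S_e k).
rewrite mulmxDl -rowE opprD addrA (_ : _ - row k T = y - x *m T - root_vec (r k) - (row k T - root_vec (r k))).
  by apply: sK.2 hk _; apply: frame_root_class tO fT (hr k).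
by rewrite opprB addrA subrK.
Qed.

Lemma frame_phi_coset O T x : frame O T -> dual_lat (@dot 3) lat_S x ->
  frame_phi T (lat_coset lat_S x) = lat_coset (frame_ker T) (x *m T).
Proof.
move=> fT hx; have [gT _ _ _] := fT; have sK := frame_ker_subgroup gT.
apply/seteqP; split=> y.
  case=> _ [z [k [/lat_cosetE hz hk ->]]]; apply/lat_cosetE.
  rewrite addrAC -mulmxBl; apply: subgroupD => //; apply: frame_S_ker fT hz.
move=> /lat_cosetE hy; split; first by exists x.
exists x, (y - x *m T); split=> //; last by rewrite addrC subrK.
by apply/lat_cosetE; rewrite subrr; case: lat_S_subgroup.
Qed.

Lemma lat_S_dual x : lat_S x -> dual_lat (@dot 3) lat_S x.
Proof.
move=> /lat_SP[hx _]; apply/dual_SP; split=> [i|]; last by rewrite isint_sum.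
by rewrite rpredM ?natr_int.
Qed.

(** * From frames to deletion data *)

Lemma isint_binom (m : rat) : isint m -> isint (m * (m - 1) / 2).
Proof.
move=> hm; rewrite -par_eq0 ?rpredM ?rpredB ?rpred1 // parM ?rpredB ?rpred1 //.
by rewrite parB ?rpred1 // par1; case: (F2_cases (par m)) => ->.
Qed.

Lemma H2_char (h : 'I_3 -> H2) (ch : {linear H2 -> ('F_2)^o}) x : injective h ->
  (forall i, h i != 0) -> ch x != 0 -> exists i, forall y, ch y = wedge y (h i).
Proof.
move=> h_inj h0 hx; pose w k : 'F_2 := ch (h k).
have s : w I0 + w I1 + w I2 = 0.
  by rewrite /w -(sum3 (fun k => ch (h k))) -raddf_sum sum_h ?raddf0.
have ext i : (forall k, w k = (k != i)%:R) -> exists i, forall y, ch y = wedge y (h i).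
  move=> hi; exists i => y; have [->|y0] := eqVneq y 0; first by rewrite raddf0 wedge0.
  by have [k <-] := H2_cases h_inj h0 y0; rewrite wedge_h // eq_sym -hi.
have nz : ~ [/\ w I0 = 0, w I1 = 0 & w I2 = 0].
  case=> w0 w1 w2; move/eqP: hx; apply; have [->|x0] := eqVneq x 0; first by rewrite raddf0.
  by have [k <-] := H2_cases h_inj h0 x0; case: (ord3P k) => ->.
have [e0|e0] := F2_cases (w I0); have [e1|e1] := F2_cases (w I1); have [e2|e2] := F2_cases (w I2);
  move: s; rewrite e0 e1 e2 // => _.
- by case: nz.
- by apply: (ext I0) => k; case: (ord3P k) => ->; rewrite ?e0 ?e1 ?e2.
- by apply: (ext I1) => k; case: (ord3P k) => ->; rewrite ?e0 ?e1 ?e2.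
- by apply: (ext I2) => k; case: (ord3P k) => ->; rewrite ?e0 ?e1 ?e2.
Qed.

Lemma frame_norm O T x : frame O T -> dual_lat (@dot 3) lat_S x ->
  eqmod2 (form24 (x *m T) (x *m T)) (- (dot x x - dot x c_vec)).
Proof.
move=> fT /dual_SP[hx sx]; have [gT sT _ nT] := fT.
have g01 : isint ((form24 (row I0 T) (row I1 T) + 1) / 4) by apply: frame_gram fT _.
have g02 : isint ((form24 (row I0 T) (row I2 T) + 1) / 4) by apply: frame_gram fT _.
have g12 : isint ((form24 (row I1 T) (row I2 T) + 1) / 4) by apply: frame_gram fT _.
have := nT I0; have := nT I1; have := nT I2.
have := hx I0; have := hx I1; have := hx I2; move: sx g01 g02 g12.
have xc : dot x c_vec = \sum_i x 0 i.
  by rewrite dotE; apply: eq_bigr => i _; rewrite c_vecE mulr1.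
have quad : form24 (x *m T) (x *m T) =
    \sum_i x 0 i * \sum_k x 0 k * form24 (row i T) (row k T).
  rewrite form24_mulmx; apply: eq_bigr => i _; rewrite form24C form24_mulmx; congr (_ * _).
  by apply: eq_bigr => k _; rewrite form24C.
rewrite /eqmod2 xc dotE quad.
rewrite !sum3 [form24 (row I1 T) (row I0 T)]form24C.
rewrite [form24 (row I2 T) (row I0 T)]form24C [form24 (row I2 T) (row I1 T)]form24C.
move: (x 0 I0) (x 0 I1) (x 0 I2) (form24 (row I0 T) (row I0 T)) (form24 (row I1 T) (row I1 T))
  (form24 (row I2 T) (row I2 T)) (form24 (row I0 T) (row I1 T)) (form24 (row I0 T) (row I2 T))
  (form24 (row I1 T) (row I2 T)) => x0 x1 x2 b00 b11 b22 b01 b02 b12.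
move=> hs h01 h02 h12 m2 m1 m0 h2 h1 h0.
set s := x0 + x1 + x2 in hs *.
(* Inserting 2 mod 8 on the diagonal and -1 mod 4 off it leaves binomials [m (m - 1) / 2] with [m]
   integral, plus integral multiples of the error terms. *)
have -> : (x0 * (x0 * b00 + x1 * b01 + x2 * b02) + x1 * (x0 * b01 + x1 * b11 + x2 * b12) +
    x2 * (x0 * b02 + x1 * b12 + x2 * b22) - - (x0 * x0 + x1 * x1 + x2 * x2 - s)) / 2 =
  2 * x0 * (2 * x0 - 1) / 2 + 2 * x1 * (2 * x1 - 1) / 2 + 2 * x2 * (2 * x2 - 1) / 2
  - s * (s - 1) / 2
  + (2 * x0 * (2 * x0) * ((b00 - 2) / 8) + 2 * x1 * (2 * x1) * ((b11 - 2) / 8)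
     + 2 * x2 * (2 * x2) * ((b22 - 2) / 8))
  + (2 * x0 * (2 * x1) * ((b01 + 1) / 4) + 2 * x0 * (2 * x2) * ((b02 + 1) / 4)
     + 2 * x1 * (2 * x2) * ((b12 + 1) / 4)).
  by rewrite /s; field.
apply: rpredD; [apply: rpredD; [apply: rpredB|]|].
- by apply: rpredD; [apply: rpredD|]; apply: isint_binom.
- exact: isint_binom.
- by apply: rpredD; [apply: rpredD|]; apply: rpredM => //; apply: rpredM.
by apply: rpredD; [apply: rpredD|]; apply: rpredM => //; apply: rpredM.
Qed.

Lemma frame_deletion_data (h : 'I_3 -> H2) O T : injective h -> (forall i, h i != 0) -> is_trio O ->
  frame O T -> deletion_data h O (frame_datum h T).
Proof.
move=> h_inj h0 tO fT; have [gT sT pT nT] := fT; have sK := frame_ker_subgroup gT.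
have [p hp] := trio_index tO.
have chi i x := @chi_lam h O T i x h_inj h0 fT; have kE := frame_kerE h_inj h0 fT.
split; split=> /=.
- split=> [x y gx gy|x ngx]; last by rewrite /frame_lam asboolF.
  apply: (wedge_inj h_inj h0) => i; rewrite wedgeD !chi //; last exact: GammaD.
  by rewrite form24Dr parD ?form24_int.
- move=> i j ji; apply: (wedge_inj h_inj h0) => k; rewrite chi; last exact: Gamma_root.
  rewrite form24_root mxE pT wedge_h // hp; move: ji; rewrite hp => /eqP->.
  by rewrite eq_sym.
- move=> ch [x hx].
  have [i hi] : exists i, forall y, ch y = wedge y (h i).
    exact: (H2_char h_inj h0 hx).
  exists (row i T); split=> // [a ga|].
    apply/eqmod2P; rewrite ?form24_int ?natr_int // par_natr natr_Zp hi.
    by rewrite chi.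
  rewrite /eqmod2 (_ : _ / 2 = 2 * ((form24 (row i T) (row i T) - 2) / 8)); last by field.
  by rewrite rpredM ?natr_int.
- rewrite /A_K kE; split; last first.
    move=> X nX; apply/seteqP; split=> // y [] //.
  split.
  + move=> X [x hx <-]; rewrite (frame_phi_coset fT hx).
    by exists (x *m T) => //; apply: frame_dual fT hx.
  + move=> X Y /set_mem[x hx <-] /set_mem[y hy <-].
    rewrite !(frame_phi_coset fT) // => /(lat_coset_eq _ _ sK).
    rewrite -mulmxBl => hxy; apply/(lat_coset_eq _ _ lat_S_subgroup).
    by apply: frame_ker_S fT _ hxy; apply: (dual_S_subgroup.2 _ _ hx hy).
  + move=> Y [y hy <-]; have [x hx kx] := frame_dual_surj tO fT hy.
    exists (lat_coset lat_S x); first by exists x.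
    rewrite (frame_phi_coset fT hx); apply/(lat_coset_eq _ _ sK).
    by rewrite -opprB; apply: subgroupN.
- move=> X Y [x hx <-] [y hy <-].
  rewrite (addset_coset _ _ lat_S_subgroup) !(frame_phi_coset fT) //; last first.
    exact: (subgroupD dual_S_subgroup hx hy).
  by rewrite (addset_coset _ _ sK) mulmxDl.
- move=> X x y [z hz eX] Xx.
  have hx : dual_lat (@dot 3) lat_S x.
    rewrite -(subrK z x); apply: subgroupD dual_S_subgroup _ hz.
    by apply/lat_S_dual/lat_cosetE; rewrite eX.
  rewrite -eX (frame_phi_coset fT hz) => /lat_cosetE hy.
  have {}hy : frame_ker T (y - x *m T).
    rewrite -[y](subrK (z *m T)) -addrA -mulmxBl; apply: subgroupD sK hy _.
    apply: frame_S_ker fT _; rewrite -opprB; apply: (subgroupN lat_S_subgroup).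
    by apply/lat_cosetE; rewrite eX.
  (* Moving the representative by [k] in K changes the norm by [2 (u, k) + k^2], even because [u] is
     dual to K and [Gamma] is even. *)
  have := frame_norm fT hx; rewrite /eqmod2; set q := - (_ - _); set u := x *m T => hq.
  have -> : y = u + (y - x *m T) by rewrite addrC subrK.
  move: (y - x *m T) hy => k hy.
  rewrite form24Dr !form24Dl [form24 k u]form24C.
  rewrite (_ : _ / 2 = (form24 u u - q) / 2 + form24 u k + form24 k k / 2); last by field.
  rewrite rpredD //; last by apply: Gamma_even; case: hy.
  by rewrite rpredD // (frame_dual fT hx).
- move=> i j ji; rewrite (frame_phi_coset fT (dual_S_e i)) kE -rowE.
  by apply/(lat_coset_eq _ _ sK); apply: (frame_root_class tO fT ji).
Qed.

(** * From deletion data to frames *)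

Lemma row_entry (R : Type) m n (A : 'M[R]_(m, n)) i j : row i A 0 j = A i j.
Proof. by rewrite mxE. Qed.

Lemma subgroupZ n (L : set 'rV[rat]_n) z x : subgroup L -> isint z -> L x -> L (z *: x).
Proof.
move=> sL /intrP[k ->] hx.
have h m : L (m%:R *: x).
  by elim: m => [|m IH]; rewrite ?scale0r ?mulrS ?scalerDl ?scale1r; [case: sL|apply: subgroupD].
case: k => m; first exact: h.
by rewrite NegzE rmorphN scaleNr; apply/(subgroupN sL)/h.
Qed.

(** A frame sends [c] to 0 and hence this vector to [-t_i/2], so [t_i] can be read off the gluing.
    Two of these vectors together with [c] generate the dual of S. *)
Definition half_vec (i : 'I_3) : W := 2^-1 *: (c_vec - e_vec i).

Lemma half_vecE i k : half_vec i 0 k = (k != i)%:R / 2.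
Proof.
rewrite !mxE -[in LHS](c_vecE k) /c_vec; rewrite -/(c_vec) c_vecE eq_sym /= mulrC.
by case: eqP => _ /=; rewrite ?subrr ?subr0.
Qed.

Lemma dual_S_half i : dual_lat (@dot 3) lat_S (half_vec i).
Proof.
apply/dual_SP; split=> [k|].
  by rewrite half_vecE mulrC divfK // natr_int.
have -> : \sum_k half_vec i 0 k = 1; last exact: rpred1.
by rewrite sum3 !half_vecE; case: (ord3P i) => -> /=; field.
Qed.

Lemma half_vec_norm i : - (dot (half_vec i) (half_vec i) - dot (half_vec i) c_vec) = 2^-1.
Proof.
rewrite !dotE !sum3 !half_vecE !c_vecE.
by case: (ord3P i) => -> /=; field.
Qed.

Lemma half_vec_mulmx (T : 'M[rat]_(3, 24)) i : \sum_i row i T = 0 ->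
  half_vec i *m T = - 2^-1 *: row i T.
Proof.
move=> sT; rewrite /half_vec -scalemxAl mulmxBl -rowE.
have -> : c_vec *m T = 0.
  by rewrite mulmx_suml -[RHS]sT; apply: eq_bigr => k _; rewrite -rowE.
by rewrite sub0r scalerN scaleNr.
Qed.

Lemma dual_S_span x : dual_lat (@dot 3) lat_S x ->
  exists a b c, [/\ isint a, isint b, isint c
    & x = a *: half_vec I0 + b *: half_vec I1 + c *: c_vec].
Proof.
move=> /dual_SP[hx sx].
exists (2 * x 0 I2 - 2 * x 0 I0), (2 * x 0 I2 - 2 * x 0 I1), (\sum_i x 0 i - 2 * x 0 I2).
split; try by rewrite rpredB.
apply/rowP=> k; rewrite mxE [(_ *: c_vec) _ _]mxE mxE [(_ *: half_vec I0) _ _]mxE.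
rewrite [(_ *: half_vec I1) _ _]mxE !half_vecE c_vecE sum3.
by case: (ord3P k) => -> /=; field.
Qed.

(** One direction compares the gluings at [half_vec i]. For the other, frames that agree modulo
    [2 Gamma] define the same K, and [x (T - T')] has the integral coefficients [2 x_i] on the
    vectors [(t_i - t_i')/2]. *)
Lemma frame_datum_eq (h : 'I_3 -> H2) O T T' : injective h -> (forall i, h i != 0) ->
    frame O T -> frame O T' ->
  frame_datum h T = frame_datum h T' <->
  forall i, frame_ker T' (2^-1 *: (row i T - row i T')).
Proof.
move=> h_inj h0 fT fT'; have [gT sT _ _] := fT; have [gT' sT' _ _] := fT'.
have sK := frame_ker_subgroup gT; have sK' := frame_ker_subgroup gT'.
split=> [[_ ephi] i|hK].
  have := congr1 (fun f => f (lat_coset lat_S (half_vec i))) ephi.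
  rewrite (frame_phi_coset fT (dual_S_half i)) (frame_phi_coset fT' (dual_S_half i)) => e.
  have : lat_coset (frame_ker T) (half_vec i *m T) (half_vec i *m T).
    by apply/lat_cosetE; rewrite subrr; case: sK.
  rewrite e => /lat_cosetE; rewrite !half_vec_mulmx // -scalerBr scaleNr => /(subgroupN sK').
  by rewrite opprK.
have epar i x : Gamma x -> par (form24 (row i T) x) = par (form24 (row i T') x).
  move=> gx; rewrite -[row i T](subrK (row i T')) form24Dl parD ?form24_int //; last exact: GammaB.
  have -> : row i T - row i T' = 2 *: (2^-1 *: (row i T - row i T')).
    by rewrite scalerA divff // scale1r.
  by rewrite form24Zl par2 ?add0r // form24_int //; case: (hK i).
have eK : frame_ker T = frame_ker T'.
  by apply/seteqP; split=> x [gx hx]; split=> // i; rewrite ?epar // -epar.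
rewrite /frame_datum; have -> : frame_lam h T = frame_lam h T'.
  apply: funext => x; have [gx|ngx] := pselect (Gamma x); last by rewrite /frame_lam !asboolF.
  by rewrite /frame_lam !asboolT // !epar.
congr pair; apply: funext => X.
have [[x hx <-]|nX] := pselect (A_S X); last by apply/seteqP; split=> y [].
rewrite (frame_phi_coset fT) // (frame_phi_coset fT') // eK.
apply/(lat_coset_eq _ _ sK'); rewrite -mulmxBr mulmx_sum_row.
apply: (big_ind (frame_ker T')); [by case: sK'|by move=> ? ?; apply: subgroupD|move=> i _].
have /dual_SP[hx2 _] := hx.
have -> : x 0 i *: row i (T - T') = (2 * x 0 i) *: (2^-1 *: (row i T - row i T')).
  by rewrite raddfB scalerA; congr (_ *: _); field.
by apply: subgroupZ.
Qed.

Lemma deletion_data_frame (h : 'I_3 -> H2) O d : injective h -> (forall i, h i != 0) ->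
  is_trio O -> deletion_data h O d -> exists2 T, frame O T & d = frame_datum h T.
Proof.
move=> h_inj h0 tO; case: d => lam phi [/= [[lamD lam_out] lam_root _]].
case=> [[[phi_fun phi_inj phi_surj] phi_out] phiD phi_norm phi_root].
have [r hr] := trio_root tO; have [p hp] := trio_index tO.
set K := ker_map lam in phi_root.
have lam0 : lam 0 = 0.
  have := lamD 0 0 Gamma0 Gamma0; rewrite addr0 => /eqP.
  by rewrite eq_sym -subr_eq0 addrK => /eqP.
have lamN x : Gamma x -> lam (- x) = lam x.
  move=> gx; have := lamD x (- x) gx (GammaN gx); rewrite subrr lam0 => /eqP.
  rewrite eq_sym addrC addr_eq0 => /eqP->; apply/rowP=> k; rewrite mxE; exact: F2_opp.
have lamB x y : Gamma x -> Gamma y -> lam (x - y) = lam x + lam y.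
  by move=> gx gy; rewrite lamD ?lamN //; apply: GammaN.
have sK : subgroup K.
  split=> [|x y [gx hx] [gy hy]]; first by split=> //; exact: Gamma0.
  by split; [apply: GammaB|rewrite lamB // hx hy addr0].
have K_dual x : K x -> dual_lat form24 K x.
  by move=> [gx _] y [gy _]; apply: form24_int.
have sdK : subgroup (dual_lat form24 K).
  apply: dual_lat_subgroup => [a|x y a]; first by rewrite -(scale0r 0) form24Zl mul0r.
  by rewrite form24Dl form24Nl.
have AS x : dual_lat (@dot 3) lat_S x -> A_S (lat_coset lat_S x) by move=> hx; exists x.
have phi_coset x : dual_lat (@dot 3) lat_S x ->
    exists2 y, dual_lat form24 K y & phi (lat_coset lat_S x) = lat_coset K y.
  by move=> /AS/phi_fun[y hy <-]; exists y.
have phi0 : phi (lat_coset lat_S 0) = lat_coset K 0.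
  have d0 : dual_lat (@dot 3) lat_S 0 by case: dual_S_subgroup.
  have [y hy ey] := phi_coset 0 d0.
  have := phiD _ _ (AS _ d0) (AS _ d0).
  rewrite (addset_coset _ _ lat_S_subgroup) addr0 ey (addset_coset _ _ sK).
  move=> /(lat_coset_eq _ _ sK); rewrite opprD addrA subrr sub0r => /(subgroupN sK).
  by rewrite opprK => hKy; apply/(lat_coset_eq _ _ sK); rewrite subr0.
have [y0 hy0 ey0] := phi_coset _ (dual_S_half I0).
have [y1 hy1 ey1] := phi_coset _ (dual_S_half I1).
(* Forced by [half_vec i] going to [-t_i/2]; the third row makes the sum 0. *)
pose T : 'M[rat]_(3, 24) := \matrix_(i, j)
  (if i == I0 then - 2 *: y0 else if i == I1 then - 2 *: y1 else 2 *: (y0 + y1)) 0 j.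
have rT i : row i T = if i == I0 then - 2 *: y0 else if i == I1 then - 2 *: y1 else 2 *: (y0 + y1).
  by apply/rowP=> j; rewrite !mxE.
have sT : \sum_i row i T = 0.
  by rewrite sum3 !rT /= scalerDr !scaleNr addrACA addNr add0r addNr.
(* The vectors at which the gluing is induced by T form a subgroup, which will contain the
   generators of the dual of S. *)
pose M : set W := [set x | dual_lat (@dot 3) lat_S x /\
  phi (lat_coset lat_S x) = lat_coset K (x *m T)].
have MD x y : M x -> M y -> M (x + y).
  move=> [hx ex] [hy ey]; split; first exact: subgroupD dual_S_subgroup hx hy.
  rewrite -(addset_coset _ _ lat_S_subgroup) phiD ?ex ?ey; [|exact: AS..].
  by rewrite (addset_coset _ _ sK) mulmxDl.
have MN x : M x -> M (- x).
  move=> [hx ex]; have hNx := subgroupN dual_S_subgroup hx; split=> //.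
  have [y hy ey] := phi_coset _ hNx; rewrite ey; apply/(lat_coset_eq _ _ sK).
  have := phiD _ _ (AS _ hx) (AS _ hNx).
  rewrite (addset_coset _ _ lat_S_subgroup) subrr phi0 ex ey (addset_coset _ _ sK).
  move=> /(lat_coset_eq _ _ sK); rewrite sub0r => /(subgroupN sK).
  by rewrite opprK mulNmx opprK addrC.
have M0 : M 0.
  by split; [case: dual_S_subgroup|rewrite phi0 mul0mx].
have sM : subgroup M by split=> // x y hx hy; apply: MD => //; apply: MN.
have Mc : M c_vec.
  have hc : lat_S c_vec by apply/lat_SP; split=> [i|i k]; rewrite !c_vecE ?rpred1.
  split; first exact: lat_S_dual.
  have -> : c_vec *m T = 0.
    by rewrite mulmx_suml -[RHS]sT; apply: eq_bigr => k _; rewrite -rowE.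
  by rewrite -phi0; congr phi; apply/(lat_coset_eq _ _ lat_S_subgroup); rewrite subr0.
have Mu0 : M (half_vec I0).
  split; first exact: dual_S_half.
  by rewrite half_vec_mulmx // rT eqxx ey0 scalerA mulrNN mulVf // scale1r.
have Mu1 : M (half_vec I1).
  split; first exact: dual_S_half.
  by rewrite half_vec_mulmx // rT /= ey1 scalerA mulrNN mulVf // scale1r.
have Mdual x : dual_lat (@dot 3) lat_S x -> M x.
  move=> /dual_S_span[a [b [c [ha hb hc ->]]]].
  by apply: (MD); [apply: (MD)|]; apply: subgroupZ.
have phiE x hx := (Mdual x hx).2.
have Kt i j : j \in O i -> K (row i T - root_vec j).
  move=> ji; apply/(lat_coset_eq _ _ sK).
  by rewrite -(phi_root _ _ ji) (phiE _ (dual_S_e i)) -rowE.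
have gT i : Gamma (row i T).
  by have [g _] := Kt _ _ (hr i); rewrite -[row i T](subrK (root_vec (r i))); apply: GammaD.
have lamT i : lam (row i T) = h i.
  rewrite -(lam_root _ _ (hr i)); have [_] := Kt _ _ (hr i); rewrite lamB // => /eqP.
  rewrite addr_eq0 => /eqP ->; apply/rowP=> k; rewrite mxE; exact: F2_opp.
have nT i : isint ((form24 (row i T) (row i T) - 2) / 8).
  have hu := dual_S_half i.
  have self n (L : set 'rV[rat]_n) (x : 'rV[rat]_n) : subgroup L -> lat_coset L x x.
    by move=> sL; apply/lat_cosetE; rewrite subrr; case: sL.
  have hy : phi (lat_coset lat_S (half_vec i)) (half_vec i *m T).
    by rewrite (phiE _ hu); apply: self.
  have := phi_norm _ _ _ (AS _ hu) (self _ _ _ lat_S_subgroup) hy.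
  rewrite half_vec_norm /eqmod2 half_vec_mulmx // form24Zl form24Zr.
  by congr (isint _); field.
(* The vector [t_i/2] is dual to K, so pairing with [t_i] is even on K; an element outside K is
   congruent mod K to the [t_k] with the same image under [lam]. *)
have hpar i a : Gamma a -> par (form24 (row i T) a) = wedge (lam a) (h i).
  have ker b : K b -> par (form24 (row i T) b) = 0.
    move=> Kb; have [y hy ey] := phi_coset _ (dual_S_half i).
    have hy2 : isint (form24 (half_vec i *m T) b).
      have : dual_lat form24 K (half_vec i *m T).
        rewrite -(subrK y (half_vec i *m T)); apply: subgroupD sdK _ hy; apply: K_dual.
        by apply/(lat_coset_eq _ _ sK); rewrite -ey -phiE //; apply: dual_S_half.
      by apply.
    have -> : form24 (row i T) b = 2 * - form24 (half_vec i *m T) b.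
      by rewrite half_vec_mulmx // form24Zl; field.
    by rewrite par2 ?rpredN.
  move=> ga; have [la|la] := eqVneq (lam a) 0; first by rewrite la wedge0 ker.
  have [k hk] := H2_cases h_inj h0 la; rewrite -hk wedge_h //.
  rewrite -(subrK (row k T) a) form24Dr parD ?form24_int //; last exact: GammaB.
  rewrite ker ?add0r ?gram_par //; split; first exact: GammaB.
  by rewrite lamB // lamT hk; apply/rowP=> l; rewrite !mxE F2_addxx.
have fT : frame O T.
  split=> // i j; have ji : j \in O (p j) by rewrite hp.
  have -> : 2 * T i j = form24 (row i T) (root_vec j) by rewrite form24_root row_entry.
  by rewrite hpar // (lam_root _ _ ji) wedge_h // hp eq_sym.
exists T => //.
have elam : lam = frame_lam h T.
  apply: funext => x; have [gx|ngx] := pselect (Gamma x); last first.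
    by rewrite /frame_lam asboolF // lam_out.
  by apply: (wedge_inj h_inj h0) => i; rewrite (chi_lam i h_inj h0 fT gx) hpar.
congr pair => //; apply: funext => X.
have [[x hx <-]|nX] := pselect (A_S X); last first.
  by rewrite phi_out //; apply/seteqP; split=> y // [].
by rewrite (frame_phi_coset fT hx) phiE // /K elam (frame_kerE h_inj h0 fT).
Qed.

(** * The action on frames *)

Lemma isometry_unit g : Defs.isometry g -> g \in unitmx.
Proof.
case=> hg _; suff /mulmx1_unit[] : g *m g^T = 1%:M by [].
apply/matrixP=> i j; rewrite mxE; have := hg (root_vec i) (root_vec j).
rewrite form24_root mxE -!rowE form24E => e.
apply: (@mulfI _ 2) => //; rewrite mulr_sumr.
rewrite (eq_bigr (fun k => 2 * row i g 0 k * row j g 0 k)) => [|k _]; last first.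
  by rewrite !mxE mulrA.
by rewrite e !mxE eqxx andTb [j == i]eq_sym.
Qed.

Lemma isometry_form g x y : Defs.isometry g -> form24 (x *m g) (y *m g) = form24 x y.
Proof. by case. Qed.

Lemma isometry_Gamma g x : Defs.isometry g -> Gamma (x *m g) <-> Gamma x.
Proof.
move=> ig; have [_ eg] := ig; split=> [|gx]; last by rewrite -eg; exists x.
rewrite -{1}eg => -[y gy /(congr1 (fun z => z *m invmx g))].
by rewrite !mulmxK ?isometry_unit // => <-.
Qed.

Lemma mulset_mul n (X : set 'rV[rat]_n) (A B : 'M_n) : mulset (mulset X A) B = mulset X (A *m B).
Proof.
apply/seteqP; split=> y.
  by case=> _ [x hx <-] <-; exists x => //; rewrite mulmxA.
by case=> x hx <-; exists (x *m A); [exists x|rewrite mulmxA].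
Qed.

Lemma mulset1 n (X : set 'rV[rat]_n) : mulset X 1%:M = X.
Proof.
apply/seteqP; split=> y; first by case=> x hx <-; rewrite mulmx1.
by move=> hy; exists y; rewrite ?mulmx1.
Qed.

Lemma mulmx_perm (x : W) (s : 'S_3) i : (x *m perm_mx s) 0 (s i) = x 0 i.
Proof. by rewrite -[s]invgK -col_permE mxE invgK permK. Qed.

Lemma lat_S_perm x (s : 'S_3) : lat_S x -> lat_S (x *m perm_mx s).
Proof.
move=> /lat_SP[hx px]; apply/lat_SP; split=> [i|i k].
  by rewrite -[i](permKV s) mulmx_perm.
by rewrite -[i](permKV s) -[k](permKV s) !mulmx_perm.
Qed.

Lemma dual_S_perm x (s : 'S_3) : dual_lat (@dot 3) lat_S x ->
  dual_lat (@dot 3) lat_S (x *m perm_mx s).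
Proof.
move=> /dual_SP[hx sx]; apply/dual_SP; split=> [i|].
  by rewrite -[i](permKV s) mulmx_perm.
by rewrite (reindex_inj (@perm_inj _ s)) /= (eq_bigr (fun i => x 0 i)) // => i _; rewrite mulmx_perm.
Qed.

Lemma A_S_perm X (s : 'S_3) : A_S (mulset X (perm_mx s)) <-> A_S X.
Proof.
have h t Y : A_S Y -> A_S (mulset Y (perm_mx t)).
  case=> z hz <-; exists (z *m perm_mx t); first exact: dual_S_perm.
  apply/seteqP; split=> y.
    move=> /lat_cosetE /(@lat_S_perm _ t^-1%g) hy.
    exists (y *m perm_mx t^-1%g); last by rewrite -mulmxA -perm_mxM mulVg perm_mx1 mulmx1.
    apply/lat_cosetE; move: hy.
    by rewrite mulmxBl -[z *m _ *m _]mulmxA -perm_mxM mulgV perm_mx1 mulmx1.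
  case=> x /lat_cosetE hx <-; apply/lat_cosetE; rewrite -mulmxBl; exact: lat_S_perm.
split; last exact: h.
by move=> /(h s^-1%g); rewrite mulset_mul -perm_mxM mulgV perm_mx1 mulset1.
Qed.

Definition act_mx (pi : 'S_3) (T : 'M[rat]_(3, 24)) (g : 'M[rat]_24) : 'M[rat]_(3, 24) :=
  invmx (perm_mx pi) *m T *m g.

Lemma invmx_perm (pi : 'S_3) : invmx (perm_mx pi) = perm_mx pi^-1%g :> 'M[rat]_3.
Proof.
have u := unitmx_perm rat pi; apply: (can_inj (mulKmx u)).
by rewrite mulmxV // -perm_mxM mulgV perm_mx1.
Qed.

Lemma row_act_mx (pi : 'S_3) T g i : row (pi i) (act_mx pi T g) = row i T *m g.
Proof.
rewrite /act_mx invmx_perm row_mul; congr (_ *m _).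
by rewrite -row_permE; apply/rowP=> j; rewrite !mxE permK.
Qed.

Lemma act_mx_frame O T g pi : frame O T -> Defs.isometry g -> octad_perm O g pi ->
  frame O (act_mx pi T g).
Proof.
move=> [gT sT pT nT] ig [s hs hO].
split=> [i||i j|i].
- by rewrite -[i](permKV pi) row_act_mx; apply/(isometry_Gamma _ ig).
- rewrite (reindex_inj (@perm_inj _ pi)) /= (eq_bigr (fun i => row i T *m g)) => [|i _].
    by rewrite -mulmx_suml sT mul0mx.
  exact: row_act_mx.
- rewrite -[i](permKV pi) -[j](permKV s); set i' := (pi^-1)%g i; set j' := (s^-1)%g j.
  have -> : 2 * act_mx pi T g (pi i') (s j') = form24 (row i' T *m g) (root_vec (s j')).
    by rewrite form24_root -(row_act_mx pi) row_entry.
  rewrite -hO mem_imset ?pT; last exact: perm_inj.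
  rewrite -pT -(row_entry T) -form24_root.
  have [<-|/(congr1 -%R)] := hs j'; first by rewrite isometry_form.
  rewrite opprK => <-; rewrite form24Nr isometry_form // parN // form24_root.
  by have /GammaP[h _] := gT i'.
by rewrite -[i](permKV pi) row_act_mx isometry_form.
Qed.

(** Turns the action on functions and sets of vectors into a matrix product. The quotient maps are
    compared character by character. *)
Lemma act_frame_datum (h : 'I_3 -> H2) O T g pi : injective h -> (forall i, h i != 0) ->
    frame O T -> Defs.isometry g -> octad_perm O g pi ->
  act h g pi (frame_datum h T) = frame_datum h (act_mx pi T g).
Proof.
move=> h_inj h0 fT ig hpi; have fT' := act_mx_frame fT ig hpi.
have ug := isometry_unit ig.
have [gT _ _ _] := fT; have [gT' _ _ _] := fT'.
rewrite /act /frame_datum /=.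
have -> : frame_lam h (act_mx pi T g) = fun x => pi_star h pi (frame_lam h T (x *m invmx g)).
  apply: funext => x; have gxg : Gamma (x *m invmx g) <-> Gamma x.
    by rewrite -(isometry_Gamma _ ig) mulmxKV.
  have [gx|ngx] := pselect (Gamma x); last first.
    by rewrite /frame_lam !asboolF ?pi_star0 // gxg.
  apply: (wedge_inj h_inj h0) => i; rewrite -[i](permKV pi) pi_starP //.
  rewrite (chi_lam _ h_inj h0 fT') // (chi_lam _ h_inj h0 fT); last by apply/gxg.
  by rewrite row_act_mx -[in LHS](mulmxKV ug x) isometry_form.
congr pair; apply: funext => X; apply/seteqP; split=> y.
  case=> _ [/[!invmx_perm] /A_S_perm AX [_ [k [[x Xx <-] [gk hk] ->]]]] <-.
  split=> //; exists x, (k *m g); split=> //; last by rewrite mulmxDl /act_mx invmx_perm !mulmxA.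
  split; first by apply/(isometry_Gamma _ ig).
  by move=> i; rewrite -[i](permKV pi) row_act_mx isometry_form.
case=> AX [x [k [Xx [gk hk] ->]]].
exists (x *m invmx (perm_mx pi) *m T + k *m invmx g); last by rewrite mulmxDl mulmxKV // /act_mx !mulmxA.
split; first by rewrite invmx_perm; apply/A_S_perm.
exists (x *m invmx (perm_mx pi)), (k *m invmx g); split=> //; first by exists x.
split; first by apply/(isometry_Gamma _ ig); rewrite mulmxKV.
by move=> i; have := hk (pi i); rewrite row_act_mx -{1}(mulmxKV ug k) isometry_form.
Qed.

(** * Sign changes *)

Definition sgn (y : 'F_2) : rat := if y == 0 then 1 else -1.

Lemma sgnD x y : sgn (x + y) = sgn x * sgn y.
Proof. by case: (F2_cases x) => ->; case: (F2_cases y) => ->; rewrite /sgn /= ?mulr1 ?mul1r ?mulrNN ?mulr1. Qed.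

Lemma sgn_sqr y : sgn y * sgn y = 1.
Proof. by rewrite -sgnD F2_addxx. Qed.

(** Indexing by words turns composition of sign changes into addition. *)
Definition sgn_mx (Y : word) : 'M[rat]_24 := diag_mx (\row_j sgn (Y 0 j)).

Lemma mul_sgn_mx m (A : 'M[rat]_(m, 24)) Y i j : (A *m sgn_mx Y) i j = A i j * sgn (Y 0 j).
Proof. by rewrite mul_mx_diag !mxE. Qed.

Lemma sgn_mxD Y Z : sgn_mx (Y + Z) = sgn_mx Y *m sgn_mx Z.
Proof.
rewrite /sgn_mx mulmx_diag; congr diag_mx; apply/rowP=> j.
by rewrite !mxE sgnD.
Qed.

Lemma sgn_mx0 : sgn_mx 0 = 1%:M.
Proof.
rewrite /sgn_mx -diag_const_mx; congr diag_mx; apply/rowP=> j.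
by rewrite !mxE /sgn eqxx.
Qed.

Lemma addww (Y : word) : Y + Y = 0.
Proof. by apply/rowP=> j; rewrite !mxE F2_addxx. Qed.

Lemma sgn_mxK m (A : 'M[rat]_(m, 24)) Y : A *m sgn_mx Y *m sgn_mx Y = A.
Proof. by rewrite -mulmxA -sgn_mxD addww sgn_mx0 mulmx1. Qed.

Lemma root_sgn_mx j Y : root_vec j *m sgn_mx Y = sgn (Y 0 j) *: root_vec j.
Proof.
apply/rowP=> k; rewrite mul_sgn_mx !mxE eqxx /= mulrC.
by case: eqP => [->|]; rewrite // !mulr0.
Qed.

(** A sign does not alter the parity of a doubled coordinate, so every sign change preserves
    [Gamma]. *)
Lemma sgn_mx_isometry Y : Defs.isometry (sgn_mx Y).
Proof.
split=> [x y|].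
  rewrite !form24E; apply: eq_bigr => j _; rewrite !mul_sgn_mx.
  by rewrite -[RHS]mulr1 -(sgn_sqr (Y 0 j)); ring.
have h x : Gamma x -> Gamma (x *m sgn_mx Y).
  move=> /GammaP[hx gx]; apply/GammaP.
  have e j : 2 * (x *m sgn_mx Y) 0 j = 2 * x 0 j \/ 2 * (x *m sgn_mx Y) 0 j = - (2 * x 0 j).
    by rewrite mul_sgn_mx /sgn; case: ifP => _; [left|right]; rewrite ?mulr1 // !mulrN mulr1.
  split=> [j|]; first by case: (e j) => ->; rewrite ?rpredN.
  by congr (golay _): gx; apply/rowP=> j; rewrite [LHS]mxE [RHS]mxE; case: (e j) => ->; rewrite ?parN.
apply/seteqP; split=> x; first by case=> y /h gy <-.
by move=> /h gx; exists (x *m sgn_mx Y) => //; rewrite sgn_mxK.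
Qed.

Lemma sign_changesP g : sign_changes g <-> exists Y, g = sgn_mx Y.
Proof.
split=> [[ig rg]|[Y ->]]; last first.
  split; first exact: sgn_mx_isometry.
  move=> j; rewrite perm1 root_sgn_mx /sgn.
  by case: ifP => _; [left|right]; rewrite ?scale1r ?scaleN1r.
exists (\row_j (g j j != 1)%:R); apply/row_matrixP => j; rewrite !rowE root_sgn_mx mxE.
have gjj : g j j = (root_vec j *m g) 0 j by rewrite -rowE mxE.
have := rg j; rewrite perm1 gjj => -[] ->; rewrite !mxE !eqxx /=.
  by rewrite /sgn scale1r.
by rewrite /sgn /= scaleN1r.
Qed.

Lemma octad_perm_sgn O Y pi : is_trio O -> octad_perm O (sgn_mx Y) pi <-> pi = 1%g.
Proof.
move=> tO; have [p hp] := trio_index tO; have [r hr] := trio_root tO.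
split=> [[s hs hO]|->].
  have s1 j : s j = j.
    apply/eqP; apply: contraT => ne.
    have e0 : (root_vec (s j) : V) 0 j = 0 by rewrite mxE [j == _]eq_sym (negPf ne) andbF.
    have : (root_vec j *m sgn_mx Y) 0 j != 0.
      by rewrite root_sgn_mx !mxE !eqxx mulr1 /sgn; case: ifP.
    by case: (hs j) => ->; [rewrite e0 eqxx|rewrite mxE e0 oppr0 eqxx].
  apply/permP=> i; rewrite perm1; have := hr i.
  have : s (r i) \in O (pi i) by rewrite -hO imset_f.
  by rewrite s1 !hp => /eqP <- /eqP.
exists 1%g => [j|i]; last first.
  by rewrite perm1 (eq_imset _ (@perm1 _)) imset_id.
by case/sign_changesP: (ex_intro (fun Z => sgn_mx Y = sgn_mx Z) Y erefl).
Qed.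

Lemma sign_orbitE (h : 'I_3 -> H2) O T : injective h -> (forall i, h i != 0) ->
    is_trio O -> frame O T ->
  datum_orbit h O sign_changes (frame_datum h T) =
  [set frame_datum h (T *m sgn_mx Y) | Y in [set: word]].
Proof.
move=> h_inj h0 tO fT.
have actE Y : act h (sgn_mx Y) 1 (frame_datum h T) = frame_datum h (T *m sgn_mx Y).
  rewrite (act_frame_datum h_inj h0 fT (sgn_mx_isometry Y)); last exact/octad_perm_sgn.
  by rewrite /act_mx invmx_perm invg1 perm_mx1 mul1mx.
apply/seteqP; split=> d.
  case=> g [pi [/sign_changesP[Y ->] /(octad_perm_sgn _ _ tO) -> ->]].
  by rewrite actE; exists Y.
case=> Y _ <-; exists (sgn_mx Y), 1%g; split; last by rewrite actE.
  by apply/sign_changesP; exists Y.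
exact/octad_perm_sgn.
Qed.

Lemma sgn_frame O T Y : is_trio O -> frame O T -> frame O (T *m sgn_mx Y).
Proof.
move=> tO fT; have -> : T *m sgn_mx Y = act_mx 1 T (sgn_mx Y).
  by rewrite /act_mx invmx_perm invg1 perm_mx1 mul1mx.
by apply: act_mx_frame (sgn_mx_isometry Y) _ => //; apply/octad_perm_sgn.
Qed.

(** * The linear form [eps] of a frame *)

Definition restr (Y : word) (x : V) : V := \row_j ((Y 0 j != 0)%:R * x 0 j).

Lemma mul_sgn_restr x Y : x *m sgn_mx Y = x - 2 *: restr Y x.
Proof.
apply/rowP=> j; rewrite mul_sgn_mx !mxE /sgn; case: eqP => _ /=; ring.
Qed.

Lemma form24_restr x y Y : form24 x (restr Y y) = form24 y (restr Y x).
Proof. by rewrite !form24E; apply: eq_bigr => j _; rewrite !mxE; ring. Qed.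

Lemma form24_restr_restr x y Y : form24 (restr Y x) (restr Y y) = form24 x (restr Y y).
Proof.
rewrite !form24E; apply: eq_bigr => j _; rewrite !mxE.
by case: (_ != 0); rewrite ?mul1r // !mul0r !mulr0.
Qed.

(* A sign change Y in the trio code multiplies the gluing by (-1)^eps. *)
Definition eps (T : 'M[rat]_(3, 24)) (Y : word) : 'F_2 :=
  par (form24 (row I0 T) (restr Y (row I1 T))).

Lemma frame_half_int O T i j : frame O T -> isint (2 * T i j).
Proof. by case=> gT _ _ _; have /GammaP[h _] := gT i; rewrite -(row_entry T). Qed.

Lemma oct_off O T i j : frame O T -> par (2 * T i j) = 1 - oct_mx O i j.
Proof.
case=> _ _ -> _; rewrite mxE.
by case: (j \in O i); rewrite /= ?subrr ?subr0.
Qed.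

Lemma Gamma_restr O T i Y : frame O T ->
  Gamma (restr Y (row i T)) <-> golay (off_word (row i (oct_mx O)) Y).
Proof.
move=> fT; have e j : 2 * restr Y (row i T) 0 j = (Y 0 j != 0)%:R * (2 * T i j).
  by rewrite mxE row_entry; ring.
have hint j : isint (2 * restr Y (row i T) 0 j).
  by rewrite e rpredM ?natr_int ?(frame_half_int _ _ fT).
have -> : off_word (row i (oct_mx O)) Y = half_word (restr Y (row i T)).
  apply/rowP=> j; rewrite mxE [in RHS]mxE e parM ?natr_int ?(frame_half_int _ _ fT) //.
  by rewrite par_natr F2_natr (oct_off _ _ fT) mulrC [row i _ 0 j]mxE.
by rewrite GammaP; split=> [[]|].
Qed.

(** The pairings form a symmetric matrix over F_2 with zero diagonal, by evenness, and zero row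
    sums, as the [t_i] sum to 0. So the off-diagonal entries coincide, and [eps] does not depend on
    the two rows chosen. *)
Lemma eps_pair O T Y i k : frame O T -> trio_code (oct_mx O) Y ->
  par (form24 (row k T) (restr Y (row i T))) = (i != k)%:R * eps T Y.
Proof.
move=> fT /trio_codeP cY; have [gT sT _ _] := fT.
have gY l : Gamma (restr Y (row l T)) by apply/(Gamma_restr _ _ fT).
pose b l m := par (form24 (row m T) (restr Y (row l T))).
have bC l m : b l m = b m l by rewrite /b form24_restr.
have b0 l : b l l = 0.
  rewrite /b -form24_restr_restr; apply/eqP; rewrite par_eq0 ?form24_int //.
  exact: Gamma_even.
have sb l : b l I0 + b l I1 + b l I2 = 0.
  rewrite /b -!parD ?rpredD ?form24_int // -!form24Dl -(sum3 (fun i => row i T)) sT.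
  by rewrite -(scale0r 0) form24Zl mul0r par0.
have F2e (x y : 'F_2) : x + y = 0 -> x = y.
  by move=> h; rewrite -[y]F2_opp; apply/eqP; rewrite -addr_eq0 h.
have e01 : b I0 I1 = b I0 I2 by apply: F2e; have := sb I0; rewrite b0 add0r.
have e12 : b I1 I0 = b I1 I2 by apply: F2e; have := sb I1; rewrite b0 addr0.
have e10 : b I0 I1 = b I1 I0 by rewrite bC.
have e20 : b I2 I0 = b I1 I0 by rewrite bC -e01.
have e21 : b I2 I1 = b I1 I0 by rewrite bC -e12.
rewrite -/(b i k) /eps -/(b I1 I0).
case: (ord3P i) => ->; case: (ord3P k) => ->; rewrite /= ?mul0r ?mul1r ?b0 //.
by rewrite -e01.
Qed.

Lemma off_wordE b Y j : off_word b Y 0 j = (1 - b 0 j) * Y 0 j.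
Proof. by rewrite mxE. Qed.

Lemma restrE Y x j : restr Y x 0 j = (Y 0 j != 0)%:R * x 0 j.
Proof. by rewrite mxE. Qed.

Lemma oct_mx_sum O j : is_trio O -> \sum_i oct_mx O i j = 1.
Proof.
move=> /trio_index[p hp]; rewrite (bigD1 (p j)) //= big1 => [|i]; rewrite mxE hp ?eqxx ?addr0 //.
by rewrite eq_sym => /negPf->.
Qed.

Lemma golay_octad O i : is_trio O -> golay (row i (oct_mx O)).
Proof. by case=> oO _; rewrite row_oct_mx; case/andP: (oO i). Qed.

Lemma trio_code_octad O i : is_trio O -> trio_code (oct_mx O) (row i (oct_mx O)).
Proof.
move=> tO; have [p hp] := trio_index tO; apply/trio_codeP=> k.
have e j l : row l (oct_mx O) 0 j = (p j == l)%:R by rewrite !mxE hp.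
have [->|nk] := eqVneq k i.
  rewrite (_ : off_word _ _ = 0) ?golay0 //; apply/rowP=> j; rewrite mxE e mxE.
  by case: eqP => _; rewrite ?subrr ?mul0r ?mulr0.
rewrite (_ : off_word _ _ = row i (oct_mx O)) ?golay_octad //; apply/rowP=> j; rewrite mxE !e.
by case: eqP => [->|_]; rewrite ?subr0 ?mul1r // (negPf nk) mulr0.
Qed.

Lemma off_word_sum O Y : is_trio O ->
  off_word (row I0 (oct_mx O)) Y + off_word (row I1 (oct_mx O)) Y = off_word (row I2 (oct_mx O)) Y.
Proof.
move=> tO; apply/rowP=> j; have := oct_mx_sum j tO; rewrite sum3 => s.
rewrite mxE !off_wordE !row_entry -mulrDl -s; congr (_ * _).
set a := oct_mx O I0 j; set b := oct_mx O I1 j; set c := oct_mx O I2 j.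
have -> : a + b + c - a + (a + b + c - b) = (a + b + c - c) + (c + c) by ring.
by rewrite F2_addxx addr0.
Qed.

(** The defect of additivity is the sum of [w], supported on the intersection of Y and Z. Mod 2 it
    is the inner product of two Golay words, Y restricted off the first octad and Z off the
    second. *)
Lemma eps_add O T Y Z : is_trio O -> frame O T -> trio_code (oct_mx O) Y ->
  trio_code (oct_mx O) Z -> eps T (Y + Z) = eps T Y + eps T Z.
Proof.
move=> tO fT cY cZ; have [gT _ _ _] := fT.
have gr W i : trio_code (oct_mx O) W -> Gamma (restr W (row i T)).
  by move=> /trio_codeP h; apply/(Gamma_restr _ _ fT).
have fi W : trio_code (oct_mx O) W -> isint (form24 (row I0 T) (restr W (row I1 T))).
  by move=> cW; apply: form24_int => //; apply: gr.
pose w j : rat := 2 * T I0 j * (2 * T I1 j) * ((Y 0 j != 0)%:R * (Z 0 j != 0)%:R).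
have wint j : isint (w j).
  apply: rpredM; last by apply: rpredM; apply: natr_int.
  by apply: rpredM; apply: frame_half_int fT.
have e : form24 (row I0 T) (restr (Y + Z) (row I1 T)) =
    form24 (row I0 T) (restr Y (row I1 T)) + form24 (row I0 T) (restr Z (row I1 T)) - \sum_j w j.
  rewrite !form24E -big_split -sumrB; apply: eq_bigr => j _.
  rewrite !restrE !row_entry mxE /w.
  case: (F2_cases (Y 0 j)) => ->; case: (F2_cases (Z 0 j)) => ->;
    rewrite ?addr0 ?add0r ?F2_addxx ?eqxx /=; ring.
have [j _|sint se] := @par_sum _ (index_enum 'I_24) xpredT w; first exact: wint.
rewrite /eps e parB ?rpredD ?fi // parD ?fi // se.
suff -> : \sum_j par (w j) = 0 by rewrite addr0.
move/trio_codeP: cY => /(_ I0) c0; move/trio_codeP: cZ => /(_ I1) c1.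
apply: etrans (golay_orth c0 c1); apply: eq_bigr => j _.
have h i := frame_half_int i j fT.
have hYZ : isint ((Y 0 j != 0)%:R * (Z 0 j != 0)%:R : rat).
  by apply: rpredM; apply: natr_int.
rewrite !off_wordE !row_entry -(oct_off I0 j fT) -(oct_off I1 j fT) /w.
move: (h I0) (h I1); move: (2 * T I0 j) (2 * T I1 j) => a b ha hb.
rewrite parM // ?(rpredM ha hb) // parM // -natrM par_natr natrM !F2_natr; ring.
Qed.

(** On [O_i] the coordinates of [t_i] are integers and the doubled ones of [t_k] are odd, so the
    value is Q mod 2, with Q the sum of the squares of the former. The 16 odd squares off [O_i] are
    1 mod 8 and contribute a multiple of 4 to the norm; norm 2 mod 8 then makes Q odd. *)
Lemma eps_octad O T i : is_trio O -> frame O T -> eps T (row i (oct_mx O)) = 1.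
Proof.
move=> tO fT; have [p hp] := trio_index tO; have [gT _ pT nT] := fT.
have co := trio_code_octad i tO.
have [k nk] : exists k : 'I_3, i != k by case: (ord3P i) => ->; [exists I1|exists I0|exists I0].
have := eps_pair i k fT co; rewrite nk mul1r => <-.
have h2 l j : isint (2 * T l j) := frame_half_int l j fT.
have tint j : p j = i -> isint (T i j).
  move=> pj; have : par (2 * T i j) == 0 by rewrite pT hp pj eqxx.
  by rewrite par_eq0 // mulrAC divff // mul1r.
have odd_sq (x : rat) : isint x -> par x = 1 -> isint ((x ^+ 2 - 1) / 8).
  move=> hx px; have hx1 : isint ((x - 1) / 2).
    by rewrite -par_eq0 ?rpredB ?rpred1 // parB ?rpred1 // par1 px F2_addxx.
  have -> : (x ^+ 2 - 1) / 8 = (x - 1) / 2 * ((x - 1) / 2 - 1) / 2 + (x - 1) / 2 by field.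
  by rewrite rpredD // isint_binom.
have form_o : form24 (row k T) (restr (row i (oct_mx O)) (row i T)) =
    \sum_(j | p j == i) 2 * T k j * T i j.
  rewrite form24E [RHS]big_mkcond; apply: eq_bigr => j _.
  rewrite restrE !row_entry [oct_mx _ _ _]mxE hp.
  by case: (p j == i); rewrite /= ?mul1r // mul0r mulr0.
rewrite form_o; pose Q := \sum_(j | p j == i) T i j * T i j.
have [j /eqP pj|Qint eQ] := @par_sum _ (index_enum 'I_24) (fun j => p j == i) (fun j => T i j * T i j).
  by apply: rpredM; apply: tint.
have [j /eqP pj|_ ->] := @par_sum _ (index_enum 'I_24) (fun j => p j == i) (fun j => 2 * T k j * T i j).
  by apply: rpredM => //; apply: tint.
have -> : \sum_(j | p j == i) par (2 * T k j * T i j) = par Q.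
  rewrite eQ; apply: eq_bigr => j /eqP pj; have hj := tint j pj.
  rewrite parM // pT hp pj nk mul1r parM //.
  by case: (F2_cases (par (T i j))) => ->; rewrite ?mulr0 ?mulr1.
pose Z := \sum_(j | p j != i) ((2 * T i j) ^+ 2 - 1) / 8.
have Zint : isint Z.
  by apply: isint_sum => j pj; apply: odd_sq => //; rewrite pT hp pj.
have card16 : (\sum_(j | p j != i) 1 = 16 :> rat).
  have [/(_ i)/andP[/eqP cO _] _] := tO.
  rewrite sumr_const; congr (_%:R).
  have := cardC [pred j | p j == i]; rewrite card_ord (_ : #|[pred j | p j == i]| = 8%N).
    by move=> c; apply: (@addnI 8); rewrite -[RHS]c; congr (_ + _)%N; apply: eq_card.
  by apply: etrans cO; apply: eq_card => j; rewrite inE hp.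
have -> : Q = 1 + 2 * (2 * ((form24 (row i T) (row i T) - 2) / 8) - 2 - Z).
  have -> : Z = (\sum_(j | p j != i) 2 * T i j * T i j) / 4 - 2.
    transitivity ((\sum_(j | p j != i) 2 * T i j * T i j) / 4 - (\sum_(j | p j != i) 1) / 8).
      by rewrite /Z !mulr_suml -sumrB; apply: eq_bigr => j _; field.
    by rewrite card16; field.
  rewrite form24E (bigID (fun j => p j == i)) /=.
  rewrite (eq_bigr (fun j => 2 * (T i j * T i j))) => [|j _]; last by rewrite row_entry mulrA.
  rewrite -mulr_sumr -/Q (eq_bigr (fun j => 2 * T i j * T i j)) => [|j _]; last by rewrite row_entry.
  by field.
have hz : isint (2 * ((form24 (row i T) (row i T) - 2) / 8) - 2 - Z).
  have i2 : isint (2 : rat) := natr_int _ 2.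
  by apply: rpredB Zint; apply: rpredB i2; apply: rpredM.
by rewrite parD ?rpred1 // ?par2 // ?par1 ?addr0 // rpredM // natr_int.
Qed.

Lemma eps_ext O T T' (M : 'M['F_2]_(3, 24)) : is_trio O -> frame O T -> frame O T' ->
    (forall Y, trio_code (oct_mx O) Y = (Y <= col_mx (oct_mx O) M)%MS) ->
    (forall k, eps T (row k M) = eps T' (row k M)) ->
  forall Y, trio_code (oct_mx O) Y -> eps T Y = eps T' Y.
Proof.
move=> tO fT fT' cM eM Y; rewrite cM => /submxP[c ->].
rewrite mulmx_sum_row; set B := col_mx _ _.
suff [] : trio_code (oct_mx O) (\sum_k c 0 k *: row k B) /\
    eps T (\sum_k c 0 k *: row k B) = eps T' (\sum_k c 0 k *: row k B) by [].
apply: (big_ind (fun Y => trio_code (oct_mx O) Y /\ eps T Y = eps T' Y)).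
- split; first exact: trio_code0.
  by rewrite /eps; congr par; rewrite !form24E !big1 // => j _; rewrite !mxE !eqxx !mul0r mulr0.
- move=> X1 X2 [cA eA] [cB eB]; split; first exact: trio_codeD.
  by rewrite !(eps_add tO) // eA eB.
move=> k _; have ck : trio_code (oct_mx O) (row k B) by rewrite cM row_sub.
case: (F2_cases (c 0 k)) => ->.
  rewrite scale0r; split; first exact: trio_code0.
  by rewrite /eps; congr par; rewrite !form24E !big1 // => j _; rewrite !mxE !eqxx !mul0r mulr0.
rewrite scale1r; split=> //; rewrite /B; case: (split_ordP k) => l ->.
  by rewrite rowKu !(eps_octad _ tO).
by rewrite rowKd.
Qed.

Lemma sign_transport_golay O T T' : is_trio O -> frame O T -> frame O T' ->
    (forall Y, trio_code (oct_mx O) Y -> eps T Y = eps T' Y) ->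
  exists Y, forall i, golay (\row_j par (T i j - T' i j) + off_word (row i (oct_mx O)) Y).
Proof.
move=> tO fT fT' eqeps; have [p hp] := trio_index tO; have [gT sT pT nT] := fT; have [gT' sT' pT' nT'] := fT'.
have dint i j : isint (T i j - T' i j).
  have -> : T i j - T' i j = (2 * T i j - 2 * T' i j) / 2 by field.
  have h2 := frame_half_int i j fT; have h2' := frame_half_int i j fT'.
  by rewrite -par_eq0 ?rpredB // parB // pT pT' F2_addxx.
pose v i : word := \row_j par (T i j - T' i j).
pose D i : 'M['F_2]_24 := diag_mx (\row_j (1 - oct_mx O i j)).
have offE i Y : off_word (row i (oct_mx O)) Y = Y *m D i.
  by apply/rowP=> j; rewrite mul_mx_diag !mxE mulrC.
(* Its row space consists of the restrictions of a common [Y] off the first two octads, each modulo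
   the Golay code; membership of [(v I0, v I1)] is solvability, tested on the cokernel. *)
pose M := col_mx (row_mx (D I0) (D I1)) (col_mx (row_mx golay_gen 0) (row_mx 0 golay_gen)).
have : (row_mx (v I0) (v I1) <= M)%MS.
  rewrite submxE; set K := cokermx M.
  have MK : M *m K = 0 by apply: mulmx_coker.
  have [Ku [Kd eK]] : exists Ku Kd, K = col_mx Ku Kd by exists (usubmx K), (dsubmx K); rewrite vsubmxK.
  move: MK; rewrite eK /M !mul_col_mx !mul_row_col !mul0mx addr0 add0r.
  rewrite -[0 in RHS]vsubmxK => /eq_col_mx[h1]; rewrite -[dsubmx 0]vsubmxK => /eq_col_mx[h2 h3].
  rewrite !linear0 in h1 h2 h3; apply/eqP/rowP=> k.
  pose g0 : word := (col k Ku)^T; pose g1 : word := (col k Kd)^T.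
  have gg (A : 'M['F_2]_(24, _)) : golay_gen *m A = 0 -> golay (col k A)^T.
    move=> hA; rewrite golay_dual -trmx_mul; apply/eqP/trmx_inj.
    by rewrite trmxK trmx0 colE mulmxA hA mul0mx.
  have gg0 : golay g0 by apply: gg.
  have gg1 : golay g1 by apply: gg.
  have rel j : (1 - oct_mx O I0 j) * g0 0 j + (1 - oct_mx O I1 j) * g1 0 j = 0.
    have := congr1 (fun A : 'M_(24, _) => A j k) h1.
    by rewrite /D mxE !mul_diag_mx !mxE.
  (* By [rel], [g0] vanishes on the second octad, [g1] on the first, and they agree on the third; so
     one word restricts to both. *)
  pose Z : word := \row_j (g0 0 j + oct_mx O I1 j * g1 0 j).
  have ZE j : Z 0 j = g0 0 j + oct_mx O I1 j * g1 0 j by rewrite mxE.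
  have oE i j : oct_mx O i j = (p j == i)%:R by rewrite mxE hp.
  have o1 : off_word (row I1 (oct_mx O)) Z = g0.
    apply/rowP=> j; rewrite off_wordE row_entry ZE; move: (rel j); rewrite !oE.
    by case: (ord3P (p j)) => -> /=; rewrite ?subr0 ?subrr ?mul0r ?mul1r ?addr0 ?add0r // => ->.
  have o0 : off_word (row I0 (oct_mx O)) Z = g1.
    apply/rowP=> j; rewrite off_wordE row_entry ZE; move: (rel j); rewrite !oE.
    case: (ord3P (p j)) => -> /=; rewrite ?subr0 ?subrr ?mul0r ?mul1r ?addr0 ?add0r //.
      by move=> ->; rewrite add0r.
    by move/eqP; rewrite addr_eq0 F2_opp => /eqP.
  have cZ : trio_code (oct_mx O) Z.
    apply/trio_codeP=> i; case: (ord3P i) => ->; rewrite ?o0 ?o1 //.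
    by rewrite -off_word_sum // o0 o1 golayD.
  have gr S : frame O S -> isint (form24 (row I0 S) (restr Z (row I1 S))).
    move=> fS; have [gS _ _ _] := fS; apply: form24_int => //.
    by apply/(Gamma_restr _ _ fS); move/trio_codeP: cZ; apply.
  (* The difference of the two products is split so that all factors are integral; mod 2 the terms
     are those of the pairings with [g0] and [g1]. *)
  pose w j : rat := (Z 0 j != 0)%:R *
    ((T I0 j - T' I0 j) * (2 * T' I1 j) + 2 * T I0 j * (T I1 j - T' I1 j)).
  have fi i j : isint (2 * T i j) := frame_half_int i j fT.
  have fi' i j : isint (2 * T' i j) := frame_half_int i j fT'.
  have wi j : isint (w j).
    apply: rpredM; first exact: natr_int.
    by apply: rpredD; apply: rpredM.
  have ew : form24 (row I0 T) (restr Z (row I1 T)) - form24 (row I0 T') (restr Z (row I1 T')) =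
      \sum_j w j.
    rewrite !form24E -sumrB; apply: eq_bigr => j _; rewrite !restrE !row_entry /w; ring.
  have [j _|_ sw] := @par_sum _ (index_enum 'I_24) xpredT w; first exact: wi.
  have : par (\sum_j w j) = 0.
    by rewrite -ew parB ?gr // -/(eps T Z) -/(eps T' Z) eqeps // F2_addxx.
  rewrite sw => s0; rewrite [RHS]mxE -[RHS]s0 mxE [(v I0 *m Ku) _ _]mxE [(v I1 *m Kd) _ _]mxE -big_split.
  apply: eq_bigr => j _ /=.
  have -> : Ku j k = g0 0 j by rewrite !mxE.
  have -> : Kd j k = g1 0 j by rewrite !mxE.
  rewrite -o0 -o1 !off_wordE !row_entry -(oct_off I0 j fT) -(oct_off I1 j fT') /w ![v _ _ _]mxE.
  move: (dint I0 j) (dint I1 j) (fi I0 j) (fi' I1 j).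
  move: (T I0 j - T' I0 j) (T I1 j - T' I1 j) (2 * T I0 j) (2 * T' I1 j) => a b c d ha hb hc hd.
  rewrite parM ?natr_int // ?rpredD ?rpredM // par_natr F2_natr.
  by rewrite parD ?rpredM // !parM //; ring.
move=> /submxP[c]; rewrite -[c]hsubmxK -[rsubmx c]hsubmxK !mul_row_col !mul_mx_row !mulmx0.
rewrite !add_row_mx addr0 add0r => /eq_row_mx[e0 e1]; exists (lsubmx c) => i.
have g i' (b : 'rV_12) : v i' = lsubmx c *m D i' + b *m golay_gen ->
    golay (v i' + off_word (row i' (oct_mx O)) (lsubmx c)).
  move=> ->; rewrite offE addrAC addww add0r; exact: submxMl.
have g0 := g I0 _ e0; have g1 := g I1 _ e1; rewrite -/(v i).
(* The third condition is the sum of the first two. *)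
case: (ord3P i) => -> //; rewrite -off_word_sum //.
have -> : v I2 = v I0 + v I1.
  apply/rowP=> j; rewrite !mxE.
  have s S : \sum_i row i S = 0 -> S I2 j = - (S I0 j + S I1 j) :> rat.
    move=> /(congr1 (fun x : V => x 0 j)); rewrite sum3 !mxE => /eqP.
    by rewrite addrC addr_eq0 => /eqP.
  transitivity (par (- (T I0 j - T' I0 j + (T I1 j - T' I1 j)))).
    by congr par; rewrite (s T) // (s T') //; ring.
  by rewrite parN; [apply: parD|apply: rpredD].
by rewrite addrACA golayD.
Qed.

(** The half difference of the two frames is minus the restriction of [t_i] to Y: lying in [Gamma]
    is the code condition, and lying in K is the vanishing of [eps]. *)
Lemma sgn_frame_datum (h : 'I_3 -> H2) O T Y : injective h -> (forall i, h i != 0) ->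
    is_trio O -> frame O T ->
  frame_datum h (T *m sgn_mx Y) = frame_datum h T <->
  trio_code (oct_mx O) Y /\ eps T Y = 0.
Proof.
move=> h_inj h0 tO fT; have fS := sgn_frame Y tO fT; have [gT _ _ _] := fT.
have sK := frame_ker_subgroup gT.
have e i : 2^-1 *: (row i (T *m sgn_mx Y) - row i T) = - restr Y (row i T).
  by rewrite row_mul mul_sgn_restr addrAC subrr add0r scalerN scalerA mulVf // scale1r.
rewrite (frame_datum_eq h_inj h0 fS fT); split=> [hK|[cY eY] i].
  have {}hK i : frame_ker T (restr Y (row i T)).
    by have := subgroupN sK (hK i); rewrite e opprK.
  split; last by rewrite /eps; have [_ ->] := hK I1.
  by apply/trio_codeP=> i; apply/(Gamma_restr _ _ fT); case: (hK i).
rewrite e; apply: (subgroupN sK); split=> [|k].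
  by apply/(Gamma_restr _ _ fT); move/trio_codeP: cY; apply.
by rewrite (eps_pair _ _ fT cY) eY mulr0.
Qed.

Lemma eps_sgn T Y Z : eps (T *m sgn_mx Y) Z = eps T Z.
Proof.
rewrite /eps; congr par; rewrite !form24E; apply: eq_bigr => j _.
rewrite !restrE !row_entry !mul_sgn_mx -[RHS]mulr1 -(sgn_sqr (Y 0 j)); ring.
Qed.

(** For Y in the trio code, [eps T Y = 0] means that the sign change Y fixes the datum, a condition
    on the datum alone. *)
Lemma frame_datum_eps (h : 'I_3 -> H2) O T T' Y : injective h -> (forall i, h i != 0) ->
    is_trio O -> frame O T -> frame O T' -> trio_code (oct_mx O) Y ->
  frame_datum h T = frame_datum h T' -> eps T Y = eps T' Y.
Proof.
move=> h_inj h0 tO fT fT' cY eTT'.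
have actE S : frame O S -> act h (sgn_mx Y) 1 (frame_datum h S) = frame_datum h (S *m sgn_mx Y).
  move=> fS; rewrite (act_frame_datum h_inj h0 fS (sgn_mx_isometry Y)); last exact/octad_perm_sgn.
  by rewrite /act_mx invmx_perm invg1 perm_mx1 mul1mx.
have : eps T Y = 0 <-> eps T' Y = 0.
  have h1 := sgn_frame_datum Y h_inj h0 tO fT; have h2 := sgn_frame_datum Y h_inj h0 tO fT'.
  rewrite -(actE _ fT) in h1; rewrite -(actE _ fT') -eTT' in h2; split=> e.
    by have [] := h2.1 (h1.2 (conj cY e)).
  by have [] := h1.1 (h2.2 (conj cY e)).
case: (F2_cases (eps T Y)) => ->; case: (F2_cases (eps T' Y)) => -> // -[h1 h2].
  by rewrite h1.
by rewrite h2.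
Qed.

Lemma zero_sum3 (c : 'I_3 -> 'I_3 -> 'F_2) : (forall i, c i i = 0) ->
    (forall i, c i I0 + c i I1 + c i I2 = 0) -> (forall k, c I0 k + c I1 k + c I2 k = 0) ->
  forall i k, c i k = (i != k)%:R * c I0 I1.
Proof.
move=> c0 cr cc.
have F2e (x y : 'F_2) : x + y = 0 -> x = y.
  by move=> h; rewrite -[y]F2_opp; apply/eqP; rewrite -addr_eq0 h.
have e1 : c I0 I2 = c I0 I1 by apply/esym/F2e; have := cr I0; rewrite c0 add0r.
have e2 : c I2 I1 = c I0 I1 by apply/esym/F2e; have := cc I1; rewrite c0 addr0.
have e3 : c I2 I0 = c I0 I1 by rewrite -e2; apply: F2e; have := cr I2; rewrite c0 addr0.
have e4 : c I1 I0 = c I0 I1 by rewrite -e3; apply: F2e; have := cc I0; rewrite c0 add0r.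
have e5 : c I1 I2 = c I0 I1 by rewrite -e4; apply/esym/F2e; have := cr I1; rewrite c0 addr0.
by move=> i k; case: (ord3P i) => ->; case: (ord3P k) => ->; rewrite /= ?mul0r ?mul1r ?c0.
Qed.

Lemma sgn_mx_const1 m (A : 'M[rat]_(m, 24)) : A *m sgn_mx (const_mx 1) = - A.
Proof. by apply/matrixP=> i j; rewrite mul_sgn_mx !mxE mulrN1. Qed.

(* The two gluings over a given quotient map differ by the central element -1. *)
Lemma sign_transport (h : 'I_3 -> H2) O T T' : injective h -> (forall i, h i != 0) ->
    is_trio O -> frame O T -> frame O T' ->
    (forall Y, trio_code (oct_mx O) Y -> eps T Y = eps T' Y) ->
  exists Y, frame_datum h (T *m sgn_mx Y) = frame_datum h T'.
Proof.
move=> h_inj h0 tO fT fT' eqeps; have [Y hY] := sign_transport_golay tO fT fT' eqeps.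
have fS := sgn_frame Y tO fT; have [gT sT pT nT] := fT; have [gT' sT' pT' nT'] := fT'.
have [gS sS pS nS] := fS; have sK := frame_ker_subgroup gT'.
pose d i : V := 2^-1 *: (row i (T *m sgn_mx Y) - row i T').
have gd i : Gamma (d i).
  have e j : 2 * d i 0 j = T i j - T' i j - (Y 0 j != 0)%:R * (2 * T i j).
    by rewrite mxE row_mul mul_sgn_restr !mxE; field.
  have hT j : isint (2 * T i j) := frame_half_int i j fT.
  have hT' j : isint (2 * T' i j) := frame_half_int i j fT'.
  have dint j : isint (T i j - T' i j).
    have -> : T i j - T' i j = (2 * T i j - 2 * T' i j) / 2 by field.
    by rewrite -par_eq0 ?rpredB // parB // pT pT' F2_addxx.
  have yint j : isint ((Y 0 j != 0)%:R * (2 * T i j)).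
    by apply: rpredM => //; apply: natr_int.
  apply/GammaP; split=> [j|]; first by rewrite e; apply: rpredB.
  congr (golay _): (hY i); apply/rowP=> j; rewrite [LHS]mxE [RHS]mxE e parB //.
  rewrite off_wordE row_entry -(oct_off i j fT) mxE; move: (2 * T i j) (hT j) => a ha.
  by rewrite parM ?natr_int // par_natr F2_natr mulrC.
pose c i k := par (form24 (row k T') (d i)).
have fint i k : isint (form24 (row k T') (d i)) by apply: form24_int.
(* Both [t_i'] and [t_i' + 2 d_i] have norm 2 mod 8, so [(t_i', d_i) + d_i^2] is even, and so is
   [d_i^2]. *)
have c0 i : c i i = 0.
  have eS : row i (T *m sgn_mx Y) = row i T' + 2 *: d i.
    by rewrite /d scalerA divff // scale1r addrC subrK.
  apply/eqP; rewrite par_eq0 //; move: (d i) (gd i) eS => di gdi eS.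
  have -> : form24 (row i T') di / 2 = (form24 (row i (T *m sgn_mx Y)) (row i (T *m sgn_mx Y)) - 2) / 8
      - (form24 (row i T') (row i T') - 2) / 8 - form24 di di / 2.
    by rewrite eS form24Dr !form24Dl !form24Zr !form24Zl [form24 di (row i T')]form24C; field.
  by apply: rpredB; [apply: rpredB|apply: Gamma_even].
have cr i : c i I0 + c i I1 + c i I2 = 0.
  rewrite /c -!parD ?rpredD // -!form24Dl -(sum3 (fun i => row i T')) sT'.
  by rewrite -(scale0r 0) form24Zl mul0r par0.
have sd : d I0 + d I1 + d I2 = 0.
  rewrite -(sum3 d) /d -scaler_sumr sumrB; move: sS sT' => /= -> ->.
  by rewrite subrr scaler0.
have cc k : c I0 k + c I1 k + c I2 k = 0.
  by rewrite /c -!parD ?rpredD // -!form24Dr sd -(scale0r 0) form24Zr mul0r par0.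
have ce := zero_sum3 c0 cr cc.
case: (F2_cases (c I0 I1)) => ec.
  exists Y; apply/(frame_datum_eq h_inj h0 fS fT') => i; split; first exact: gd.
  by move=> k; rewrite -/(c i k) ce ec mulr0.
(* Negating the frame turns [d_i] into [-(d_i + t_i')], and [(t_k', t_i')] cancels the discrepancy
   mod 2. *)
exists (Y + const_mx 1).
have eS : T *m sgn_mx (Y + const_mx 1) = - (T *m sgn_mx Y).
  by rewrite sgn_mxD mulmxA sgn_mx_const1.
have fS' := sgn_frame (Y + const_mx 1) tO fT; rewrite eS in fS' *.
apply/(frame_datum_eq h_inj h0 fS' fT') => i.
have -> : 2^-1 *: (row i (- (T *m sgn_mx Y)) - row i T') = - (d i + row i T').
  by apply/rowP=> j; rewrite /d !mxE; move: (\sum_k _) => s; field.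
apply: (subgroupN sK); split=> [|k]; first by apply: GammaD; [exact: gd|exact: gT'].
rewrite form24Dr parD; [|exact: fint|exact: form24_int].
by rewrite -/(c i k) ce ec mulr1 (frame_par _ _ fT') eq_sym F2_addxx.
Qed.

(** The norm of each row is 2 * (16/4 + 1) = 10, which is 2 mod 8; the cyclic choice of signs makes
    the rows sum to 0. *)
Lemma frame_exists O : is_trio O -> exists T, frame O T.
Proof.
move=> tO; have [p hp] := trio_index tO; have [r hr] := trio_root tO.
have pr i : p (r i) = i by apply/eqP; rewrite -hp.
(* -1 at a chosen point of O_i, 0 elsewhere on O_i, and 1/2 or -1/2 off O_i. *)
pose t (i k : 'I_3) (b : bool) : rat :=
  if i == k then (if b then -1 else 0) else
  if b || (i == k + 1) then 2^-1 else - 2^-1.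
pose T : 'M[rat]_(3, 24) := \matrix_(i, j) t i (p j) (j == r (p j)).
have TE i j : T i j = t i (p j) (j == r (p j)) by rewrite mxE.
have pT i j : par (2 * T i j) = (j \notin O i)%:R.
  rewrite TE hp /t eq_sym; case: ifP => _ /=.
    by case: ifP => _; rewrite par2 // rpredN.
  by case: ifP => _; rewrite ?mulrN divff // ?parN ?par1.
have Tint i j : isint (2 * T i j).
  rewrite TE /t; case: ifP => _; first by case: ifP => _; rewrite ?mulr0 // mulrN1 rpredN natr_int.
  by case: ifP => _; rewrite ?mulrN divff // rpredN.
exists T; split=> // [i||i].
- apply/GammaP; split=> [j|]; first by rewrite row_entry.
  (* The complement of an octad is the sum of the other two. *)
  have [k [l e]] : exists k l, forall j,
      (j \notin O i)%:R = (j \in O k)%:R + (j \in O l)%:R :> 'F_2.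
    by case: (ord3P i) => ->; [exists I1, I2|exists I0, I2|exists I0, I1] => j; rewrite !hp;
       case: (ord3P (p j)) => ->; apply: val_inj.
  rewrite (_ : half_word _ = row k (oct_mx O) + row l (oct_mx O)).
    by apply: golayD; apply: golay_octad.
  by apply/rowP=> j; rewrite mxE row_entry pT e !mxE.
- apply/rowP=> j; rewrite summxE sum3 !row_entry !TE mxE /t.
  by case: (ord3P (p j)) => ->; case: (j == _); rewrite /=; field.
have -> : form24 (row i T) (row i T) = 10; last first.
  by rewrite (_ : _ / 8 = 1) ?rpred1 //; field.
rewrite form24E (eq_bigr (fun j => 2^-1 - (j \in O i)%:R / 2 + 2 * (j == r i)%:R)) => [|j _]; last first.
  rewrite !row_entry !TE /t hp [i == p j]eq_sym; have [->|ne] := eqVneq (p j) i.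
    by case: eqP => _ /=; field.
  have -> : (j == r i) = false by apply: contraNF ne => /eqP->; rewrite pr.
  by case: ifP => _ /=; field.
have [/(_ i)/andP[/eqP cO _] _] := tO.
have s1 : \sum_j (j \in O i)%:R = 8 :> rat.
  transitivity (#|O i|%:R : rat); last by rewrite cO.
  rewrite -sum1_card natr_sum [in RHS]big_mkcond; apply: eq_bigr => j _.
  by case: (j \in O i).
have s2 : \sum_j (j == r i)%:R = 1 :> rat.
  by rewrite (bigD1 (r i)) //= big1 ?addr0 ?eqxx // => j /negPf->.
rewrite big_split sumrB /= sumr_const card_ord -mulr_suml -mulr_sumr s1 s2 -mulr_natr.
by field.
Qed.

(** * Code automorphisms as isometries *)

Lemma perm_frame_mx m (A : 'M[rat]_(m, 24)) (s : 'S_24) : A *m perm_mx s = col_perm s^-1%g A.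
Proof. by rewrite col_permE invgK. Qed.

Lemma root_perm_mx j (s : 'S_24) : root_vec j *m perm_mx s = root_vec (s j).
Proof.
apply/rowP=> k; rewrite perm_frame_mx !mxE eqxx /=; congr (_%:R).
by rewrite -[k in RHS](permKV s) (inj_eq perm_inj).
Qed.

Lemma perm_mx_isometry (s : 'S_24) : golay_aut s -> Defs.isometry (perm_mx s).
Proof.
move=> gs; split=> [x y|].
  rewrite !form24E [RHS](reindex_inj (@perm_inj _ s^-1%g)) /=; apply: eq_bigr => j _.
  by rewrite !perm_frame_mx !mxE.
have h t x : golay_aut t -> Gamma x -> Gamma (x *m perm_mx t).
  move=> gt /GammaP[hx gx]; apply/GammaP; split=> [j|].
    by rewrite perm_frame_mx mxE.
  have := golay_autV gt gx; congr (golay _); apply/rowP=> j.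
  by rewrite perm_frame_mx !mxE.
apply/seteqP; split=> x; first by case=> y gy <-; apply: h.
move=> gx; exists (x *m perm_mx s^-1%g); first by apply: h => //; apply: golay_autV.
by rewrite -mulmxA -perm_mxM mulVg perm_mx1 mulmx1.
Qed.

Lemma octad_stable O s : col_perm s (oct_mx O) = oct_mx O -> forall i, (s @: O i)%SET = O i.
Proof.
move=> e i; have h j : (s j \in O i) = (j \in O i).
  by apply: F2_natr_inj; have /matrixP/(_ i j) := e; rewrite !mxE.
apply/setP=> j; rewrite -[j](permKV s) mem_imset ?h //; exact: perm_inj.
Qed.

Lemma eps_perm T Y (s : 'S_24) : eps (T *m perm_mx s) Y = eps T (col_perm s Y).
Proof.
rewrite /eps; congr par; rewrite !form24E (reindex_inj (@perm_inj _ s)) /=.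
apply: eq_bigr => j _; rewrite !restrE !row_entry !perm_frame_mx.
by rewrite !mxE permK.
Qed.

(** * Counting orbits *)

(** Passes from finite counting to classical cardinality: the image is in bijection with the
    partition into fibres, all of size [K]. *)
Lemma card_range (A : finType) (B : Type) (f : A -> B) (N K : nat) :
    (0 < K)%N -> #|A| = (N * K)%N ->
    (forall x, #|[set y | `[< f y = f x >]]%SET| = K) ->
  [set f x | x in [set: A]] #= `I_N.
Proof.
move=> K0 cA cf; pose cl x := [set y | `[< f y = f x >]]%SET.
pose P := (cl @: A)%SET.
have clP x y : reflect (f y = f x) (y \in cl x) by rewrite inE; apply: asboolP.
have cl_mem x : x \in cl x by apply/clP.
have cl_eq x y : f x = f y -> cl x = cl y.
  by move=> e; apply/setP=> z; apply/clP/clP; rewrite e.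
have cl_inj x y : cl x = cl y -> f x = f y.
  by move=> e; have := cl_mem x; rewrite e => /clP.
have cP : #|P| = N.
  have pP : finset.partition P [set: A]%SET.
    apply/and3P; split.
    - apply/eqP/setP=> x; rewrite inE; apply/bigcupP; exists (cl x) => //.
      exact: imset_f.
    - apply/finset.trivIsetP=> _ _ /imsetP[x _ ->] /imsetP[y _ ->] ne.
      apply/pred0P=> z /=; apply/negbTE; apply: contra ne => /andP[].
      by move=> /clP e1 /clP e2; apply/eqP/cl_eq; rewrite -e1.
    - apply/imsetP=> -[x _ e]; have := cl_mem x; by rewrite -e inE.
  have := card_uniform_partition _ pP => /(_ K) h.
  apply/eqP; rewrite -(eqn_pmul2r K0) -cA -cardsT; apply/eqP/esym/h.
  by move=> _ /imsetP[x _ ->]; apply: cf.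
have rep (X : 'I_N) : exists x, cl x = enum_val (cast_ord (esym cP) X).
  have := enum_valP (cast_ord (esym cP) X) => /imsetP[x _ e].
  by exists x.
pose g X := f (projT1 (cid (rep X))).
have gE X : cl (projT1 (cid (rep X))) = enum_val (cast_ord (esym cP) X) by case: cid.
have g_inj : {in [set: 'I_N] &, injective g}.
  move=> X Y _ _ /cl_eq; rewrite !gE => /enum_val_inj; exact: cast_ord_inj.
have <- : [set g X | X in [set: 'I_N]] = [set f x | x in [set: A]].
  apply/seteqP; split=> y; first by case=> X _ <-; exists (projT1 (cid (rep X))).
  case=> x _ <-; have Px : cl x \in P by apply: imset_f.
  exists (cast_ord cP (enum_rank_in Px (cl x))) => //.
  by apply: cl_inj; rewrite gE cast_ordK enum_rankK_in.
apply: card_eq_trans (inj_card_eq g_inj) _.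
by rewrite card_eq_sym; apply: card_II.
Qed.

Lemma card_trio_code O : is_trio O -> #|[set Y | trio_code (oct_mx O) Y]%SET| = (2 ^ 6)%N.
Proof.
move=> /trio_space[M [Mfree MP _]].
have <- : #|[set c *m col_mx (oct_mx O) M | c in [set: 'rV['F_2]_(3 + 3)]]%SET| = (2 ^ 6)%N.
  rewrite card_imset ?cardsT ?card_mx ?card_Fp //.
  exact: (can_inj (mulmxKp Mfree)).
apply: eq_card => Y; rewrite inE MP; apply/submxP/imsetP=> [[c ->]|[c _ ->]]; first by exists c.
by exists c.
Qed.

(** Adding an octad, where [eps] is 1, exchanges the two halves of the code. *)
Lemma card_eps_ker O T : is_trio O -> frame O T ->
  #|[set Y | trio_code (oct_mx O) Y && (eps T Y == 0)]%SET| = (2 ^ 5)%N.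
Proof.
move=> tO fT; set A := [set Y | _ && _]%SET; pose o := row I0 (oct_mx O).
have co : trio_code (oct_mx O) o by apply: trio_code_octad.
have eo Y : trio_code (oct_mx O) Y -> eps T (Y + o) = eps T Y + 1.
  by move=> cY; rewrite (eps_add tO fT) // eps_octad.
have hB : [set Y | trio_code (oct_mx O) Y && (eps T Y != 0)]%SET = [set Y + o | Y in A]%SET.
  apply/setP=> Y; rewrite inE; apply/andP/imsetP=> [[cY eY]|[X]]; last first.
    by rewrite inE => /andP[cX /eqP eX] ->; rewrite trio_codeD // eo // eX add0r.
  exists (Y + o); last by rewrite -addrA addww addr0.
  rewrite inE trio_codeD // eo //; move: eY; by case: (F2_cases (eps T Y)) => ->.
have := card_trio_code tO; rewrite (_ : [set Y | trio_code _ Y]%SET = A :|: [set Y + o | Y in A])%SET; last first.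
  by rewrite -hB; apply/setP=> Y; rewrite !inE -andb_orr orbN andbT.
rewrite cardsU disjoint_setI0 ?cards0 ?subn0 => [|]; last first.
  by rewrite -hB; apply/pred0P=> Y /=; rewrite !inE; case: (eps T Y == 0); rewrite ?andbF.
rewrite card_imset; last exact: addIr.
by rewrite addnn -mul2n expnS => /eqP; rewrite eqn_pmul2l // => /eqP.
Qed.

(** The fibre through Y is the coset of Y modulo the kernel of [eps], which is the same along the
    orbit; 24 - 5 = 19. *)
Lemma card_sign_orbit (h : 'I_3 -> H2) O T : injective h -> (forall i, h i != 0) ->
  is_trio O -> frame O T ->
  [set frame_datum h (T *m sgn_mx Y) | Y in [set: word]] #= `I_(2 ^ 19).
Proof.
move=> h_inj h0 tO fT; apply: (@card_range _ _ _ _ (2 ^ 5)); first by [].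
  by rewrite card_mx (card_Fp (isT : prime 2)) -expnD; apply: (congr1 (expn 2)).
move=> Y; rewrite -(card_eps_ker tO fT) -[RHS](card_imset _ (addIr Y)).
apply: eq_card => Z; apply/idP/imsetP=> [|[X hX ->]].
  rewrite inE => /asboolP e.
  exists (Z + Y); last by rewrite -addrA addww addr0.
  have fY := sgn_frame Y tO fT.
  have : frame_datum h (T *m sgn_mx Y *m sgn_mx (Z + Y)) = frame_datum h (T *m sgn_mx Y).
    by rewrite -mulmxA -sgn_mxD addrC -addrA addww addr0.
  by move=> /(sgn_frame_datum _ h_inj h0 tO fY)[cZ eZ]; rewrite inE cZ -(eps_sgn _ Y) eZ eqxx.
have /andP[cX /eqP eX] : trio_code (oct_mx O) X && (eps T X == 0) by move: hX; rewrite inE.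
have fY := sgn_frame Y tO fT.
rewrite inE; apply/asboolP; rewrite addrC sgn_mxD mulmxA; apply/(sgn_frame_datum _ h_inj h0 tO fY).
by rewrite eps_sgn.
Qed.

Lemma octad_stable_perm O g s : root_perm g s -> col_perm s (oct_mx O) = oct_mx O ->
  octad_perm O g 1.
Proof. by move=> hs es; exists s => // i; rewrite perm1 octad_stable. Qed.

(** A code automorphism fixing each octad adjusts [eps] to that of the target; a sign change then
    finishes. *)
Lemma Aut_trio_transitive (h : 'I_3 -> H2) O T T' : injective h -> (forall i, h i != 0) ->
    is_trio O -> frame O T -> frame O T' ->
  exists g, [/\ Aut_trio O g, octad_perm O g 1 & act h g 1 (frame_datum h T) = frame_datum h T'].
Proof.
move=> h_inj h0 tO fT fT'; have [M [_ MP Mt]] := trio_space tO.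
have [||s [gs fs es]] := Mt (eps T) (\row_k eps T' (row k M)).
- by move=> Y Z; apply: (eps_add tO fT).
- by move=> i; apply: eps_octad.
have is_s := perm_mx_isometry gs.
have rs : root_perm (perm_mx s) s by move=> j; left; apply: root_perm_mx.
have op_s := octad_stable_perm rs fs.
have act1 g S : act_mx 1 S g = S *m g by rewrite /act_mx invmx_perm invg1 perm_mx1 mul1mx.
have fs' : frame O (T *m perm_mx s) by rewrite -act1; apply: act_mx_frame.
have eqM k : eps (T *m perm_mx s) (row k M) = eps T' (row k M).
  by rewrite eps_perm es mxE.
have [Y eY] := sign_transport h_inj h0 tO fs' fT' (eps_ext tO fs' fT' MP eqM).
have ig : Defs.isometry (perm_mx s *m sgn_mx Y).
  have [i1 i2] := is_s; have [j1 j2] := sgn_mx_isometry Y.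
  by split=> [x y|]; [rewrite !mulmxA j1 i1|rewrite -mulset_mul i2 j2].
have rg : root_perm (perm_mx s *m sgn_mx Y) s.
  move=> j; rewrite mulmxA root_perm_mx root_sgn_mx /sgn.
  by case: ifP => _; [left|right]; rewrite ?scale1r ?scaleN1r.
have og := octad_stable_perm rg fs.
exists (perm_mx s *m sgn_mx Y); split=> //; first by split=> //; exists 1%g.
by rewrite (act_frame_datum h_inj h0 fT ig og) act1 mulmxA.
Qed.

Lemma card_sign_orbits (h : 'I_3 -> H2) O : injective h -> (forall i, h i != 0) -> is_trio O ->
  [set datum_orbit h O sign_changes d | d in deletion_data h O] #= `I_8.
Proof.
move=> h_inj h0 tO; have [M [_ MP Mt]] := trio_space tO.
have [T0 fT0] := frame_exists tO.
have rowM k : trio_code (oct_mx O) (row k M).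
  by rewrite MP (submx_trans (row_sub _ _)) // -addsmxE addsmxSr.
have ex (a : 'rV['F_2]_3) : exists T, frame O T /\ forall k, eps T (row k M) = a 0 k.
  have [||s [gs fs es]] := Mt (eps T0) a.
  - by move=> Y Z; apply: (eps_add tO fT0).
  - by move=> i; apply: eps_octad.
  exists (T0 *m perm_mx s); split=> [|k]; last by rewrite eps_perm.
  have rs : root_perm (perm_mx s) s by move=> j; left; apply: root_perm_mx.
  have -> : T0 *m perm_mx s = act_mx 1 T0 (perm_mx s).
    by rewrite /act_mx invmx_perm invg1 perm_mx1 mul1mx.
  by apply: act_mx_frame (perm_mx_isometry gs) (octad_stable_perm rs fs).
(* One frame for each of the 8 vectors of values on the rows of [M]; their sign orbits will exhaust
   the data. *)
pose F a := projT1 (cid (ex a)).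
have fF a : frame O (F a) by rewrite /F; case: cid => ? [].
have eF a k : eps (F a) (row k M) = a 0 k by rewrite /F; case: cid => ? [].
pose f a := datum_orbit h O sign_changes (frame_datum h (F a)).
have -> : [set datum_orbit h O sign_changes d | d in deletion_data h O] =
    [set f a | a in [set: 'rV['F_2]_3]].
  apply/seteqP; split=> X.
    case=> d /(deletion_data_frame h_inj h0 tO)[T fT ->] <-.
    pose a : 'rV['F_2]_3 := \row_k eps T (row k M).
    have eqM k : eps (F a) (row k M) = eps T (row k M) by rewrite eF mxE.
    have [Y eY] := sign_transport h_inj h0 tO (fF a) fT (eps_ext tO (fF a) fT MP eqM).
    exists a => //; rewrite /f -eY !(sign_orbitE h_inj h0 tO) //; last exact: sgn_frame.
    apply/seteqP; split=> d' [Z _ <-].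
      by exists (Y + Z) => //; rewrite sgn_mxD mulmxA sgn_mxK.
    by exists (Y + Z) => //; rewrite sgn_mxD mulmxA.
  case=> a _ <-; exists (frame_datum h (F a)) => //.
  exact: (frame_deletion_data h_inj h0 tO).
(* Fibres are singletons: [eps] depends only on the datum and is constant along sign orbits, so an
   orbit determines [a]. *)
apply: (@card_range _ _ f 8 1) => //; first by rewrite card_mx card_Fp.
move=> a; rewrite (_ : [set y | _]%SET = [set a]%SET) ?cards1 //.
apply/setP=> b; rewrite !inE; apply/asboolP/eqP=> [|->//].
rewrite /f !(sign_orbitE h_inj h0 tO) // => e.
have : [set frame_datum h (F a *m sgn_mx Y) | Y in [set: word]] (frame_datum h (F b)).
  by rewrite -e; exists 0 => //; rewrite sgn_mx0 mulmx1.
case=> Y _ eY; apply/rowP=> k; rewrite -!eF -(eps_sgn (F a) Y).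
by apply: (frame_datum_eps h_inj h0 tO) => //; apply: sgn_frame.
Qed.

Theorem proposition6p8
    (h : 'I_3 -> H2) (h_inj : injective h) (h_neq0 : forall i, h i != 0)
    (O : 'I_3 -> {set 'I_24}) (O_trio : is_trio O) :
  [/\ [set datum_orbit h O sign_changes d | d in deletion_data h O] #= `I_8,
      forall d, deletion_data h O d -> datum_orbit h O sign_changes d #= `I_(2 ^ 19)
    & forall d, deletion_data h O d -> datum_orbit h O (Aut_trio O) d = deletion_data h O].
Proof.
split=> [|d|d].
- exact: card_sign_orbits.
- case/(deletion_data_frame h_inj h_neq0 O_trio) => T fT ->.
  rewrite (sign_orbitE h_inj h_neq0 O_trio fT).
  exact: (card_sign_orbit h_inj h_neq0 O_trio fT).
move=> /(deletion_data_frame h_inj h_neq0 O_trio)[T fT ->]; apply/seteqP; split=> d'.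
  case=> g [pi [[ig _] og ->]]; rewrite (act_frame_datum h_inj h_neq0 fT ig og).
  by apply: frame_deletion_data => //; apply: act_mx_frame fT ig og.
move=> /(deletion_data_frame h_inj h_neq0 O_trio)[T' fT' ->].
have [g [ag og <-]] := Aut_trio_transitive h_inj h_neq0 O_trio fT fT'.
by exists g, 1%g.
Qed.
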